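(* Let $\Omega\subset\mathbb{R}^n$ be a bounded domain and let $\phi\in\Phi_{\rm c}(\Omega)\cap C(\Omega\times[0,\infty))$ satisfy (A0), (aDec) and restricted (VA1). If $u\in \mathrm{BV}(\Omega)$, then $$\varrho_{V,\phi}(u)=\varrho_\phi(|\nabla^a u|)+\int_\Omega \phi'_\infty\, d|D^su| .$$
   Context: A bounded domain is a bounded, open and connected set; ''increasing'' means non-decreasing. $L^0(\Omega)$ is the set of measurable functions on $\Omega$. $\Phi_{\rm w}(\Omega)$ is the set of $\phi:\Omega\times[0,\infty)\to[0,\infty]$ such that for every $x\in\Omega$: $\phi(\cdot,|f|)$ is measurable for every $f\in L^0(\Omega)$; $t\mapsto\phi(x,t)$ is increasing; $\phi(x,0)=\lim_{t\to0^+}\phi(x,t)=0$ and $\lim_{t\to\infty}\phi(x,t)=\infty$; and there is $L\ge1$ independent of $x$ with $\frac{\phi(x,s)}{s}\le L\frac{\phi(x,t)}{t}$ for $0<s\le t$. $\Phi_{\rm c}(\Omega)$ is the set of those $\phi\in\Phi_{\rm w}(\Omega)$ such that $t\mapsto\phi(x,t)$ is convex and left-continuous for every $x\in\Omega$. Modulus of continuity: an increasing function $\omega:[0,\infty)\to[0,\infty]$ with $\omega(0)=\lim_{t\to0^+}\omega(t)=0$. (A0): there is $\beta\in(0,1]$ with $\phi(x,\beta)\le1\le\phi(x,\frac1\beta)$ for every $x\in\Omega$. (A1): for every $K>0$ there is $\beta\in(0,1]$ such that for all $x,y\in\Omega$, $\phi(x,\beta t)\le\phi(y,t)+1$ when $\phi(y,t)\in[0,\frac{K}{|x-y|^n}]$.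 Restricted (VA1): $\phi$ satisfies (A1) and for every $K>0$ there is a modulus of continuity $\omega$ such that $\phi(x,\frac{t}{1+\omega(|x-y|)})\le\phi(y,t)+\omega(|x-y|)$ when $\phi(y,t)\in[0,\frac{K}{|x-y|^n}]$, for all $x,y\in\Omega$ with $\phi'_\infty(x)<\infty$ or $\phi'_\infty(y)<\infty$. (aDec): for some $q>1$ there is $L_q\ge1$ such that $\frac{\phi(x,t)}{t^q}\le L_q\frac{\phi(x,s)}{s^q}$ for all $0<s\le t$ and $x\in\Omega$. Recession function: $\phi'_\infty(x):=\limsup_{t\to\infty}\frac{\phi(x,t)}{t}\in[0,\infty]$. Conjugate: $\phi^*(x,t):=\sup_{s\ge0}(st-\phi(x,s))$. Modular: $\varrho_\phi(f):=\int_\Omega\phi(x,|f|)\,dx$. Dual modular, for $u\in L^1(\Omega)$: $\varrho_{V,\phi}(u):=\sup\{\int_\Omega u\,\mathrm{div}\,w-\phi^*(x,|w|)\,dx \mid w\in C^1_0(\Omega;\mathbb{R}^n)\}$, where $C^1_0$ denotes $C^1$-functions with compact support in $\Omega$; the integral is $-\infty$ if $\int_\Omega\phi^*(x,|w|)\,dx=\infty$. For $u\in\mathrm{BV}(\Omega)$ the derivative measure $Du$ has the Lebesgue decomposition $Du=D^au+D^su$ into absolutely continuous and singular parts (with respect to Lebesgue measure); $\nabla^au$ is the density of $D^au$, and $|D^su|$ is the total variation measure of $D^su$. *)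

(* Defs.v *)
From HB Require Import structures.
From mathcomp Require Import all_boot all_order all_algebra.
From mathcomp Require Import all_classical all_reals all_analysis.
From mathcomp Require Import measurable_realfun.

Set Implicit Arguments.
Unset Strict Implicit.
Unset Printing Implicit Defensive.

Import Order.TTheory GRing.Theory Num.Theory.
Import numFieldNormedType.Exports.

Local Open Scope classical_set_scope.
Local Open Scope ring_scope.

Definition rV_display : measure_display. Proof. exact: default_measure_display. Qed.

Section measurable_rV.
Context {R : realType} {n : nat}.

(* As for [n.-tuple T] in the library: the sigma-algebra generated by the
   coordinates; it is the Borel sigma-algebra, see [measurable_rV_open] below. *)
Definition rV_measurable : set (set 'rV[R]_n) :=
  g_sigma_preimage (fun (i : 'I_n) (x : 'rV[R]_n) => x ord0 i).

Let rV_set0 : rV_measurable set0.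
Proof. exact: sigma_algebra0. Qed.

Let rV_setC A : rV_measurable A -> rV_measurable (~` A).
Proof. exact: sigma_algebraC. Qed.

Let rV_bigcup (F : (set 'rV[R]_n)^nat) : (forall i, rV_measurable (F i)) ->
  rV_measurable (\bigcup_i (F i)).
Proof. exact: sigma_algebra_bigcup. Qed.

HB.instance Definition _ := @isMeasurable.Build rV_display
  'rV[R]_n rV_measurable rV_set0 rV_setC rV_bigcup.

End measurable_rV.

Section measurable_rV_lemmas.
Context {R : realType}.

Lemma measurable_coord_rV n (i : 'I_n) :
  measurable_fun [set: 'rV[R]_n] (fun x : 'rV[R]_n => x ord0 i).
Proof.
move=> _ Y mY; rewrite setTI; apply: sub_sigma_algebra => /=.
rewrite -bigcup_seq/=; exists i => /=; first by rewrite mem_index_enum.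
by exists Y => //; rewrite setTI.
Qed.

Lemma measurable_fun_rV d (T : measurableType d) n (f : T -> 'rV[R]_n) :
  (forall i, measurable_fun setT (fun t => f t ord0 i)) -> measurable_fun setT f.
Proof.
move=> mf _ B mB; rewrite setTI.
suff : preimage_set_system setT f rV_measurable `<=` measurable.
  by apply; exists B => //; rewrite setTI.
rewrite /rV_measurable /= -g_sigma_preimage_comp.
apply: smallest_sub; first exact: sigma_algebra_measurable.
move=> A; rewrite -bigcup_seq => -[/= i _ [C mC <-]].
exact: mf.
Qed.

End measurable_rV_lemmas.

Section lebesgue_rV.
Context {R : realType}.

Definition cons_rV n (p : R * 'rV[R]_n) : 'rV[R]_n.+1 :=
  \row_i oapp (p.2 ord0) p.1 (unlift ord0 i).

Lemma cons_rV0 n (p : R * 'rV[R]_n) : cons_rV p ord0 ord0 = p.1.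
Proof. by rewrite mxE unlift_none. Qed.

Lemma cons_rVS n (p : R * 'rV[R]_n) (i : 'I_n) :
  cons_rV p ord0 (lift ord0 i) = p.2 ord0 i.
Proof. by rewrite mxE liftK. Qed.

Lemma measurable_cons_rV n : measurable_fun setT (@cons_rV n).
Proof.
apply: measurable_fun_rV => i; case: (unliftP ord0 i) => [j|] ->.
  under eq_fun do rewrite cons_rVS.
  exact: (measurableT_comp (measurable_coord_rV j) measurable_snd).
under eq_fun do rewrite cons_rV0.
exact: measurable_fst.
Qed.

Section step.
Variables (n : nat) (mu : {measure set 'rV[R]_n -> \bar R}).

Definition lebesgue_rV_step : set 'rV[R]_n.+1 -> \bar R :=
  pushforward ((@lebesgue_measure R) \x^ mu)%E (@cons_rV n).

Let step0 : lebesgue_rV_step set0 = 0%E.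
Proof. by rewrite /lebesgue_rV_step /pushforward preimage_set0 measure0. Qed.

Let step_ge0 A : (0 <= lebesgue_rV_step A)%E.
Proof. by rewrite /lebesgue_rV_step /pushforward measure_ge0. Qed.

Let step_sigma_additive : semi_sigma_additive lebesgue_rV_step.
Proof.
move=> F mF tF mUF.
exact: (@measure_semi_sigma_additive _ _ _
  (measure_function_pushforward__canonical__measure_function_Measure
     ((@lebesgue_measure R) \x^ mu)%E (@measurable_cons_rV n))).
Qed.

HB.instance Definition _ := isMeasure.Build _ _ _ lebesgue_rV_step
  step0 step_ge0 step_sigma_additive.

End step.

(* n-fold product of the one-dimensional Lebesgue measure; characterised on
   boxes by [lebesgue_rV_box]. *)
Fixpoint lebesgue_rV (n : nat) : {measure set 'rV[R]_n -> \bar R} :=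
  match n with
  | 0 => \d_(0 : 'rV[R]_0)
  | m.+1 => lebesgue_rV_step (lebesgue_rV m)
  end.

Lemma lebesgue_rV_box n (A : 'I_n -> set R) : (forall i, measurable (A i)) ->
  lebesgue_rV n [set x | forall i, A i (x ord0 i)] =
  (\prod_(i < n) lebesgue_measure (A i))%E.
Proof.
elim: n A => [|n IH] A mA.
  by rewrite big_ord0 /= diracE mem_set// => -[].
have mB : measurable [set y : 'rV[R]_n | forall i, A (lift ord0 i) (y ord0 i)].
  rewrite (_ : [set _ | _] = \bigcap_(i in [set: 'I_n])
      ((fun x : 'rV[R]_n => x ord0 i) @^-1` A (lift ord0 i))); last first.
    by apply/seteqP; split => x /= xA i; [move=> _|]; exact: xA.
  apply: fin_bigcap_measurable => // i _.
  by rewrite -[X in measurable X]setTI; exact: measurable_coord_rV.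
rewrite big_ord_recl -IH; last by move=> i; exact: mA.
have := product_measure2E (@lebesgue_measure R) (lebesgue_rV n) (mA ord0) mB.
move=> /= <-; rewrite /lebesgue_rV_step /pushforward.
congr (_ _); apply/seteqP; split => [[x y]/= xy|[x y]/= [x0 xy] i].
  split; first by have := xy ord0; rewrite cons_rV0.
  by move=> i; have := xy (lift ord0 i); rewrite cons_rVS.
by case: (unliftP ord0 i) => [j|] ->; rewrite ?cons_rVS ?cons_rV0.
Qed.

End lebesgue_rV.

Section measurable_rV_open.
Context {R : realType} {n : nat}.

Lemma open_measurable_rV (A : set 'rV[R]_n) : open A -> measurable A.
Proof.
move=> oA.
pose q (x : 'rV[rat]_n) : 'rV[R]_n := map_mx ratr x.
pose B (p : 'rV[rat]_n * nat) : set 'rV[R]_n :=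
  if `[< ball (q p.1) p.2.+1%:R^-1 `<=` A >] then ball (q p.1) p.2.+1%:R^-1 else set0.
have -> : A = \bigcup_p B p.
  apply/seteqP; split => [x Ax|x [p _]]; last first.
    by rewrite /B; case: asboolP => // + ?; exact.
  have [e /= e0 xeA] : exists2 e : R, 0 < e & ball x e `<=` A.
    by have /nbhs_ballP[e /= e0 xeA] := open_nbhs_nbhs (conj oA Ax); exists e.
  have [k kP] : exists k : nat, k.+1%:R^-1 < e / 2.
    have e20 : 0 < e / 2 by rewrite divr_gt0.
    near \oo => k; exists k; near: k.
    exact: (near_infty_natSinv_lt (PosNum e20)).
  have k0 : (0 : R) < k.+1%:R^-1 by rewrite invr_gt0.
  have /choice[r rP] (i : 'I_n) : exists r : rat, ball (x ord0 i) k.+1%:R^-1 (ratr r).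
    have [z [/= xr [r _ rE]]] := @dense_rat R (ball (x ord0 i) k.+1%:R^-1)
       (ex_intro _ _ (ballxx _ k0)) (ball_open _ _).
    by exists r; rewrite rE.
  have qx : ball x k.+1%:R^-1 (q (\row_i r i)).
    by split => // i j; rewrite !mxE (ord1 i); exact: rP.
  exists (\row_i r i, k) => //; rewrite /B /=; case: asboolP => [_|[]].
    exact: ball_sym.
  move=> y qy; apply: xeA; rewrite [e]splitr; apply: ball_triangle.
    by apply: le_ball qx; exact: ltW.
  by apply: le_ball qy; exact: ltW.
apply: countable_bigcupT_measurable => [|p]; first exact: countableP.
rewrite /B; case: asboolP => _; last exact: measurable0.
have -> : ball (q p.1) p.2.+1%:R^-1 = \bigcap_(i in [set: 'I_n])
    ((fun x : 'rV[R]_n => x ord0 i) @^-1` ball (q p.1 ord0 i) p.2.+1%:R^-1).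
  apply/seteqP; split => [x [_ qx] i _|x qx]; first exact: qx.
  by split => // i j; rewrite (ord1 i); exact: qx.
apply: fin_bigcap_measurable => // i _.
rewrite -[X in measurable X]setTI; apply: measurable_coord_rV => //.
exact: measurable_ball.
Unshelve. all: by end_near. Qed.

Lemma measurable_rV_open : @measurable _ 'rV[R]_n = <<s @open 'rV[R]_n >>.
Proof.
apply/seteqP; split; last first.
  apply: smallest_sub; first exact: sigma_algebra_measurable.
  exact: open_measurable_rV.
apply: smallest_sub; first exact: smallest_sigma_algebra.
move=> A; rewrite -bigcup_seq => -[/= i _ [C mC <-]].
suff : measurable `<=`
    image_set_system setT (fun x : 'rV[R]_n => x ord0 i) <<s @open 'rV[R]_n >>.
  by apply.
rewrite [X in X `<=` _](_ : _ = (@RGenOpens.G R).-sigma.-measurable); last first.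
  exact: RGenOpens.measurableE.
apply: smallest_sub.
  exact/sigma_algebra_image/smallest_sigma_algebra.
move=> _ [x [y ->]]; apply: sub_sigma_algebra; rewrite setTI.
by apply: open_comp => [? _|]; [exact: coord_continuous|exact: itv_open].
Qed.

End measurable_rV_open.

(* The library's norm on ['rV[R]_n] is the sup norm. *)
Definition enorm {R : realType} {n : nat} (x : 'rV[R]_n) : R :=
  Num.sqrt (\sum_(i < n) x ord0 i ^+ 2).

Definition bounded_domain {R : realType} {n : nat} (Omega : set 'rV[R]_n) : Prop :=
  [/\ bounded_set Omega, open Omega & connected Omega].

Definition partial_deriv {R : realType} {n : nat} (w : 'rV[R]_n -> 'rV[R]_n)
    (i j : 'I_n) (x : 'rV[R]_n) : R :=
  'D_(delta_mx ord0 j) (fun y => w y ord0 i) x.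

Definition divergence {R : realType} {n : nat} (w : 'rV[R]_n -> 'rV[R]_n)
    (x : 'rV[R]_n) : R :=
  \sum_(i < n) partial_deriv w i i x.

Definition continuously_differentiable {R : realType} {n : nat}
    (w : 'rV[R]_n -> 'rV[R]_n) : Prop :=
  forall i j : 'I_n,
    (forall x, derivable (fun y => w y ord0 i) x (delta_mx ord0 j)) /\
    continuous (partial_deriv w i j).

(* C^1_0(Omega; R^n), each field being extended by zero outside Omega. *)
Definition C1_0 {R : realType} {n : nat} (Omega : set 'rV[R]_n)
    (w : 'rV[R]_n -> 'rV[R]_n) : Prop :=
  [/\ continuously_differentiable w,
      compact (closure [set x | w x != 0]) &
      closure [set x | w x != 0] `<=` Omega].

(* A function Omega x [0, oo) -> [0, oo] is represented by a total
   [phi : 'rV[R]_n -> R -> \bar R]; only its values at x in Omega and t >= 0 are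
   ever constrained or used. *)
Section Phi.
Context {R : realType} {n : nat}.
Implicit Types (Omega : set 'rV[R]_n) (phi : 'rV[R]_n -> R -> \bar R).

Local Open Scope ereal_scope.

Definition Phi_w Omega phi : Prop :=
  [/\ forall x (t : R), Omega x -> (0 <= t)%R -> 0 <= phi x t,
      forall f : 'rV[R]_n -> R, measurable_fun Omega f ->
        measurable_fun Omega (fun x => phi x `|f x|%R),
      forall x (s t : R), Omega x -> (0 <= s)%R -> (s <= t)%R -> phi x s <= phi x t,
      forall x, Omega x ->
        [/\ phi x 0%R = 0, phi x t @[t --> (0 : R)^'+] --> 0 &
            phi x t @[t --> +oo%R] --> +oo] &
      exists2 L : R, (1 <= L)%R &
        forall x (s t : R), Omega x -> (0 < s)%R -> (s <= t)%R ->
          phi x s / s%:E <= L%:E * (phi x t / t%:E)].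

Definition Phi_c Omega phi : Prop :=
  [/\ Phi_w Omega phi,
      forall x (s t l : R), Omega x -> (0 <= s)%R -> (0 <= t)%R ->
        (0 <= l)%R -> (l <= 1)%R ->
        phi x (l * s + (1 - l) * t)%R <= l%:E * phi x s + (1 - l)%:E * phi x t &
      forall x (t : R), Omega x -> (0 < t)%R -> phi x s @[s --> t^'-] --> phi x t].

Definition jointly_continuous Omega phi : Prop :=
  {within Omega `*` [set t : R | (0 <= t)%R],
    continuous (fun p : 'rV[R]_n * R => phi p.1 p.2)}.

Definition A0 Omega phi : Prop :=
  exists beta : R, [/\ (0 < beta)%R, (beta <= 1)%R &
    forall x, Omega x -> phi x beta <= 1 /\ 1 <= phi x (1 / beta)%R].

(* phi(y, t) lies in [0, K / |x - y|^n]; in [\bar R], K / 0 = +oo for K > 0. *)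
Definition in_range phi (K : R) (x y : 'rV[R]_n) (t : R) : Prop :=
  0 <= phi y t <= K%:E / (enorm (x - y) ^+ n)%:E.

Definition A1 Omega phi : Prop :=
  forall K : R, (0 < K)%R ->
    exists beta : R, [/\ (0 < beta)%R, (beta <= 1)%R &
      forall x y (t : R), Omega x -> Omega y -> (0 <= t)%R -> in_range phi K x y t ->
        phi x (beta * t)%R <= phi y t + 1].

Definition aDec Omega phi : Prop :=
  exists2 q : R, (1 < q)%R &
    exists2 Lq : R, (1 <= Lq)%R &
      forall x (s t : R), Omega x -> (0 < s)%R -> (s <= t)%R ->
        phi x t / (t `^ q)%:E <= Lq%:E * (phi x s / (s `^ q)%:E).

Definition modulus_of_continuity (omega : R -> \bar R) : Prop :=
  [/\ forall r : R, (0 <= r)%R -> 0 <= omega r,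
      forall r s : R, (0 <= r)%R -> (r <= s)%R -> omega r <= omega s,
      omega 0%R = 0 &
      omega r @[r --> (0 : R)^'+] --> 0].

Definition recession phi (x : 'rV[R]_n) : \bar R :=
  limf_esup (fun t : R => phi x t / t%:E) +oo%R.

(* [fine] is harmless below: t / (1 + omega) is finite, and it is 0 when
   omega = +oo. *)
Definition restricted_VA1 Omega phi : Prop :=
  A1 Omega phi /\
  forall K : R, (0 < K)%R ->
    exists2 omega : R -> \bar R, modulus_of_continuity omega &
      forall x y (t : R), Omega x -> Omega y -> (0 <= t)%R ->
        recession phi x < +oo \/ recession phi y < +oo ->
        in_range phi K x y t ->
        phi x (fine (t%:E / (1 + omega (enorm (x - y)))))
          <= phi y t + omega (enorm (x - y)).

Definition conjugate phi (x : 'rV[R]_n) (t : R) : \bar R :=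
  ereal_sup [set (s * t)%:E - phi x s | s in [set s : R | (0 <= s)%R]].

Definition modular Omega phi (f : 'rV[R]_n -> R) : \bar R :=
  \int[lebesgue_rV n]_(x in Omega) phi x `|f x|%R.

Definition dual_functional Omega phi (u : 'rV[R]_n -> R)
    (w : 'rV[R]_n -> 'rV[R]_n) : \bar R :=
  if \int[lebesgue_rV n]_(x in Omega) conjugate phi x (enorm (w x)) == +oo
  then -oo
  else \int[lebesgue_rV n]_(x in Omega)
         ((u x * divergence w x)%:E - conjugate phi x (enorm (w x))).

Definition dual_modular Omega phi (u : 'rV[R]_n -> R) : \bar R :=
  ereal_sup [set dual_functional Omega phi u w | w in C1_0 Omega].

End Phi.

Section integral_charge.
Context d (T : measurableType d) (R : realType).
Implicit Types (nu : {charge set T -> \bar R}).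

Local Open Scope ereal_scope.

Definition hahn_positive nu : set T := projT1 (cid (Hahn_decomposition nu)).

Definition hahn_negative nu : set T :=
  projT1 (cid (projT2 (cid (Hahn_decomposition nu)))).

Lemma hahn_chosen nu :
  hahn_decomposition nu (hahn_positive nu) (hahn_negative nu).
Proof. exact: projT2 (cid (projT2 (cid (Hahn_decomposition nu)))). Qed.

(* Integral with respect to a signed measure, by Jordan decomposition; it does not
   depend on the Hahn decomposition by [Hahn_decomposition_uniq]. *)
Definition integral_charge nu (D : set T) (f : T -> R) : \bar R :=
  \int[jordan_pos (hahn_chosen nu)]_(x in D) (f x)%:E -
  \int[jordan_neg (hahn_chosen nu)]_(x in D) (f x)%:E.

End integral_charge.

(* An R^n-valued finite Borel measure, given by its components. Such measures are
   taken on the whole of R^n, but only their restriction to Omega is ever used. *)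
Notation vector_measure R n := ('I_n -> {charge set 'rV[R]_n -> \bar R}).

Section BV.
Context {R : realType} {n : nat}.
Implicit Types (Omega : set 'rV[R]_n) (u : 'rV[R]_n -> R).

Local Open Scope ereal_scope.

Definition vector_value (nu : vector_measure R n) (A : set 'rV[R]_n) : 'rV[R]_n :=
  \row_(i < n) fine (nu i A).

(* Supremum over countable measurable partitions; since nu(set0) = 0 and terms are
   nonnegative, families covering only part of [B] do not change it. *)
Definition vector_variation (nu : vector_measure R n) (B : set 'rV[R]_n) : \bar R :=
  ereal_sup [set \sum_(k <oo) (enorm (vector_value nu (F k)))%:E | F in
    [set F : (set 'rV[R]_n)^nat | [/\ forall k, measurable (F k),
       trivIset setT F & \bigcup_k F k `<=` B]]].

Definition is_derivative_measure Omega u (Du : vector_measure R n) : Prop :=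
  forall w, C1_0 Omega w ->
    \int[lebesgue_rV n]_(x in Omega) (u x * divergence w x)%:E =
    - \sum_(i < n) integral_charge (Du i) Omega (fun x => w x ord0 i).

(* Ambrosio, Fusco and Pallara, Functions of Bounded Variation and Free
   Discontinuity Problems, Definition 3.1. *)
Definition BV Omega u : Prop :=
  (lebesgue_rV n).-integrable Omega (EFin \o u) /\
  exists Du, is_derivative_measure Omega u Du.

(* Du = g dx + Ds on Omega with Ds singular with respect to Lebesgue measure. *)
Definition is_lebesgue_decomposition Omega (Du : vector_measure R n)
    (g : 'rV[R]_n -> 'rV[R]_n) (Ds : vector_measure R n) : Prop :=
  [/\ forall i, (lebesgue_rV n).-integrable Omega (fun x => (g x ord0 i)%:E),
      forall i A, measurable A -> A `<=` Omega ->
        Du i A = \int[lebesgue_rV n]_(x in A) (g x ord0 i)%:E + Ds i A &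
      exists N, [/\ measurable N, lebesgue_rV n N = 0 &
        forall i A, measurable A -> A `<=` Omega `\` N -> Ds i A = 0]].

End BV.

(* Main.v *)
(* Write f = phi(x, .), T = phi'_infty, Ds = s tau with tau finite and s = 0 off a
   Lebesgue-null set N, so that |Ds| = |s| tau.  Replacing w by -w, the dual functional is
     J(w) = int (w . g - phi^*(x, |w|)) dx + int w . s dtau.
   Upper bound: Young's inequality gives w . g - phi^*(x, |w|) <= phi(x, |g|), and
   restricted (VA1) forces |w| <= T at every point as soon as phi^*(x, |w|) is integrable,
   since otherwise phi^*(y, |w y|) >= c / |x - y|^n - 1 near some point x.
   Lower bound: let S_A = f(A + 1) - f(A), a continuous function of x that increases to T
   with A.  For 0 <= t <= S_A the conjugate phi^*(x, t) is bounded and (A + 1)-Lipschitz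
   in t, so J is L^1-continuous on the fields with |w| <= S_A.  In this class an almost
   optimal field is S_A s / |s| on N, and q g / |g| on {|g| <= A} outside N, where
   q = (f(|g| + h) - f(|g|)) / h, because t q - f(t) <= q |g| - f(|g|) + h q for all t.
   It is approximated, with the same constraint, by C^1 fields with compact support:
   round it to finitely many values, replace the level sets by compact subsets and
   interpolate between these.  Finally A -> oo. *)

Require Import Defs.
From HB Require Import structures.
From mathcomp Require Import all_boot all_order all_algebra.
From mathcomp Require Import finmap.
From mathcomp Require Import all_classical all_reals all_analysis.
From mathcomp Require Import measurable_realfun ring lra.

Set Implicit Arguments.
Unset Strict Implicit.
Unset Printing Implicit Defensive.

Import Order.TTheory GRing.Theory Num.Theory.
Import numFieldNormedType.Exports.

Local Open Scope classical_set_scope.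
Local Open Scope ring_scope.

(** * Euclidean norm and convex functions *)

(** The bound [|w| <= S_A] has to survive the approximation exactly: above the recession function
    the conjugate is [+oo], so a field that exceeds it slightly may have functional [-oo].
    Mollification does not respect such a pointwise bound, but convex combinations of constant
    vectors do, if each vector is used only where its length is below [S_A]; hence the gluing of
    finitely many values. This needs [{c < S_A}] to be open, which is why [S_A] is a unit increment
    of [phi x] and not a derivative: a derivative need not depend continuously on x. (A0) and (aDec)
    make [phi] finite and bounded in x for fixed t, hence [S_A] bounded. The quotient q is
    admissible because [|g| <= A] and [h <= 1] give [q <= S_A] by convexity. One finite measure,
    [(|g| + A + 1) dx + |s| tau], controls the cost of passing from the optimal field to a C1 field
    on the absolutely continuous and the singular part at once. The representation [Ds = s tau] is
    not normalised: tau only dominates all components, and [|s| tau] is shown to be the total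
    variation. *)

Lemma continuous_sumr (R : realType) (T : topologicalType) I (r : seq I)
    (F : I -> T -> R) :
  (forall i, continuous (F i)) -> continuous (fun x => \sum_(i <- r) F i x).
Proof.
by move=> cF; apply: continuous_big => // x; exact: add_continuous.
Qed.

Section euclidean_norm.
Context {R : realType} {n : nat}.
Implicit Types (x y z : 'rV[R]_n) (a : R).

Definition dot x y : R := \sum_(i < n) x ord0 i * y ord0 i.

Lemma enorm_ge0 x : 0 <= enorm x.
Proof. exact: sqrtr_ge0. Qed.

Lemma sqr_enorm x : enorm x ^+ 2 = dot x x.
Proof.
rewrite sqr_sqrtr; first by apply: eq_bigr => i _; rewrite expr2.
by apply: sumr_ge0 => i _; exact: sqr_ge0.
Qed.

Lemma enorm0 : enorm (0 : 'rV[R]_n) = 0.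
Proof. by rewrite /enorm big1 ?sqrtr0// => i _; rewrite mxE expr0n. Qed.

Lemma enormZ a x : enorm (a *: x) = `|a| * enorm x.
Proof.
rewrite /enorm -sqrtr_sqr -sqrtrM ?sqr_ge0// mulr_sumr; congr Num.sqrt.
by apply: eq_bigr => i _; rewrite mxE exprMn.
Qed.

Lemma enormN x : enorm (- x) = enorm x.
Proof. by rewrite -scaleN1r enormZ normrN1 mul1r. Qed.

Lemma coord_le_enorm x i : `|x ord0 i| <= enorm x.
Proof.
rewrite -sqrtr_sqr ler_wsqrtr// (bigD1 i)//= lerDl sumr_ge0// => j _.
exact: sqr_ge0.
Qed.

Lemma enorm_eq0 x : enorm x = 0 -> x = 0.
Proof.
move=> x0; apply/rowP => i; rewrite mxE; apply/eqP; rewrite -normr_le0 -x0.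
exact: coord_le_enorm.
Qed.

Lemma dotNl x y : dot (- x) y = - dot x y.
Proof. by rewrite /dot -sumrN; apply: eq_bigr => i _; rewrite mxE mulNr. Qed.

Lemma dotBl x y z : dot (x - y) z = dot x z - dot y z.
Proof.
by rewrite /dot -sumrB; apply: eq_bigr => i _; rewrite !mxE mulrBl.
Qed.

Lemma dotZl a x y : dot (a *: x) y = a * dot x y.
Proof. by rewrite /dot mulr_sumr; apply: eq_bigr => i _; rewrite mxE mulrA. Qed.

Lemma dotC x y : dot x y = dot y x.
Proof. by apply: eq_bigr => i _; rewrite mulrC. Qed.

Lemma dot0l x : dot 0 x = 0.
Proof. by rewrite /dot big1// => i _; rewrite mxE mul0r. Qed.

(** Cauchy-Schwarz, from the nonnegative squared norm of [y] minus its projection on [x]. *)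
Lemma dot_le x y : dot x y <= enorm x * enorm y.
Proof.
have [/enorm_eq0 ->|x0] := eqVneq (enorm x) 0; first by rewrite dot0l enorm0 mul0r.
have {}x0 : 0 < enorm x by rewrite lt0r x0 enorm_ge0.
have : 0 <= dot (y - (dot x y / enorm x ^+ 2) *: x)
                (y - (dot x y / enorm x ^+ 2) *: x).
  by rewrite -sqr_enorm sqr_ge0.
rewrite dotBl dotZl !(dotC _ (_ - _)) !dotBl !dotZl -!sqr_enorm (dotC y x).
set a := enorm x in x0 *; set b := enorm y; set d := dot x y.
have -> : b ^+ 2 - d / a ^+ 2 * d - d / a ^+ 2 * (d - d / a ^+ 2 * a ^+ 2)
          = b ^+ 2 - d ^+ 2 / a ^+ 2.
  by field; rewrite gt_eqF.
rewrite subr_ge0 ler_pdivrMr ?exprn_gt0// -exprMn => dab.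
have [d0|/ltW d0] := leP 0 d; last first.
  by rewrite (le_trans d0)// mulr_ge0// ?enorm_ge0// ltW.
by rewrite -(@ler_pXn2r _ 2)// ?nnegrE// ?mulr_ge0// ?enorm_ge0// ?(ltW x0)// mulrC.
Qed.

Lemma normr_dot_le x y : `|dot x y| <= enorm x * enorm y.
Proof. by rewrite ler_norml dot_le andbT lerNl -dotNl -(enormN x) dot_le. Qed.

Lemma enormD x y : enorm (x + y) <= enorm x + enorm y.
Proof.
rewrite -(@ler_pXn2r _ 2)// ?nnegrE ?addr_ge0 ?enorm_ge0//.
have -> : enorm (x + y) ^+ 2 = enorm x ^+ 2 + enorm y ^+ 2 + dot x y *+ 2.
  rewrite !sqr_enorm /dot -mulr_natr mulr_suml -!big_split/=.
  by apply: eq_bigr => i _; rewrite !mxE; ring.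
by have := dot_le x y; rewrite sqrrD; lra.
Qed.

Lemma enormB x y : enorm (x - y) = enorm (y - x).
Proof. by rewrite -enormN opprB. Qed.

Lemma ler_enorm_dist x y : `|enorm x - enorm y| <= enorm (x - y).
Proof.
have := enormD (x - y) y; have := enormD (y - x) x.
by rewrite !subrK ler_norml (enormB y); lra.
Qed.

Lemma enorm_le_coords x a : (forall i, `|x ord0 i| <= a) -> enorm x <= n%:R * a.
Proof.
(* For [n = 0] the hypothesis is empty and [a] may be negative. *)
move=> xa; have [n0|n0] := posnP n.
  have -> : n%:R * a = 0 by rewrite n0 mul0r.
  rewrite /enorm big1 ?sqrtr0//.
  by move=> i _; have := leq_trans (ltn_ord i) (eq_leq n0).
have a0 : 0 <= a by rewrite (le_trans _ (xa (Ordinal n0))).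
rewrite -(@ger0_norm _ (n%:R * a)) ?mulr_ge0// -sqrtr_sqr ler_wsqrtr//.
rewrite exprMn (@le_trans _ _ (n%:R * a ^+ 2))//.
  rewrite mulr_natl -[leRHS](_ : \sum_(i < n) a ^+ 2 = _); last first.
    by rewrite sumr_const card_ord.
  apply: ler_sum => i _.
  by rewrite -real_normK ?num_real// lerXn2r ?nnegrE//.
by rewrite ler_wpM2r ?sqr_ge0// expr2 ler_peMl ?ler1n.
Qed.

Lemma enorm_le_sum x : enorm x <= \sum_i `|x ord0 i|.
Proof.
have S0 : 0 <= \sum_i `|x ord0 i| by exact: sumr_ge0.
rewrite -(ger0_norm S0) -sqrtr_sqr ler_wsqrtr// [leRHS]expr2 mulr_suml.
apply: ler_sum => i _; rewrite -real_normK ?num_real// expr2 ler_wpM2l//.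
by rewrite (bigD1 i)//= lerDl sumr_ge0.
Qed.

Lemma coord_le_norm x i : `|x ord0 i| <= `|x|.
Proof.
rewrite [leRHS]/Num.norm /= mx_normrE.
by apply/bigmax_geP; right => /=; exists (ord0, i).
Qed.

Lemma enorm_le_norm x : enorm x <= n%:R * `|x|.
Proof. by apply: enorm_le_coords => i; exact: coord_le_norm. Qed.

Lemma coord_continuous_rV i : continuous (fun x : 'rV[R]_n => x ord0 i).
Proof. exact: coord_continuous. Qed.

End euclidean_norm.

Lemma measurable_dot (R : realType) n d (T : measurableType d) (D : set T)
    (f g : T -> 'rV[R]_n) :
  (forall i, measurable_fun D (fun x => f x ord0 i)) ->
  (forall i, measurable_fun D (fun x => g x ord0 i)) ->
  measurable_fun D (fun x => dot (f x) (g x)).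
Proof. by move=> mf mg; apply: measurable_sum => i; exact: measurable_funM. Qed.

Lemma measurable_enorm (R : realType) n d (T : measurableType d) (D : set T)
    (f : T -> 'rV[R]_n) :
  (forall i, measurable_fun D (fun x => f x ord0 i)) ->
  measurable_fun D (fun x => enorm (f x)).
Proof.
move=> mf.
have msqrt : measurable_fun setT (@Num.sqrt R).
  by apply: continuous_measurable_fun; exact: sqrt_continuous.
apply: (measurableT_comp msqrt).
by apply: measurable_sum => i; exact: measurable_funX.
Qed.

Section convex_function.
Context {R : realType} (F : R -> R).
Hypothesis F0 : F 0 = 0.
Hypothesis F_ge0 : forall t, 0 <= t -> 0 <= F t.
Hypothesis F_nd : forall s t, 0 <= s -> s <= t -> F s <= F t.
Hypothesis F_convex : forall s t l, 0 <= s -> 0 <= t -> 0 <= l -> l <= 1 ->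
  F (l * s + (1 - l) * t) <= l * F s + (1 - l) * F t.

(** Convexity with the denominators cleared, degenerate intervals included. The slope inequalities
    below are linear or bilinear consequences of it. *)
Lemma convex_chord a b c : 0 <= a -> a <= b -> b <= c ->
  (c - a) * F b <= (c - b) * F a + (b - a) * F c.
Proof.
move=> a0 ab bc; have [ca|ac] := leP c a.
  have -> : b = a by lra.
  have -> : c = a by lra.
  lra.
have ca0 : 0 < c - a by lra.
have := @F_convex a c ((c - b) / (c - a)) a0.
rewrite ler_pdivrMr// mul1r divr_ge0 ?subr_ge0//; last lra.
have -> : (c - b) / (c - a) * a + (1 - (c - b) / (c - a)) * c = b.
  by field; rewrite gt_eqF.
move=> /(_ ltac:(lra) isT ltac:(lra)).
rewrite -(ler_pM2l ca0) => /le_trans; apply.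
rewrite le_eqVlt; apply/orP; left; apply/eqP.
by field; rewrite gt_eqF.
Qed.

(** The line through [(a, F a)] with the slope of the chord over [[a, a + h]] lies below the graph
    outside [(a, a + h)]. Between these points monotonicity gives [F a <= F t], and the loss is at
    most slope times [h]. *)
Lemma convex_slope_conj a h t : 0 <= a -> 0 < h -> 0 <= t ->
  (F (a + h) - F a) / h * t - F t <=
  (F (a + h) - F a) / h * a - F a + (F (a + h) - F a).
Proof.
move=> a0 h0 t0; set s := (F (a + h) - F a) / h.
have sh : F (a + h) - F a = s * h by rewrite divfK// gt_eqF.
have s0 : 0 <= s by rewrite divr_ge0 ?subr_ge0 ?F_nd// ?lerDl ltW.
rewrite sh; have [ta|at_] := leP t a.
  have : (a + h - t) * F a <= h * F t + (a - t) * (F a + s * h).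
    have := @convex_chord t a (a + h) t0 ta.
    rewrite (_ : F (a + h) = F a + s * h); last by lra.
    by rewrite [a + h - a]addrAC subrr add0r; apply; lra.
  by nra.
have [tah|aht] := leP t (a + h).
  have := F_nd a0 (ltW at_); have : s * t <= s * (a + h) by apply: ler_wpM2l.
  by nra.
have : (t - a) * (F a + s * h) <= (t - (a + h)) * F a + h * F t.
  have := @convex_chord a (a + h) t a0.
  rewrite (_ : F (a + h) = F a + s * h); last by lra.
  by rewrite [a + h - a]addrAC subrr add0r; apply; lra.
by nra.
Qed.

(** Both chords are compared with the one over [[a, b + k]], so the two intervals may overlap. *)
Lemma convex_slope_le a b h k : 0 <= a -> a <= b -> 0 < h -> a + h <= b + k ->
  0 < k -> (F (a + h) - F a) / h <= (F (b + k) - F b) / k.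
Proof.
move=> a0 ab h0 ahbk k0; rewrite ler_pdivrMr// mulrAC ler_pdivlMr//.
have := @convex_chord a (a + h) (b + k) a0 ltac:(lra) ahbk.
have := @convex_chord a b (b + k) a0 ab ltac:(lra).
have bka : 0 < b + k - a by lra.
move=> H1 H2; rewrite -(ler_pM2r bka); nra.
Qed.

Lemma convex_increment_nd a b : 0 <= a -> a <= b ->
  F (a + 1) - F a <= F (b + 1) - F b.
Proof.
move=> a0 ab; have := @convex_slope_le a b 1 1 a0 ab.
by rewrite !divr1; apply => //; lra.
Qed.

(** For such [s] the supremum defining the conjugate can be taken over [[0, A + 1]]; hence the
    Lipschitz constant [A + 1] of the conjugate. *)
Lemma convex_increment_conj A s t : 0 <= A -> 0 <= s -> s <= F (A + 1) - F A ->
  A + 1 <= t -> s * t - F t <= s * (A + 1) - F (A + 1).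
Proof.
move=> A0 s0 sA At.
have := @convex_chord A (A + 1) t A0 ltac:(lra) At.
rewrite [A + 1 - A]addrAC subrr add0r; nra.
Qed.

Lemma convex_increment_le A t : 0 <= A -> A < t ->
  A + 1 <= t -> (F (A + 1) - F A) * (t - A) <= F t.
Proof.
move=> A0 At A1t.
have := @convex_chord A (A + 1) t A0 ltac:(lra) A1t.
have := F_ge0 A0.
rewrite [A + 1 - A]addrAC subrr add0r; nra.
Qed.

(** As [F 0 = 0], the ratio is the slope of the chord over [[0, A]]. This half of a sandwich lets
    increments replace ratios in the recession function. *)
Lemma convex_ratio_le_increment A : 0 < A -> F A / A <= F (A + 1) - F A.
Proof.
move=> A0; have := @convex_slope_le 0 A A 1 (lexx 0) (ltW A0) A0.
by rewrite !add0r F0 subr0 divr1; apply => //; lra.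
Qed.

Lemma convex_ratio_nd s t : 0 < s -> s <= t -> F s / s <= F t / t.
Proof.
move=> s0 st; rewrite ler_pdivrMr// mulrAC ler_pdivlMr ?(lt_le_trans s0)//.
have := @convex_chord 0 s t (lexx 0) (ltW s0) st; rewrite F0; nra.
Qed.

End convex_function.

(** * Functions and fields of class C1 *)

Section positive_part_square.
Context {R : realType}.

(** The square of the positive part. Test fields are only C1, so it can serve as the profile of bump
    functions. *)
Definition pos_sqr (t : R) : R := t * Num.max 0 t.

Lemma pos_sqr_ge0 t : 0 <= pos_sqr t.
Proof. by rewrite /pos_sqr; have [t0|t0] := leP 0 t; nra. Qed.

Lemma pos_sqr_gt0 t : (0 < pos_sqr t) = (0 < t).
Proof.
rewrite /pos_sqr; have [t0|t0] := ltP 0 t; first by rewrite mulr_gt0.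
by rewrite mulr0 ltxx.
Qed.

Lemma pos_sqr_le0 t : t <= 0 -> pos_sqr t = 0.
Proof. by move=> t0; rewrite /pos_sqr max_l// mulr0. Qed.

Lemma continuous_max0 : continuous (fun t : R => Num.max 0 t).
Proof.
by move=> t; apply: (@continuous_max R _ (cst 0) id);
  [exact: cvg_cst|exact: cvg_id].
Qed.

Lemma is_derive_pos_sqr (t : R) : is_derive t 1 pos_sqr (2 * Num.max 0 t).
Proof.
have [t0|t0|->] := ltgtP t 0.
- rewrite mulr0.
  apply: (near_eq_is_derive _ (is_derive_cst (0 : R) t 1)).
  near=> s; rewrite /= pos_sqr_le0// ltW//; near: s; exact: lt_nbhsl.
- have : is_derive t (1 : R) (id * id : R -> R) (t *: 1 + t *: 1).
    exact: is_deriveM.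
  rewrite -[t *: 1 + _](_ : 2 * t = _); last by rewrite /GRing.scale/=; ring.
  apply: near_eq_is_derive; near=> s.
  have s0 : 0 < s by near: s; exact: lt_nbhsr.
  by rewrite /pos_sqr max_r// ltW.
- rewrite mulr0.
  (* At 0 the difference quotient is [Num.max 0 s] itself, which tends to 0. *)
  have h : (fun h : R => h^-1 *: ((pos_sqr \o shift 0) (h *: 1) - pos_sqr 0)) @ 0^'
      --> (0 : R).
    apply: (@cvg_trans _ ((fun t : R => Num.max 0 t) @ 0^')).
      apply: near_eq_cvg; near=> s.
      have s0 : s != 0 by near: s; exact: nbhs_dnbhs_neq.
      rewrite /= addr0 /pos_sqr mul0r subr0 /GRing.scale/= mulr1 mulrA.
      by rewrite mulVf// mul1r.
    apply: cvg_within_filter.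
    by have := @continuous_max0 0; rewrite /continuous_at maxxx.
  apply: DeriveDef; first by apply/cvg_ex; exists 0.
  exact: cvg_lim h.
Unshelve. all: by end_near. Qed.

End positive_part_square.

Section C1_functions.
Context {R : realType} {n : nat}.
Implicit Types f g : 'rV[R]_n -> R.

Local Notation e_ := (delta_mx ord0).

Definition C1 f := continuous f /\ forall j : 'I_n,
  (forall x, derivable f x (e_ j)) /\ continuous ('D_(e_ j) f).

Lemma C1_is_derive f : continuous f ->
  (forall j, exists2 df, continuous df & forall x, is_derive x (e_ j) f (df x)) ->
  C1 f.
Proof.
move=> cf h; split => // j; have [df cdf hdf] := h j; split.
  by move=> x; have [] := hdf x.
by have -> : 'D_(e_ j) f = df by apply/funext => x; have [] := hdf x.
Qed.

Lemma C1_derive f : C1 f ->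
  forall j, exists2 df, continuous df & forall x, is_derive x (e_ j) f (df x).
Proof.
move=> [cf h] j; have [df cdf] := h j; by exists ('D_(e_ j) f).
Qed.

Lemma C1_cst (a : R) : C1 (cst a).
Proof.
apply: C1_is_derive; first exact: cst_continuous.
by move=> j; exists (cst 0); [exact: cst_continuous|move=> x; exact: is_derive_cst].
Qed.

Lemma C1_coord i : C1 (fun x : 'rV[R]_n => x ord0 i).
Proof.
apply: C1_is_derive; first exact: coord_continuous_rV.
move=> j; exists (cst ((i == j)%:R)); first exact: cst_continuous.
move=> x.
have h : (fun h : R => h^-1 *: (((fun x : 'rV[R]_n => x ord0 i) \o shift x)
    (h *: delta_mx ord0 j) - x ord0 i)) @ 0^' --> ((i == j)%:R : R).
  apply: (@cvg_trans _ ((cst (i == j)%:R : R -> R) @ 0^')); last exact: cvg_cst.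
  apply: near_eq_cvg; near=> s.
  have s0 : s != 0 by near: s; exact: nbhs_dnbhs_neq.
  by rewrite /= !mxE eqxx/= addrK /GRing.scale/= mulrA mulVf// mul1r.
apply: DeriveDef; first by apply/cvg_ex; exists (i == j)%:R.
exact: cvg_lim h.
Unshelve. all: by end_near. Qed.

Lemma C1D f g : C1 f -> C1 g -> C1 (fun x => f x + g x).
Proof.
move=> cf cg; apply: C1_is_derive.
  by move=> x; apply: continuousD; [exact: cf.1|exact: cg.1].
move=> j; have [df cdf hf] := C1_derive cf j; have [dg cdg hg] := C1_derive cg j.
exists (fun x => df x + dg x); last by move=> x; exact: is_deriveD.
by move=> x; apply: continuousD; [exact: cdf|exact: cdg].
Qed.

Lemma C1M f g : C1 f -> C1 g -> C1 (fun x => f x * g x).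
Proof.
move=> cf cg; apply: C1_is_derive.
  by move=> x; apply: continuousM; [exact: cf.1|exact: cg.1].
move=> j; have [df cdf hf] := C1_derive cf j; have [dg cdg hg] := C1_derive cg j.
exists (fun x => f x * dg x + g x * df x); last first.
  by move=> x; exact: (is_deriveM (hf x) (hg x)).
move=> x; apply: (@continuousD _ _ _ (fun x => f x * dg x) (fun x => g x * df x)).
  by apply: continuousM; [exact: cf.1|exact: cdg].
by apply: continuousM; [exact: cg.1|exact: cdf].
Qed.

Lemma C1Z a f : C1 f -> C1 (fun x => a * f x).
Proof. by move=> cf; apply: C1M => //; exact: C1_cst. Qed.

Lemma C1B f g : C1 f -> C1 g -> C1 (fun x => f x - g x).
Proof.
move=> cf cg; have := C1D cf (C1Z (-1) cg).
by under eq_fun do rewrite mulN1r.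
Qed.

Lemma C1_sum I (r : seq I) (F : I -> 'rV[R]_n -> R) :
  (forall i, C1 (F i)) -> C1 (fun x => \sum_(i <- r) F i x).
Proof.
move=> cF; elim: r => [|i r IH].
  by under eq_fun do rewrite big_nil; exact: C1_cst.
by under eq_fun do rewrite big_cons; exact: C1D.
Qed.

(** Passing to the line through [x] makes the one-variable chain rule and mean value theorem
    applicable to partial derivatives. *)
Lemma is_derive_line f x v df : is_derive x v f df ->
  is_derive (0 : R) 1 (fun h : R => f (h *: v + x)) df.
Proof.
move=> [fx <-]; apply: DeriveDef; first exact: (derivable1P _ _ _).1.
rewrite /derive; congr (lim _).
suff -> : (fun h : R => h^-1 *: (((fun h0 : R => f (h0 *: v + x)) \o shift 0)
    (h *: 1) - f (0 *: v + x))) =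
  (fun h : R => h^-1 *: ((f \o shift x) (h *: v) - f x)) by [].
by apply/funext => h /=; rewrite addr0 scale0r add0r [_%:A]mulr1.
Qed.

Lemma is_derive_of_line f x v df :
  is_derive (0 : R) 1 (fun h : R => f (h *: v + x)) df -> is_derive x v f df.
Proof.
move=> [fx <-]; apply: DeriveDef; first exact: (derivable1P _ _ _).2.
rewrite /derive; congr (lim _).
suff -> : (fun h : R => h^-1 *: (((fun h0 : R => f (h0 *: v + x)) \o shift 0)
    (h *: 1) - f (0 *: v + x))) =
  (fun h : R => h^-1 *: ((f \o shift x) (h *: v) - f x)) by [].
by apply/funext => h /=; rewrite addr0 scale0r add0r [_%:A]mulr1.
Qed.

Lemma C1_pos_sqr f : C1 f -> C1 (fun x => pos_sqr (f x)).
Proof.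
move=> cf; have cm : continuous (fun x => Num.max 0 (f x)).
  move=> x; apply: (@continuous_comp _ _ _ f (fun t => Num.max 0 t)).
    exact: cf.1.
  exact: continuous_max0.
apply: C1_is_derive.
  move=> x; apply: (@continuousM _ _ f (fun x => Num.max 0 (f x))).
    exact: cf.1.
  exact: cm.
move=> j; have [df cdf hf] := C1_derive cf j.
exists (fun x => 2 * Num.max 0 (f x) * df x).
  move=> x; apply: (@continuousM _ _ (fun x => 2 * Num.max 0 (f x)) df).
    by apply: (@continuousM _ _ (cst 2)); [exact: cst_continuous|exact: cm].
  exact: cdf.
move=> x; apply: is_derive_of_line.
apply: (@is_derive1_comp _ pos_sqr (fun h : R => f (h *: e_ j + x))).
  by rewrite scale0r add0r; exact: is_derive_pos_sqr.
exact: is_derive_line.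
Qed.

End C1_functions.

Section partial_continuity.
Context {R : realType} {n : nat}.
Implicit Types (f : 'rV[R]_n -> R) (x y : 'rV[R]_n).

Lemma le_increment (phi dphi : R -> R) (d M : R) :
  (forall s : R, is_derive s 1 phi (dphi s)) ->
  (forall s, `|s| <= `|d| -> `|dphi s| <= M) ->
  `|phi d - phi 0| <= M * `|d|.
Proof.
move=> dp dM.
have cp : continuous phi.
  by move=> s; apply/differentiable_continuous/derivable1_diffP; have [] := dp s.
have [d0|d0] := leP 0 d.
  have [c] := MVT_segment d0 (fun s _ => dp s) (continuous_subspaceT cp).
  rewrite in_itv/= => /andP[c0 cd] ->.
  by rewrite subr0 normrM ler_wpM2r// dM// !ger0_norm.
have [c] := MVT_segment (ltW d0) (fun s _ => dp s) (continuous_subspaceT cp).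
rewrite in_itv/= => /andP[dc c0].
rewrite sub0r distrC => ->.
by rewrite normrM normrN ler_wpM2r// dM// !ler0_norm// ?lerN2// ltW.
Qed.

Lemma le_increment_coord f (x : 'rV[R]_n) j (d M : R) :
  (forall y, derivable f y (delta_mx ord0 j)) ->
  (forall s, `|s| <= `|d| -> `|'D_(delta_mx ord0 j) f (s *: delta_mx ord0 j + x)| <= M) ->
  `|f (d *: delta_mx ord0 j + x) - f x| <= M * `|d|.
Proof.
move=> df fM.
have := @le_increment (fun h => f (h *: delta_mx ord0 j + x))
  (fun h => 'D_(delta_mx ord0 j) f (h *: delta_mx ord0 j + x)) d M.
rewrite scale0r add0r; apply => // s.
(* [is_derive_line] differentiates at parameter 0 only; translating the parameter by [s] reaches the
   other points. *)
have := is_derive_line (derivableP (df (s *: delta_mx ord0 j + x))).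
have -> : (fun h : R => f (h *: delta_mx ord0 j + (s *: delta_mx ord0 j + x))) =
    (fun h => f (h *: delta_mx ord0 j + x)) \o (fun h => h + s).
  by apply/funext => h /=; rewrite scalerDl addrA.
set g := fun h => f (h *: _ + x) => gs.
have hs : is_derive s (1 : R) (fun h : R => h - s) 1.
  have := is_deriveB (is_derive_id s (1 : R)) (is_derive_cst s s (1 : R)).
  by rewrite subr0.
have gs0 : is_derive (s - s) (1 : R) (g \o (fun h => h + s))
    ('D_(delta_mx ord0 j) f (s *: delta_mx ord0 j + x)).
  by rewrite subrr.
have := @is_derive1_comp _ _ (fun h => h - s) _ _ _ gs0 hs; rewrite mulr1.
suff -> : (g \o (fun h => h + s)) \o (fun h => h - s) = g by [].
by apply/funext => h /=; rewrite subrK.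
Qed.

Lemma norm_rV_le x (e : R) : 0 <= e -> (forall i, `|x ord0 i| <= e) -> `|x| <= e.
Proof.
move=> e0 xe; rewrite [leLHS]/Num.norm /= mx_normrE; apply/bigmax_leP; split=> //.
by move=> [i j] _ /=; rewrite (ord1 i).
Qed.

Lemma dist_continuous_at f x :
  (forall e, 0 < e ->
    exists2 d, 0 < d & forall y, `|y - x| <= d -> `|f y - f x| <= e) ->
  {for x, continuous f}.
Proof.
move=> h; apply/(@cvgrPdist_le _ _ _ (nbhs x) _ f (f x)) => e e0.
have [d d0 hd] := h e e0; near=> y; rewrite distrC hd// distrC; near: y.
Unshelve. all: by end_near. Qed.

(** [C1_0] speaks of partial derivatives only, so continuity of a field has to be derived. Near [x]
    all partials are bounded by [M], and [y] is reached from [x] by changing one coordinate at a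
    time. The intermediate points stay in the sup-norm ball where the bound holds. *)
Lemma continuous_partials f :
  (forall j, (forall x, derivable f x (delta_mx ord0 j)) /\
             continuous ('D_(delta_mx ord0 j) f)) ->
  continuous f.
Proof.
move=> cf x.
pose D j := 'D_(delta_mx ord0 j) f.
pose M := 1 + \sum_j `|D j x|.
have M0 : 0 < M by rewrite ltr_pwDl// sumr_ge0.
have [r /= r0 rM] : exists2 r : R, 0 < r &
    forall j y, `|y - x| <= r -> `|D j y| <= M.
  have : \forall y \near x, forall j, `|D j y| <= M.
    apply: (@filter_forall _ 'I_n (fun j y => `|D j y| <= M) (nbhs x) _) => j.
    have cD : {for x, continuous (fun y => `|D j y|)}.
      by apply: continuous_comp; [exact: (cf j).2|exact: norm_continuous].
    have : `|D j x| < M.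
      by rewrite /M (bigD1 j)//= addrCA ltrDl ltr_pwDl// sumr_ge0.
    move=> DM; near=> y; rewrite ltW//; near: y.
    exact: (cD _ (lt_nbhsl DM)).
  move=> /nbhs_ballP[e /= e0 eM]; exists (e / 2); first by rewrite divr_gt0.
  move=> j y yx; apply: eM; rewrite -ball_normE /= distrC.
  by rewrite (le_lt_trans yx)// ltr_pdivrMr// ltr_pMr// ltr1n.
have fxy y : `|y - x| <= r -> `|f y - f x| <= n%:R * M * `|y - x|.
  move=> yx.
  pose z k : 'rV[R]_n := \row_i (if (i < k)%N then y ord0 i else x ord0 i).
  have z0 : z 0%N = x by apply/rowP => i; rewrite mxE.
  have zn : z n = y by apply/rowP => i; rewrite mxE ltn_ord.
  suff : forall k, (k <= n)%N -> `|f (z k) - f x| <= k%:R * (M * `|y - x|).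
    by move=> /(_ n (leqnn n)); rewrite zn mulrA.
  elim=> [_|k IH kn]; first by rewrite z0 subrr normr0 mul0r.
  have zS : z k.+1 = (y - x) ord0 (Ordinal kn) *: delta_mx ord0 (Ordinal kn) + z k.
    apply/rowP => i; rewrite !mxE eqxx/= ltnS leq_eqVlt.
    have [ik|ik] /= := eqVneq (nat_of_ord i) k.
      have -> : i = Ordinal kn by exact: val_inj.
      by rewrite eqxx mulr1/= ltnn subrK.
    case: (i =P Ordinal kn) => [iE|_]; first by rewrite iE eqxx in ik.
    by rewrite mulr0 add0r.
  rewrite -(subrK (f (z k)) (f (z k.+1))) -addrA (le_trans (ler_normD _ _))//.
  rewrite -natr1 mulrDl mul1r [leRHS]addrC lerD//; last exact/IH/ltnW.
  rewrite zS (le_trans (le_increment_coord (M := M) (cf _).1 _))//; last first.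
    by rewrite ler_pM2l// coord_le_norm.
  move=> s sd; apply: rM.
  apply: norm_rV_le => [|i]; first exact: ltW.
  have yxi : `|(y - x) ord0 i| <= r by rewrite (le_trans (coord_le_norm _ _)).
  move: yxi; rewrite !mxE eqxx/=.
  have [->|ik] /= := eqVneq i (Ordinal kn).
    rewrite ltnn mulr1 addrK => _; rewrite (le_trans sd)//.
    by rewrite (le_trans (coord_le_norm _ _)).
  rewrite mulr0 add0r; case: ifPn => // _ _.
  by rewrite subrr normr0 ltW.
apply: dist_continuous_at => e e0.
have nM : 0 <= n%:R * M by rewrite mulr_ge0// ltW.
exists (Num.min r (e / (1 + n%:R * M))) => [|y].
  by rewrite lt_min r0 divr_gt0// ltr_pwDl.
rewrite le_min => /andP[yr ye].
rewrite (le_trans (fxy _ yr))// (le_trans (ler_wpM2l nM ye))//.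
by rewrite mulrCA ler_piMr ?(ltW e0)// ler_pdivrMr ?ltr_pwDl// mul1r lerDr.
Unshelve. all: by end_near. Qed.

End partial_continuity.

Section C1_cutoff.
Context {R : realType} {n : nat}.
Implicit Types (x y : 'rV[R]_n) (C U K : set 'rV[R]_n).

Lemma compact_closed_ball x (r : R) : compact [set y : 'rV[R]_n | `|y - x| <= r].
Proof.
have [r0|r0] := leP r 0.
  apply: (@subclosed_compact _ _ [set x]); last 2 first.
  - exact: compact_set1.
  - move=> y /= yx; apply/eqP; rewrite -subr_eq0 -normr_le0.
    exact: le_trans yx r0.
  apply: (@preimage_closed _ _ (fun y => `|y - x|) [set t | t <= r]).
    move=> y _; apply: continuous_comp; last exact: norm_continuous.
    by apply: continuousB; [exact: cvg_id|exact: cst_continuous].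
  exact: closed_le.
have -> : [set y : 'rV[R]_n | `|y - x| <= r] = closed_ball x r.
  by rewrite closed_ballE//; apply/seteqP; split => y /=; rewrite /closed_ball_/= distrC.
apply: bounded_closed_compact; last exact: closed_ball_closed.
exists (`|x| + r); split; first exact: num_real.
move=> M xrM y; rewrite closed_ballE// /closed_ball_/= => yx.
rewrite (le_trans _ (ltW xrM))//.
have -> : y = x - (x - y) by rewrite subKr.
by rewrite (le_trans (ler_normB _ _))// lerD.
Qed.

(* The cutoff is [1 - pos_sqr (1 - F / m)], with [F] a finite sum of [C1] bumps that is
   positive on [C] and [m] its minimum there. *)
Lemma C1_cutoff C U : compact C -> open U -> C `<=` U ->
  exists eta : 'rV[R]_n -> R, exists K,
    [/\ C1 eta, forall x, 0 <= eta x <= 1, forall x, C x -> eta x = 1,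
        compact K /\ K `<=` U & forall x, eta x != 0 -> K x].
Proof.
move=> cC oU CU.
have [C0|/set0P C0] := eqVneq C set0.
  exists (cst 0), set0; split => //.
  - exact: C1_cst.
  - by move=> x; rewrite lexx ler01.
  - by rewrite C0.
  - by split => //; exact: compact0.
  - by move=> x; rewrite eqxx.
have /choice[r rP] (x : 'rV[R]_n) : exists r : R, 0 < r /\
    (C x -> [set y : 'rV[R]_n | `|y - x| <= r] `<=` U).
  have [Cx|nCx] := pselect (C x); last by exists 1; split.
  have /nbhs_ballP[e /= e0 eU] := open_nbhs_nbhs (conj oU (CU x Cx)).
  exists (e / 2); split; first by rewrite divr_gt0.
  move=> _ y /= yx; apply: eU; rewrite -ball_normE /= distrC.
  by rewrite (le_lt_trans yx)// ltr_pdivrMr// ltr_pMr// ltr1n.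
(* Unlike the sup norm, this polynomial is C1. It is positive exactly on the open Euclidean ball of
   radius [r x], which lies in the sup-norm ball and hence in [U] when [x] is in [C]. *)
pose q x y := r x ^+ 2 - \sum_i (y ord0 i - x ord0 i) * (y ord0 i - x ord0 i).
have qC1 x : C1 (q x).
  apply: C1B; first exact: C1_cst.
  by apply: C1_sum => i; apply: C1M; (apply: C1B; [exact: C1_coord|exact: C1_cst]).
have qx x : 0 < q x x.
  rewrite /q big1 ?subr0 ?exprn_gt0//; first by have [] := rP x.
  by move=> i _; rewrite subrr mulr0.
have [D DC CD] : exists2 D : {fset 'rV[R]_n}, {subset D <= C} &
    C `<=` \bigcup_(x in [set` D]) [set y | 0 < q x y].
  move: cC; rewrite compact_cover; apply.
    move=> x _; apply: (@open_comp _ _ (q x) [set t | 0 < t]); last exact: open_gt.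
    by move=> y _; exact: (qC1 x).1.
  by move=> x Cx; exists x => //=; exact: qx.
pose F y := \sum_(x <- D) pos_sqr (q x y).
have FC1 : C1 F by apply: C1_sum => x; exact: C1_pos_sqr.
have F0 y : 0 <= F y by apply: sumr_ge0 => x _; exact: pos_sqr_ge0.
have Fgt0 x y : x \in D -> 0 < q x y -> 0 < F y.
  move=> xD qxy; rewrite /F (big_rem x)//= ltr_pwDl ?pos_sqr_gt0//.
  by apply: sumr_ge0 => z _; exact: pos_sqr_ge0.
have [c /set_mem Cc cmin] := EVT_min_rV C0 cC (continuous_subspaceT FC1.1).
have m0 : 0 < F c by have [x /= xD] := CD c Cc; exact: Fgt0.
exists (fun y => 1 - pos_sqr (1 - (F c)^-1 * F y)).
exists (\big[setU/set0]_(x <- D) [set y : 'rV[R]_n | `|y - x| <= r x]).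
have le1 y : 1 - (F c)^-1 * F y <= 1.
  by rewrite gerBl mulr_ge0// invr_ge0 ltW.
split.
- apply: C1B; first exact: C1_cst.
  apply: C1_pos_sqr; apply: C1B; first exact: C1_cst.
  exact: C1Z.
- move=> y; have := pos_sqr_ge0 (1 - (F c)^-1 * F y).
  have : pos_sqr (1 - (F c)^-1 * F y) <= 1.
    by rewrite /pos_sqr; have := le1 y; have [] := leP 0 (1 - (F c)^-1 * F y); nra.
  by lra.
- move=> y Cy; rewrite pos_sqr_le0 ?subr0// subr_le0.
  by rewrite ler_pdivlMl// mulr1 cmin// ; exact/mem_set.
- split; first by apply: bigsetU_compact => x _; exact: compact_closed_ball.
  rewrite -bigcup_seq => y [x /= xD]; have [_] := rP x; apply.
  by have /set_mem := DC x xD.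
- move=> y eta0; rewrite -bigcup_seq.
  have Fy : 0 < F y.
    rewrite lt0r F0 andbT; apply: contra eta0 => /eqP ->.
    by rewrite mulr0 subr0 /pos_sqr mul1r max_r// subrr.
  have [x xD qxy] : exists2 x, x \in D & 0 < q x y.
    apply: contrapT => h; move: Fy; rewrite /F big_seq big1 ?ltxx// => x xD.
    rewrite pos_sqr_le0// leNgt; apply/negP => qxy; apply: h; by exists x.
  exists x => //=; have [rx0 _] := rP x.
  apply: norm_rV_le => [|i]; first exact: ltW.
  rewrite -(@ler_pXn2r _ 2)// ?nnegrE ?(ltW rx0)// real_normK ?num_real// !mxE.
  move: qxy; rewrite /q subr_gt0 (bigD1 i)//= -expr2 => /ltW; apply: le_trans.
  by rewrite lerDl sumr_ge0// => j _; rewrite -expr2 sqr_ge0.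
Qed.

End C1_cutoff.

Section C1_fields.
Context {R : realType} {n : nat}.
Implicit Types (Omega K : set 'rV[R]_n) (w : 'rV[R]_n -> 'rV[R]_n).

Lemma C1_0_coord_continuous Omega w i : C1_0 Omega w ->
  continuous (fun x => w x ord0 i).
Proof. by move=> [cw _ _]; apply: continuous_partials => j; exact: cw. Qed.

Lemma C1_0N Omega w : C1_0 Omega w -> C1_0 Omega (fun x => - w x).
Proof.
move=> Cw; have [cw csw sw] := Cw; split.
- move=> i j.
  have : C1 (fun x => w x ord0 i).
    by split; [exact: C1_0_coord_continuous Cw|move=> k; exact: cw].
  move=> /(C1Z (-1)) [_ /(_ j)].
  suff <- : (fun x => (- w x) ord0 i) = (fun x => -1 * w x ord0 i) by [].
  by apply/funext => x; rewrite mxE mulN1r.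
- by under eq_set do rewrite oppr_eq0.
- by under eq_set do rewrite oppr_eq0.
Qed.

Lemma C1_0_compact_support Omega w K : (forall i, C1 (fun x => w x ord0 i)) ->
  compact K -> K `<=` Omega -> (forall x, w x != 0 -> K x) -> C1_0 Omega w.
Proof.
move=> Cw cK KO wK.
have clK : closure [set x | w x != 0] `<=` K.
  rewrite [X in _ `<=` X](closure_id K).1; first exact: closureS.
  by apply: compact_closed => //; exact: norm_hausdorff.
split.
- by move=> i j; exact: (Cw i).2.
- by apply: subclosed_compact clK => //; exact: closed_closure.
- exact: subset_trans clK KO.
Qed.

Lemma C1_0_enorm_continuous Omega w : C1_0 Omega w ->
  continuous (fun x => enorm (w x)).
Proof.
move=> Cw x; apply: (@continuous_comp _ _ _ _ Num.sqrt); last exact: sqrt_continuous.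
apply: continuous_sumr => i y; under eq_fun do rewrite expr2.
by apply: continuousM; exact: (C1_0_coord_continuous Cw).
Qed.

Lemma C1_0_bounded Omega w : C1_0 Omega w ->
  exists M, forall x, enorm (w x) <= M.
Proof.
move=> Cw; have [_ cK _] := Cw; set K := closure _ in cK.
have [K0|/set0P K0] := eqVneq K set0.
  exists 0 => x; have [->|wx] := eqVneq (w x) 0; first by rewrite enorm0.
  have : K x by exact: subset_closure.
  by rewrite K0.
have cw := C1_0_enorm_continuous Cw.
have [c _ cmax] := EVT_max_rV K0 cK (continuous_subspaceT cw).
exists (enorm (w c)) => x.
have [->|wx] := eqVneq (w x) 0; first by rewrite enorm0 enorm_ge0.
by apply: cmax; apply/mem_set; apply: subset_closure.
Qed.

Lemma C1_0_divergence Omega w : C1_0 Omega w ->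
  continuous (divergence w) /\ exists M, forall x, `|divergence w x| <= M.
Proof.
move=> Cw; have [dw cK _] := Cw; set K := closure _ in cK.
have cd : continuous (divergence w).
  by apply: continuous_sumr => i; exact: (dw i i).2.
split => //.
have dw0 x : ~ K x -> divergence w x = 0.
  move=> nKx; rewrite /divergence big1// => i _.
  rewrite /partial_deriv (@near_eq_derive _ _ _ _ (cst 0)) ?derive_cst//.
  have : nbhs x (~` K).
    by apply: open_nbhs_nbhs; split => //; apply: closed_openC; exact: closed_closure.
  apply: filterS => y /= nKy; have [->|wy] := eqVneq (w y) 0; first by rewrite mxE.
  by exfalso; apply: nKy; exact: subset_closure.
have [K0|/set0P K0] := eqVneq K set0.
  by exists 0 => x; rewrite dw0 ?normr0// K0.
have cnd : continuous (fun x => `|divergence w x|).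
  by move=> x; apply: continuous_comp; [exact: cd|exact: norm_continuous].
have [c _ cmax] := EVT_max_rV K0 cK (continuous_subspaceT cnd).
exists `|divergence w c| => x.
have [Kx|nKx] := pselect (K x); first by apply: cmax; exact/mem_set.
by rewrite dw0// normr0.
Qed.

End C1_fields.

(** * Approximation of measurable fields by C1 fields *)

Section measurability_rV.
Context {R : realType} {n : nat}.
Implicit Types (A B D Omega : set 'rV[R]_n).

Lemma continuous_measurable_rV D (f : 'rV[R]_n -> R) :
  measurable D -> continuous f -> measurable_fun D f.
Proof.
move=> mD cf; apply: (measurability (@RGenOpens.G R)).
  exact: RGenOpens.measurableE.
move=> _ [_ [a [b ->]] <-]; apply: measurableI => //; apply: open_measurable_rV.
by apply: open_comp => [x _|]; [exact: cf|exact: itv_open].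
Qed.

Lemma measurable_fiber D (f : 'rV[R]_n -> 'rV[R]_n) c : measurable D ->
  (forall i, measurable_fun D (fun x => f x ord0 i)) ->
  measurable (D `&` [set x | f x = c]).
Proof.
move=> mD mf.
have -> : D `&` [set x | f x = c] = D `&` \bigcap_(i in [set: 'I_n])
    (D `&` (fun x => f x ord0 i) @^-1` [set c ord0 i]).
  apply/seteqP; split=> x [Dx] /= fx; split => //; first by move=> i _; split => //=; rewrite fx.
  by apply/rowP => i; have [] := fx i I.
apply: measurableI => //; apply: fin_bigcap_measurable => // i _.
exact: mf.
Qed.

End measurability_rV.

Section regularity.
Context {R : realType} {n : nat} (mu : {finite_measure set 'rV[R]_n -> \bar R}).
Implicit Types (A B F U : set 'rV[R]_n).
Local Open Scope ereal_scope.

(** Continuity from above, in the form that serves both the regularity of measures and the smallness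
    of an integral over shrinking cubes. *)
Lemma nonincreasing_measure_lt (F : (set 'rV[R]_n)^nat) (e : \bar R) :
  (forall k, measurable (F k)) -> nonincreasing_seq F ->
  mu (\bigcap_k F k) < e -> exists N, mu (F N) < e.
Proof.
move=> mF dF mue.
have mI : measurable (\bigcap_k F k) by exact: bigcapT_measurable.
have /= cF : mu (F k) @[k --> \oo] --> mu (\bigcap_k F k).
  apply: nonincreasing_cvg_mu => //.
  by rewrite ltey_eq fin_num_measure.
have [|N _ h] := cF [set y | y < e].
  by apply: open_nbhs_nbhs; split => //; exact: open_ereal_lt_ereal.
by exists N; exact: (h N (leqnn N)).
Qed.

(** Two-sided, so that the property passes to complements; inner regularity alone would not. *)
Definition regular A := forall e : R, (0 < e)%R ->
  exists F U, [/\ closed F, open U, F `<=` A, A `<=` U & mu (U `\` F) < e%:E].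

Lemma closed_measurable_rV F : closed F -> measurable F.
Proof.
move=> cF; rewrite -(setCK F); apply: measurableC.
by apply: open_measurable_rV; exact: closed_openC.
Qed.

Lemma regular_open U : open U -> regular U.
Proof.
move=> oU e e0.
(* The points at sup-norm distance at least [1 / (k + 1)] from the complement; as [U] is open, they
   exhaust it. *)
pose F k := [set x | forall y, ~ U y -> (k.+1%:R^-1 <= `|x - y|)%R].
have cF k : closed (F k).
  have -> : F k = \bigcap_(y in ~` U) [set x | (k.+1%:R^-1 <= `|x - y|)%R].
    by apply/seteqP; split => x h y; exact: h.
  apply: closed_bigI => y _ /=.
  apply: (@preimage_closed 'rV[R]_n R (fun x => `|x - y|%R) [set t | (k.+1%:R^-1 <= t)%R]).
    move=> x _; apply: continuous_comp; last exact: norm_continuous.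
    by apply: continuousB; [exact: cvg_id|exact: cst_continuous].
  exact: closed_ge.
have FU k : F k `<=` U.
  move=> x Fx; apply: contrapT => /Fx; rewrite subrr normr0.
  by rewrite leNgt invr_gt0 ltr0n.
have [N muN] : exists N, mu (U `\` F N) < e%:E.
  apply: nonincreasing_measure_lt.
  - by move=> k; apply: measurableD; [exact: open_measurable_rV|exact: closed_measurable_rV].
  - move=> k l kl; apply/subsetPset => x [Ux nFx]; split => // Fx; apply: nFx.
    move=> y /Fx; apply: le_trans.
    by rewrite lef_pV2 ?posrE ?ltr0n// ler_nat ltnS.
  - rewrite [X in mu X](_ : _ = set0) ?measure0 ?lte_fin//.
    rewrite -subset0 => x h; have [Ux _] := h 0%N I.
    have /nbhs_ballP[r /= r0 rU] := open_nbhs_nbhs (conj oU Ux).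
    have [k kr] : exists k : nat, (k.+1%:R^-1 < r)%R.
      near \oo => k; exists k; near: k.
      exact: (near_infty_natSinv_lt (PosNum r0)).
    have [_] := h k I; apply => y nUy; rewrite leNgt; apply/negP => xy.
    by apply: nUy; apply: rU; rewrite -ball_normE /=; exact: lt_trans kr.
by exists (F N), U; split => //; exact: FU.
Unshelve. all: by end_near. Qed.

Lemma regular_sigma_algebra :
  sigma_algebra setT [set A | measurable A /\ regular A].
Proof.
split.
- split => // e e0; exists set0, set0; split => //.
  - exact: closed0.
  - by rewrite setD0 measure0 lte_fin.
- move=> A [mA rA]; split; first exact: measurableD.
  move=> e e0; have [F [U [cF oU FA AU muUF]]] := rA e e0.
  exists (~` U), (~` F); split.
  - exact: open_closedC.
  - exact: closed_openC.
  - by move=> x nUx; split => // /AU.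
  - by move=> x [_ nAx] /FA.
  - by rewrite setDE setCK setIC -setDE.
- move=> A h; split; first by apply: bigcupT_measurable => k; exact: (h k).1.
  move=> e e0.
  have /choice[F /choice[U FUP]] k : exists F U, [/\ closed F, open U, F `<=` A k,
      A k `<=` U & mu (U `\` F) < (e / 2 / (2 ^ k.+1)%:R)%:E].
    apply: (h k).2; rewrite !divr_gt0// ltr0n expn_gt0//.
  have mF k : measurable (F k).
    by have [? _ _ _ _] := FUP k; exact: closed_measurable_rV.
  have mU k : measurable (U k).
    by have [_ ? _ _ _] := FUP k; exact: open_measurable_rV.
  (* A countable union of closed sets need not be closed; continuity from above lets a finite part
     suffice. The errors sum to at most [e / 2], so that the limit is strictly below [e]. *)
  pose G N := \big[setU/set0]_(k < N) F k.
  have mUU : measurable (\bigcup_k U k) by exact: bigcupT_measurable.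
  have mG N : measurable (G N) by exact: bigsetU_measurable.
  have [N muN] : exists N, mu (\bigcup_k U k `\` G N) < e%:E.
    apply: nonincreasing_measure_lt.
    - by move=> k; exact: measurableD.
    - move=> k l kl; apply/subsetPset; apply: setDS.
      by apply: subset_bigsetU.
    - apply: (@le_lt_trans _ _ (\sum_(k <oo) (e / 2 / (2 ^ k.+1)%:R)%:E)).
        apply: (@le_trans _ _ (\sum_(k <oo) mu (U k `\` F k))).
          apply: measure_sigma_subadditive.
          - by move=> k; exact: measurableD.
          - by apply: bigcapT_measurable => k; exact: measurableD.
          - move=> x xh; have [[k _ Ukx] _] := xh 0%N I; exists k => //; split => //.
            move=> Fkx; have [_] := xh k.+1 I; apply.
            by rewrite /G big_ord_recr/=; right.
        apply: lee_nneseries => // k _.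
        by have [_ _ _ _ /ltW] := FUP k.
      apply: le_lt_trans (epsilon_trick0 _ _) _ => //; first by rewrite divr_ge0// ltW.
      by rewrite lte_fin ltr_pdivrMr// ltr_pMr// ltr1n.
  exists (G N), (\bigcup_k U k); split => //.
  - by apply: closed_bigsetU => k _; have [] := FUP k.
  - by apply: bigcup_open => k _; have [] := FUP k.
  - rewrite /G -bigcup_mkord => x [k _ Fkx]; exists k => //.
    by have [_ _ + _ _] := FUP k; exact.
  - move=> x [k _ Akx]; exists k => //.
    by have [_ _ _ + _] := FUP k; exact.
Qed.

Lemma inner_regular A (e : R) : measurable A -> (0 < e)%R ->
  exists F, [/\ closed F, F `<=` A & mu (A `\` F) < e%:E].
Proof.
move=> mA e0.
have h : <<s @open 'rV[R]_n >> `<=` [set A | measurable A /\ regular A].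
  apply: (smallest_sub regular_sigma_algebra) => U oU.
  by split; [exact: open_measurable_rV|exact: regular_open].
have [|_ /(_ e e0)[F [U [cF oU FA AU muUF]]]] := h A.
  by rewrite -measurable_rV_open.
exists F; split => //; apply: le_lt_trans muUF; apply: le_measure.
- by apply/mem_set/measurableD => //; exact: closed_measurable_rV.
- apply/mem_set/measurableD; last exact: closed_measurable_rV.
  exact: open_measurable_rV.
- exact: setSD.
Qed.

End regularity.

Section simple_field_approximation.
Context {R : realType} {n : nat}.
Variables (Omega : set 'rV[R]_n) (S : 'rV[R]_n -> R).
Hypothesis S_ge0 : forall x, Omega x -> 0 <= S x.
Hypothesis open_lt_S : forall c : 'rV[R]_n, open (Omega `&` [set x | enorm c < S x]).
Implicit Types (c x : 'rV[R]_n) (cs : seq 'rV[R]_n).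

(* The values are glued one at a time as [w <- eta *: c + (1 - eta) *: w]: a convex
   combination, active only where [enorm c < S], preserves the bound by [S]. *)
Lemma C1_0_interpolation (K : 'rV[R]_n -> set 'rV[R]_n) cs : uniq cs ->
  (forall c, compact (K c)) ->
  (forall c, K c `<=` Omega `&` [set x | enorm c < S x]) ->
  (forall c c', c != c' -> K c `&` K c' = set0) ->
  exists w, [/\ C1_0 Omega w, forall x, Omega x -> enorm (w x) <= S x &
    forall c, c \in cs -> forall x, K c x -> w x = c].
Proof.
move=> ucs cK KS KI.
suff [w [L [Cw [cL LO] wL wS wK]]] : exists (w : 'rV[R]_n -> 'rV[R]_n) (L : set 'rV[R]_n),
    [/\ forall i, C1 (fun x => w x ord0 i), compact L /\ L `<=` Omega,
        forall x, w x != 0 -> L x,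
        forall x, Omega x -> enorm (w x) <= S x &
        forall c, c \in cs -> forall x, K c x -> w x = c].
  by exists w; split => //; exact: (C1_0_compact_support Cw cL LO wL).
elim: cs ucs => [_|c cs IH /= /andP[ccs ucs]].
  exists (cst 0), set0; split => //.
  - by move=> i; exact: C1_cst.
  - by split => //; exact: compact0.
  - by move=> x; rewrite eqxx.
  - by move=> x Ox; rewrite enorm0 S_ge0.
have [w [L [Cw [cL LO] wL wS wK]]] := IH ucs.
(* The cutoff [eta] vanishes off [U], so removing the compact sets already treated keeps the earlier
   values of [w] on them. *)
pose U := (Omega `&` [set x | enorm c < S x]) `&`
  ~` (\big[setU/set0]_(c' <- cs) K c').
have oU : open U.
  apply: openI => //; apply: closed_openC; apply: compact_closed.
    exact: norm_hausdorff.
  by apply: bigsetU_compact.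
have KU : K c `<=` U.
  move=> x Kx; split; first exact: KS.
  rewrite /= -bigcup_seq => -[c' /= c'cs Kc'x].
  have cc' : c != c' by apply: contraNneq ccs => ->.
  by have : (K c `&` K c') x by []; rewrite KI.
have [eta [M [Ceta eta01 etaK [cM MU] etaM]]] := C1_cutoff (cK c) oU KU.
exists (fun x => eta x *: c + (1 - eta x) *: w x), (M `|` L); split.
- move=> i; have : C1 (fun x => eta x * c ord0 i + (1 - eta x) * w x ord0 i).
    apply: C1D; first by apply: C1M => //; exact: C1_cst.
    by apply: C1M => //; apply: C1B => //; exact: C1_cst.
  by congr C1; apply/funext => x; rewrite !mxE.
- split; first exact: compactU.
  by move=> x [/MU[[]]|/LO].
- move=> x; have [->|/etaM Mx _] := eqVneq (eta x) 0; last by left.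
  by rewrite scale0r add0r subr0 scale1r => /wL; right.
- move=> x Ox; have [->|/etaM/MU[[_ cS] _]] := eqVneq (eta x) 0.
    by rewrite scale0r add0r subr0 scale1r wS.
  have /andP[eta0 eta1] := eta01 x.
  rewrite (le_trans (enormD _ _))// !enormZ !ger0_norm ?subr_ge0//.
  have := wS x Ox; rewrite /= in cS; nra.
- move=> c'; rewrite inE => /predU1P[->|c'cs] x Kx.
    by rewrite etaK// scale1r subrr scale0r addr0.
  have [->|/etaM/MU[_]] := eqVneq (eta x) 0.
    by rewrite scale0r add0r subr0 scale1r (wK _ c'cs).
  by move=> /=; rewrite -bigcup_seq => -[]; exists c'.
Qed.

(** Each level set of [v] is replaced by a compact subset given by inner regularity, and [E]
    collects what is lost. The strict inequality puts the level set of [c] inside the open set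
    [enorm c < S], where interpolation may use the value [c]. *)
Lemma C1_0_approximation (nu : {finite_measure set 'rV[R]_n -> \bar R})
    (v : 'rV[R]_n -> 'rV[R]_n) cs (e : R) :
  bounded_set Omega -> measurable Omega ->
  (forall i, measurable_fun Omega (fun x => v x ord0 i)) ->
  (forall x, Omega x -> enorm (v x) < S x) ->
  (forall x, Omega x -> v x \in cs) -> 0 < e ->
  exists w E, [/\ C1_0 Omega w, forall x, Omega x -> enorm (w x) <= S x,
    measurable E, (nu E < e%:E)%E & forall x, Omega x -> ~ E x -> w x = v x].
Proof.
move=> bO mO mv vS vcs e0.
have mB c : measurable (Omega `&` [set x | v x = c]) by exact: measurable_fiber.
(* The successor makes the total loss strictly smaller than [e], and covers an empty list. *)
have d0 : 0 < e / (size cs).+1%:R by rewrite divr_gt0.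
have /choice[K KP] c := inner_regular nu (mB c) d0.
have mK c : measurable (K c) by have [? _ _] := KP c; exact: closed_measurable_rV.
have [||c|c c' cc'|w [Cw wS wK]] := @C1_0_interpolation K (undup cs).
- exact: undup_uniq.
- move=> c; have [cK KB _] := KP c; apply: bounded_closed_compact => //.
  have [M [Mr MP]] := bO; exists M; split => // M' MM' x /KB[Ox _].
  exact: MP.
- have [_ KB _] := KP c; move=> x /KB[Ox /= vc]; split => //=.
  by rewrite -vc vS.
- rewrite -subset0 => x [Kx Kx'].
  have [_ /(_ x Kx)[_ /= vc] _] := KP c.
  have [_ /(_ x Kx')[_ /= vc'] _] := KP c'.
  by move: cc'; rewrite -vc -vc' eqxx.
pose E := \big[setU/set0]_(c <- cs) ((Omega `&` [set x | v x = c]) `\` K c).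
exists w, E; split => //.
- by apply: bigsetU_measurable => c _; exact: measurableD.
- have : (nu E <= ((size cs)%:R * (e / (size cs).+1%:R))%:E)%E.
    rewrite /E; move: (e / _) d0 KP => d d0 KP; clear -mB mK KP.
    elim: cs => [|c cs IH]; first by rewrite big_nil measure0 mul0r.
    rewrite big_cons /= -natr1 mulrDl mul1r addrC EFinD.
    rewrite (le_trans (measureU2 _ _ _))//.
    + exact: measurableD.
    + by apply: bigsetU_measurable => c' _; exact: measurableD.
    + by apply: leeD => //; have [_ _ /ltW] := KP c.
  move=> /le_lt_trans; apply.
  rewrite lte_fin mulrCA -[ltRHS]mulr1 ltr_pM2l// ltr_pdivrMr// mul1r.
  by rewrite ltr_nat.
- move=> x Ox nEx; apply: wK; first by rewrite mem_undup vcs.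
  apply: contrapT => nKx; apply: nEx; rewrite /E -bigcup_seq.
  by exists (v x) => /=; [exact: vcs|split].
Qed.

End simple_field_approximation.

Section rounding.
Context {R : realType}.
Variable d : R.
Hypothesis d_gt0 : 0 < d.

(** Rounding to multiples of [d] towards zero: absolute values do not increase, so a rounded field
    keeps its pointwise bound. *)
Definition round0 (t : R) : R :=
  if 0 <= t then d * (Num.truncn (t / d))%:R else - (d * (Num.truncn (- t / d))%:R).

Lemma round0_ge0 t : 0 <= t -> round0 t <= t < round0 t + d.
Proof.
move=> t0; rewrite /round0 t0.
have /truncn_itv : 0 <= t / d by rewrite divr_ge0// ltW.
rewrite ler_pdivlMr// ltr_pdivrMr// -natr1 mulrDl mul1r => /andP[h1 h2].
by rewrite mulrC h1 h2.
Qed.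

Lemma round0N t : round0 (- t) = - round0 t.
Proof.
rewrite /round0 oppr_ge0; have [t0|t0|->] := ltgtP t 0.
- by rewrite opprK.
- by rewrite opprK.
- by rewrite !oppr0 mul0r truncn0 mulr0 oppr0.
Qed.

Lemma round0_sign t : 0 <= t -> 0 <= round0 t.
Proof. by move=> t0; rewrite /round0 t0 mulr_ge0// ltW. Qed.

Lemma normr_round0_le t : `|round0 t| <= `|t|.
Proof.
wlog t0 : t / 0 <= t => [h|].
  have [/h//|t0] := leP 0 t.
  by rewrite -(opprK t) round0N normrN (normrN (- t)) h// oppr_ge0 ltW.
by rewrite !ger0_norm ?round0_sign//; have /andP[] := round0_ge0 t0.
Qed.

Lemma dist_round0_le t : `|round0 t - t| <= d.
Proof.
wlog t0 : t / 0 <= t => [h|].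
  have [/h//|t0] := leP 0 t.
  rewrite -(opprK t) round0N -opprD normrN h// oppr_ge0 ltW//.
have /andP[h1 h2] := round0_ge0 t0.
by rewrite ler_norml; apply/andP; split; lra.
Qed.

Lemma round0_nd : {homo round0 : s t / s <= t}.
Proof.
move=> s t st; rewrite /round0.
case: (leP 0 s) => s0; case: (leP 0 t) => t0.
- by rewrite ler_pM2l// ler_nat le_truncn// ler_pM2r ?invr_gt0.
- by move: (le_trans s0 st); rewrite leNgt t0.
- by rewrite (@le_trans _ _ 0)// ?oppr_le0 mulr_ge0// ltW.
- rewrite lerN2 ler_pM2l// ler_nat le_truncn// ler_pM2r ?invr_gt0//.
  by rewrite lerN2.
Qed.

Lemma measurable_round0 : measurable_fun setT round0.
Proof. by apply: nondecreasing_measurable => //; exact: round0_nd. Qed.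

(* [int] indexes the values of [round0], so vectors of values are countable. *)
Lemma round0_int t : exists z : int, round0 t = d * z%:~R.
Proof.
rewrite /round0; case: ifP => _.
  by exists (Num.truncn (t / d))%:Z.
by exists (- (Num.truncn (- t / d))%:Z); rewrite mulrNz mulrN.
Qed.

Lemma round0_bounded (M : R) : exists cs : seq R,
  forall t, `|t| <= M -> round0 t \in cs.
Proof.
pose N := (Num.truncn (M / d)).+1.
exists ([seq d * k%:R | k <- iota 0 N] ++ [seq - (d * k%:R) | k <- iota 0 N]).
move=> t tM; rewrite mem_cat /round0; case: ifPn => [t0|_]; apply/orP.
  left; apply/mapP; exists (Num.truncn (t / d)) => //.
  rewrite mem_iota /= add0n ltnS le_truncn// ler_pM2r ?invr_gt0//.
  by rewrite (le_trans (ler_norm _)).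
right; apply/mapP; exists (Num.truncn (- t / d)) => //.
rewrite mem_iota /= add0n ltnS le_truncn// ler_pM2r ?invr_gt0//.
by rewrite (le_trans (ler_norm _))// normrN.
Qed.

Lemma rV_seq_finite n (cs : seq R) : exists ds : seq 'rV[R]_n,
  forall x : 'rV[R]_n, (forall i, x ord0 i \in cs) -> x \in ds.
Proof.
exists [seq \row_i nth 0 cs (f i) | f : {ffun 'I_n -> 'I_(size cs)}].
move=> x xcs.
have h i : (index (x ord0 i) cs < size cs)%N by rewrite index_mem.
apply/mapP; exists [ffun i => Ordinal (h i)]; first by rewrite mem_enum.
by apply/rowP => i; rewrite mxE ffunE /= nth_index.
Qed.

Definition round_rV n (x : 'rV[R]_n) : 'rV[R]_n := \row_i round0 (x ord0 i).

Lemma enorm_round_rV_le n (x : 'rV[R]_n) : enorm (round_rV x) <= enorm x.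
Proof.
rewrite /enorm ler_wsqrtr//; apply: ler_sum => i _; rewrite mxE.
rewrite -(real_normK (num_real (round0 _))) -(real_normK (num_real (x ord0 i))).
by rewrite lerXn2r ?nnegrE// normr_round0_le.
Qed.

Lemma dist_round_rV_le n (x : 'rV[R]_n) : enorm (round_rV x - x) <= n%:R * d.
Proof. by apply: enorm_le_coords => i; rewrite !mxE dist_round0_le. Qed.

Lemma round_rV_bounded n (M : R) : exists cs : seq 'rV[R]_n,
  forall x : 'rV[R]_n, enorm x <= M -> round_rV x \in cs.
Proof.
have [cs csP] := round0_bounded M; have [ds dsP] := @rV_seq_finite n cs.
exists ds => x xM; apply: dsP => i; rewrite mxE csP//.
exact: le_trans (coord_le_enorm _ _) xM.
Qed.

End rounding.

(** * Measures and charges with densities *)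

Section density.
Context d (T : measurableType d) (R : realType).
Implicit Types (D A : set T).
Local Open Scope ereal_scope.

Lemma density_measure (mu : {measure set T -> \bar R}) (k : T -> \bar R) :
  (forall x, 0 <= k x) -> mu.-integrable setT k ->
  exists nu : {finite_measure set T -> \bar R},
    forall A, measurable A -> nu A = \int[mu]_(x in A) k x.
Proof.
move=> k0 ik.
have pos E : 0 <= induced_charge ik E.
  exact: integral_ge0.
pose m := measure_of_charge _ pos.
have fm : fin_num_fun m.
  move=> A mA; rewrite /m /measure_of_charge /induced_charge.
  by apply: integrable_fin_num => //; exact: (integrableS measurableT).
pose H := Measure_isFinite.Build _ _ _ m fm.
pose nu : {finite_measure set T -> \bar R} := HB.pack m H.
by exists nu.
Qed.

Lemma finite_measure_add (m1 m2 : {finite_measure set T -> \bar R}) :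
  exists m : {finite_measure set T -> \bar R},
    forall A, m A = m1 A + m2 A.
Proof.
have fm : fin_num_fun (measure_add m1 m2).
  by move=> A mA; rewrite measure_addE fin_numD !fin_num_measure.
pose H := Measure_isFinite.Build _ _ _ (msum _ 2) fm.
pose nu : {finite_measure set T -> \bar R} := HB.pack (msum _ 2) H.
by exists nu => A; exact: measure_addE.
Qed.

Import HBNNSimple.

(** Indicators, simple functions, monotone limits. The relation between the measures is assumed on
    subsets of [D] only, since the densities are given on [Omega]. *)
Lemma ge0_integral_density (nu mu : {measure set T -> \bar R}) D (k : T -> R)
    (f : T -> \bar R) :
  measurable D -> measurable_fun D k -> (forall x, D x -> 0 <= k x)%R ->
  (forall A, measurable A -> A `<=` D -> nu A = \int[mu]_(x in A) (k x)%:E) ->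
  measurable_fun D f -> (forall x, D x -> 0 <= f x) ->
  \int[nu]_(x in D) f x = \int[mu]_(x in D) (f x * (k x)%:E).
Proof.
move=> mD mk k0 nuE mf f0.
have indicE A : measurable A ->
    \int[nu]_(x in D) (\1_A x)%:E = \int[mu]_(x in D) ((\1_A x)%:E * (k x)%:E).
  move=> mA; rewrite integral_indic// nuE; [|exact: measurableI|exact: subIsetr].
  rewrite setIC integral_mkcondr; apply: eq_integral => x _.
  by rewrite patchE indicE; case: ifP => _; rewrite ?mul1e ?mul0e.
pose h := nnsfun_approx mD mf.
have hE n : \int[nu]_(x in D) (h n x)%:E =
    \int[mu]_(x in D) ((h n x)%:E * (k x)%:E).
  transitivity (\sum_(y \in range (h n))
      y%:E * \int[nu]_(x in D) (\1_(h n @^-1` [set y]) x)%:E).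
    under eq_integral do rewrite fimfunE -fsumEFin//.
    rewrite ge0_integral_fsum//.
    - apply: eq_fsbigr => y yh; under eq_integral do rewrite EFinM.
      by rewrite integralZl_indic_nnsfun.
    - move=> y; apply/measurable_EFinP/measurable_funM => //.
    - by move=> y x _; exact: nnfun_muleindic_ge0.
  under [RHS]eq_integral => x xD.
    rewrite fimfunE -fsumEFin// ge0_mule_fsuml; last first.
      by move=> y; exact: nnfun_muleindic_ge0.
    over.
  have mhk y : measurable_fun D (fun x => (y * \1_(h n @^-1` [set y]) x)%:E * (k x)%:E).
    apply: emeasurable_funM; apply/measurable_EFinP => //.
    exact: measurable_funM.
  rewrite ge0_integral_fsum//; last first.
    by move=> y x Dx; rewrite mule_ge0// ?lee_fin ?k0//; exact: nnfun_muleindic_ge0.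
  apply: eq_fsbigr => y yh; rewrite indicE//.
  under [RHS]eq_integral do rewrite EFinM -muleA.
  rewrite ge0_integralZl//.
  - by apply: emeasurable_funM; apply/measurable_EFinP.
  - by move=> x Dx; rewrite mule_ge0// ?lee_fin ?k0.
  - by move: yh; rewrite inE => -[t _ <-]; rewrite lee_fin.
have hf x : D x -> (h n x)%:E @[n --> \oo] --> f x.
  by move=> Dx; exact: cvg_nnsfun_approx.
have nd x : D x -> {homo (fun n => (h n x)%:E) : a b / (a <= b)%N >-> a <= b}.
  by move=> _ a b ab; rewrite lee_fin; exact/lefP/nd_nnsfun_approx.
have -> : \int[nu]_(x in D) f x = limn (fun n => \int[nu]_(x in D) (h n x)%:E).
  rewrite -monotone_convergence//.
  - by apply: eq_integral => x /[!inE] Dx; apply/esym/cvg_lim => //; exact: hf.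
  - by move=> n; exact/measurable_EFinP/measurable_funTS.
  - by move=> n x _; rewrite lee_fin.
have -> : \int[mu]_(x in D) (f x * (k x)%:E) =
    limn (fun n => \int[mu]_(x in D) ((h n x)%:E * (k x)%:E)).
  rewrite -monotone_convergence//.
  - apply: eq_integral => x /[!inE] Dx; apply/esym/cvg_lim => //.
    by apply: cvgeZr => //; exact: hf.
  - move=> n; apply: emeasurable_funM; apply/measurable_EFinP => //.
    exact/measurable_funTS.
  - by move=> n x Dx; rewrite mule_ge0// lee_fin// k0.
  - by move=> x Dx a b ab; rewrite lee_wpmul2r ?lee_fin ?k0//; exact: nd.
by congr (limn _); apply/funext.
Qed.

Lemma integral_density (nu mu : {measure set T -> \bar R}) D (k f : T -> R) :
  measurable D -> measurable_fun D k -> (forall x, D x -> 0 <= k x)%R ->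
  (forall A, measurable A -> A `<=` D -> nu A = \int[mu]_(x in A) (k x)%:E) ->
  nu.-integrable D (EFin \o f) ->
  mu.-integrable D (fun x => (f x * k x)%:E) /\
  \int[nu]_(x in D) (f x)%:E = \int[mu]_(x in D) (f x * k x)%:E.
Proof.
move=> mD mk k0 nuE fnu.
have mf : measurable_fun D f by apply/measurable_EFinP/(measurable_int _ fnu).
have ifk : mu.-integrable D (fun x => (f x * k x)%:E).
  apply/integrableP; split; first exact/measurable_EFinP/measurable_funM.
  move/integrableP : fnu => [_]; apply: le_lt_trans.
  rewrite (ge0_integral_density mD mk k0 nuE)//.
  - rewrite le_eqVlt; apply/orP; left; apply/eqP; apply: eq_integral => x /[!inE] Dx.
    by rewrite EFinM abseM /= (ger0_norm (k0 _ Dx)).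
  - by apply: (measurableT_comp (@abse_measurable _ setT)); exact/measurable_EFinP.
split => //; rewrite integralE [RHS]integralE; congr (_ - _).
- rewrite (ge0_integral_density mD mk k0 nuE)//.
  + apply: eq_integral => x /[!inE] Dx; rewrite !funeposE /=.
    by rewrite -!EFin_max -EFinM maxr_pMl ?k0// mul0r.
  + exact/measurable_funepos/measurable_EFinP.
- rewrite (ge0_integral_density mD mk k0 nuE)//.
  + apply: eq_integral => x /[!inE] Dx; rewrite !funenegE /=.
    by rewrite -!EFin_max -EFinM maxr_pMl ?k0// mul0r mulNr.
  + exact/measurable_funeneg/measurable_EFinP.
Qed.

Lemma density_measure_in (mu : {measure set T -> \bar R}) D (k : T -> R) :
  measurable D -> (forall x, D x -> 0 <= k x)%R -> mu.-integrable D (EFin \o k) ->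
  exists nu : {finite_measure set T -> \bar R},
    forall A, measurable A -> A `<=` D -> nu A = \int[mu]_(x in A) (k x)%:E.
Proof.
move=> mD k0 ik.
have [||nu nuE] := @density_measure mu (EFin \o (k \_ D)).
- by move=> x; rewrite lee_fin patchE; case: ifPn => // /[!inE] /k0.
- by move/(integrable_mkcond _ mD): ik; rewrite restrict_EFin.
exists nu => A mA AD; rewrite nuE//; apply: eq_integral => x /[!inE] Ax.
by rewrite /= patchE mem_set//; exact: AD.
Qed.

(** Moves the negative parts across, which turns an identity between signed quantities into one
    between sums of measures. *)
Lemma fin_num_sub_eq (a b c e g h : \bar R) : a \is a fin_num ->
  b \is a fin_num -> c \is a fin_num -> e \is a fin_num -> g \is a fin_num ->
  h \is a fin_num -> a - b = c - e + (g - h) <-> a + (e + h) = b + (c + g).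
Proof.
case: a => [a||]// _; case: b => [b||]// _; case: c => [c||]// _.
case: e => [e||]// _; case: g => [g||]// _; case: h => [h||]// _.
by rewrite -!EFinB -!EFinD; split => -[] E; congr EFin; lra.
Qed.

Lemma integral_measure_sum2 (a b m : {measure set T -> \bar R}) D (f : T -> \bar R) :
  measurable D -> a.-integrable D f -> b.-integrable D f ->
  (forall A, m A = a A + b A) ->
  \int[m]_(x in D) f x = \int[a]_(x in D) f x + \int[b]_(x in D) f x.
Proof.
move=> mD ia ib mE.
rewrite -(integral_measure_add mD ia ib).
apply: eq_measure_integral => A _ _.
by apply: (etrans (mE A)); exact/esym/measure_addE.
Qed.

(** Splitting [g] and [s] into positive and negative parts writes both sides as differences of
    integrals against finite measures. With the negative parts moved across, the two sums [m3] and
    [m4] agree on the measurable subsets of [D], hence so do the integrals of [f]. The Hahn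
    decomposition chosen for [nu] never has to be related to the signs of [g] and [s]. *)
Lemma integral_charge_density (nu : {charge set T -> \bar R})
    (mu tau : {measure set T -> \bar R}) D (g s f : T -> R) :
  measurable D -> mu.-integrable D (EFin \o g) -> tau.-integrable D (EFin \o s) ->
  (forall A, measurable A -> A `<=` D ->
    nu A = \int[mu]_(x in A) (g x)%:E + \int[tau]_(x in A) (s x)%:E) ->
  measurable_fun D f -> (exists M, forall x, D x -> `|f x| <= M)%R ->
  [/\ mu.-integrable D (fun x => (f x * g x)%:E),
     tau.-integrable D (fun x => (f x * s x)%:E) &
     integral_charge nu D f = \int[mu]_(x in D) (f x * g x)%:E +
                              \int[tau]_(x in D) (f x * s x)%:E].
Proof.
move=> mD ig is_ nuE mf [M fM].
have intf (m : {finite_measure set T -> \bar R}) : m.-integrable D (EFin \o f).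
  apply: measurable_bounded_integrable => //.
    by rewrite ltey_eq fin_num_measure.
  exists M; split; first exact: num_real.
  by move=> M' MM' x Dx; rewrite /= (le_trans (fM x Dx))// ltW.
have parts (m : {measure set T -> \bar R}) (k : T -> R) :
    m.-integrable D (EFin \o k) ->
    exists p q : {finite_measure set T -> \bar R},
      [/\ forall A, measurable A -> A `<=` D ->
          p A - q A = \int[m]_(x in A) (k x)%:E,
        m.-integrable D (fun x => (f x * k x)%:E) &
        \int[m]_(x in D) (f x * k x)%:E =
          \int[p]_(x in D) (f x)%:E - \int[q]_(x in D) (f x)%:E].
  move=> ik.
  have ikp := integrable_funrpos mD ik; have ikn := integrable_funrneg mD ik.
  have [//|p pE] := density_measure_in mD _ ikp.
  have [//|q qE] := density_measure_in mD _ ikn.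
  have mp (h : T -> R) : m.-integrable D (EFin \o h) -> measurable_fun D h.
    by move=> ih; apply/measurable_EFinP/(measurable_int _ ih).
  have [ifp fpE] := integral_density mD (mp _ ikp) (fun x _ => funrpos_ge0 _ _) pE (intf p).
  have [ifn fnE] := integral_density mD (mp _ ikn) (fun x _ => funrneg_ge0 _ _) qE (intf q).
  have kE x : k x = (k^\+ x - k^\- x)%R.
    by rewrite -[in LHS](funrposBneg k).
  have fkE : (fun x => (f x * k x)%:E) =
      (fun x => (f x * k^\+ x)%:E) \- (fun x => (f x * k^\- x)%:E).
    by apply/funext => x; rewrite /= -EFinB -mulrBr -kE.
  exists p, q; split.
  - move=> A mA AD; rewrite pE// qE// -integralB//.
    + by apply: eq_integral => x _; rewrite -EFinB -kE.
    + exact: integrableS ikp.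
    + exact: integrableS ikn.
  - by rewrite fkE; exact: integrableB.
  - by rewrite fpE fnE -integralB//; apply: eq_integral => x _;
    rewrite -EFinB -mulrBr -kE.
have [p1 [q1 [pq1 ifg fgE]]] := parts mu g ig.
have [p2 [q2 [pq2 ifs fsE]]] := parts tau s is_.
split => //; rewrite fgE fsE /integral_charge.
set P := jordan_pos _; set N := jordan_neg _.
have PN A : measurable A -> A `<=` D -> P A - N A = p1 A - q1 A + (p2 A - q2 A).
  move=> mA AD; rewrite pq1// pq2// -nuE// (jordan_decomp (hahn_chosen nu) mA).
  by rewrite /cadd /= cscaleN1.
have [m1 m1E] := finite_measure_add q1 q2.
have [m2 m2E] := finite_measure_add p1 p2.
have [m3 m3E] := finite_measure_add P m1.
have [m4 m4E] := finite_measure_add N m2.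
have E : \int[m3]_(x in D) (f x)%:E = \int[m4]_(x in D) (f x)%:E.
  apply: eq_measure_integral => A mA AD.
  have h : P A + m1 A = N A + m2 A.
    rewrite m1E m2E; apply: (fin_num_sub_eq _ _ _ _ _ _).1 (PN A mA AD);
    exact: fin_num_measure.
  by apply: (etrans (m3E A)); apply: (etrans h); exact/esym/m4E.
have ffin (m : {finite_measure set T -> \bar R}) :
  \int[m]_(x in D) (f x)%:E \is a fin_num by exact: integrable_fin_num (intf m).
apply: (fin_num_sub_eq _ _ _ _ _ _).2; [exact: ffin..|].
rewrite -(integral_measure_sum2 mD (intf q1) (intf q2) m1E).
rewrite -(integral_measure_sum2 mD (intf P) (intf m1) m3E).
rewrite -(integral_measure_sum2 mD (intf p1) (intf p2) m2E).
by rewrite -(integral_measure_sum2 mD (intf N) (intf m2) m4E).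
Qed.

End density.

(** * Total variation of a vector measure *)

Lemma Rintegral_sum d (T : measurableType d) (R : realType)
    (mu : {measure set T -> \bar R}) (D : set T) I (r : seq I) (f : I -> T -> R) :
  measurable D -> (forall i, mu.-integrable D (fun x => (f i x)%:E)) ->
  \int[mu]_(x in D) (\sum_(i <- r) f i x) = \sum_(i <- r) \int[mu]_(x in D) f i x.
Proof.
move=> mD intf; rewrite /Rintegral.
under eq_integral do rewrite -sumEFin.
rewrite integral_sum// sum_fine// => i _.
exact: integrable_fin_num.
Qed.

Section vector_integral.
Context d (T : measurableType d) (R : realType) {n : nat}.
Context (mu : {measure set T -> \bar R}).
Implicit Types (D : set T) (s v : T -> 'rV[R]_n).

Definition vintegral D s : 'rV[R]_n := \row_i \int[mu]_(x in D) s x ord0 i.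

Definition vintegrable D s :=
  forall i, mu.-integrable D (fun x => (s x ord0 i)%:E).

Lemma vintegrable_measurable D s : vintegrable D s ->
  forall i, measurable_fun D (fun x => s x ord0 i).
Proof. by move=> is_ i; exact/measurable_EFinP/(measurable_int _ (is_ i)). Qed.

Lemma integrable_enorm D s : measurable D -> vintegrable D s ->
  mu.-integrable D (fun x => (enorm (s x))%:E).
Proof.
move=> mD is_.
apply: (@le_integrable _ _ _ _ _ _ _ (fun x => \sum_i `|(s x ord0 i)%:E|)%E) => //.
- exact/measurable_EFinP/measurable_enorm/vintegrable_measurable.
- move=> x _; rewrite /= sumEFin /= lee_fin ger0_norm ?enorm_ge0//.
  by rewrite ger0_norm ?sumr_ge0// enorm_le_sum.
- by apply: integrable_sum => // i _; exact: integrable_abse.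
Qed.

Lemma integrable_dot D s v (M : R) : measurable D -> vintegrable D s ->
  (forall i, measurable_fun D (fun x => v x ord0 i)) ->
  (forall x, D x -> enorm (v x) <= M) ->
  mu.-integrable D (fun x => (dot (v x) (s x))%:E).
Proof.
move=> mD is_ mv vM.
apply: (@le_integrable _ _ _ _ _ _ _ (fun x => M%:E * (enorm (s x))%:E)%E) => //.
- by apply/measurable_EFinP/measurable_dot => //; exact: vintegrable_measurable.
- move=> x Dx; rewrite -EFinM /= lee_fin.
  rewrite (le_trans (normr_dot_le _ _))// (le_trans _ (ler_norm _))//.
  by rewrite ler_wpM2r ?enorm_ge0// vM.
- by apply: integrableZl => //; exact: integrable_enorm.
Qed.

(** The integral [c] is tested against itself: [|c|^2] is the integral of [c . s], at most [|c|]
    times that of [|s|]. *)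
Lemma enorm_vintegral_le D s : measurable D -> vintegrable D s ->
  enorm (vintegral D s) <= \int[mu]_(x in D) enorm (s x).
Proof.
move=> mD is_; set c := vintegral D s.
have I0 : 0 <= \int[mu]_(x in D) enorm (s x).
  by apply: Rintegral_ge0 => x _; exact: enorm_ge0.
have [c0|c0] := eqVneq (enorm c) 0; first by rewrite c0.
have {}c0 : 0 < enorm c by rewrite lt0r c0 enorm_ge0.
rewrite -(ler_pM2l c0) -expr2 sqr_enorm -RintegralZl//; last exact: integrable_enorm.
have -> : dot c c = \int[mu]_(x in D) dot c (s x).
  rewrite Rintegral_sum// => [|i]; last first.
    by under eq_fun do rewrite EFinM; exact: integrableZl.
  apply: eq_bigr => i _; rewrite RintegralZl//; last exact: is_.
  by congr (_ * _); rewrite mxE.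
apply: le_Rintegral => //.
- exact: (@integrable_dot D s (fun=> c) (enorm c)).
- exact: (integrableZl mD _ (integrable_enorm mD is_)).
- by move=> x _; exact: dot_le.
Qed.

End vector_integral.

Section vector_measure_density.
Context {R : realType} {n : nat}.
Local Open Scope ereal_scope.

(** The sum of the Jordan parts of all components: with a single reference measure the densities
    form one vector field. *)
Lemma common_dominating d (T : measurableType d) m
    (nu : 'I_m -> {charge set T -> \bar R}) :
  exists tau : {finite_measure set T -> \bar R},
    forall i, nu i `<< tau.
Proof.
elim: m nu => [|m IH] nu.
  pose nu0 : {charge set T -> \bar R} := czero.
  by exists (jordan_pos (hahn_chosen nu0)) => -[].
have [tau tauP] := IH (fun i => nu (lift ord0 i)).
have [t1 t1E] := finite_measure_add (jordan_pos (hahn_chosen (nu ord0)))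
  (jordan_neg (hahn_chosen (nu ord0))).
have [t tE] := finite_measure_add t1 tau.
exists t => i; apply/null_content_dominatesP => A mA.
move=> tA0; have /eqP : t1 A + tau A = 0 by rewrite -tE.
rewrite padde_eq0// => /andP[/eqP t10 /eqP tau0].
case: (unliftP ord0 i) => [j|] ->.
  by have /null_content_dominatesP := tauP j; apply.
move: t10; rewrite t1E => /eqP; rewrite padde_eq0// => /andP[/eqP p0 /eqP n0].
rewrite (jordan_decomp (hahn_chosen (nu ord0)) mA) /cadd/= cscaleN1.
by move: p0 n0 => /= -> ->; rewrite oppe0 adde0.
Qed.

(** Radon-Nikodym in each component. Densities are determined only almost everywhere; since the
    components vanish on subsets of [Z], the density may be set to zero there, so that it vanishes
    at every point of [Z]. *)
Lemma vector_measure_density (nu : vector_measure R n) (Z : set 'rV[R]_n) :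
  measurable Z -> (forall i A, measurable A -> A `<=` Z -> nu i A = 0) ->
  exists (tau : {finite_measure set 'rV[R]_n -> \bar R}) (s : 'rV[R]_n -> 'rV[R]_n),
    [/\ vintegrable tau setT s,
      forall i A, measurable A -> nu i A = \int[tau]_(x in A) (s x ord0 i)%:E &
      forall x, Z x -> s x = 0%R].
Proof.
move=> mZ nuZ; have [tau dom] := common_dominating nu.
pose f i := Radon_Nikodym (nu i) tau.
pose s x : 'rV[R]_n := \row_i fine ((f i \_ (~` Z)) x).
have sE i : (fun x => (s x ord0 i)%:E) = f i \_ (~` Z).
  apply/funext => x; rewrite mxE fineK// patchE; case: ifP => // _.
  exact: Radon_Nikodym_fin_num.
have mCZ : measurable (~` Z) by exact: measurableC.
have intf i : tau.-integrable setT (f i) by exact: Radon_Nikodym_integrable.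
exists tau, s; split.
- move=> i; rewrite sE; apply/(integrable_mkcond _ mCZ).
  exact: integrableS (intf i).
- move=> i A mA; rewrite sE -integral_mkcondr -setDE.
  rewrite -Radon_Nikodym_integral//; last exact: measurableD.
  have AZ : nu i (A `&` Z) = 0 by apply: nuZ; [exact: measurableI|exact: subIsetr].
  by rewrite (chargeDI _ mA mZ) AZ adde0.
- by move=> x Zx; apply/rowP => i; rewrite !mxE patchE memNset.
Qed.

Section variation.
Variables (nu : vector_measure R n) (tau : {finite_measure set 'rV[R]_n -> \bar R}).
Variable s : 'rV[R]_n -> 'rV[R]_n.
Hypothesis is_ : vintegrable tau setT s.
Hypothesis nuE : forall i A, measurable A ->
  nu i A = \int[tau]_(x in A) (s x ord0 i)%:E.

Let is_in A : measurable A -> vintegrable tau A s.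
Proof. by move=> mA i; exact: integrableS (is_ i). Qed.

Let vector_valueE A : measurable A -> vector_value nu A = vintegral tau A s.
Proof. by move=> mA; apply/rowP => i; rewrite !mxE nuE. Qed.

Let int_enorm A : measurable A ->
  (\int[tau]_(x in A) enorm (s x))%:E = \int[tau]_(x in A) (enorm (s x))%:E.
Proof.
move=> mA; rewrite /Rintegral fineK//; apply: integrable_fin_num => //.
exact/integrable_enorm/is_in.
Qed.

Let menorm A : measurable A -> measurable_fun A (fun x => (enorm (s x))%:E).
Proof.
by move=> mA; exact/measurable_EFinP/measurable_enorm/vintegrable_measurable/is_in.
Qed.

(** A reverse triangle inequality: the integral of [|s|] and the norm of the integral of [s] each
    differ from [|c| tau(A)] by at most [e tau(A)]. *)
Lemma almost_constant_enorm A c (e : R) : measurable A ->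
  (forall x, A x -> enorm (s x - c) <= e)%R ->
  \int[tau]_(x in A) (enorm (s x))%:E <=
    (enorm (vector_value nu A))%:E + (2 * e)%:E * tau A.
Proof.
move=> mA sc; rewrite vector_valueE// -int_enorm//.
have tA : tau A = (fine (tau A))%:E by rewrite fineK// fin_num_measure.
rewrite tA -EFinM -EFinD lee_fin; set t := fine (tau A).
have t0 : (0 <= t)%R by rewrite fine_ge0.
have icst (a : R) : tau.-integrable A (fun=> a%:E).
  exact: finite_measure_integrable_cst.
have ic : vintegrable tau A (fun x => s x - c)%R.
  move=> i; apply: (@eq_integrable _ _ _ _ _ mA
    ((fun x => (s x ord0 i)%:E) \- (fun=> (c ord0 i)%:E))).
    by move=> x _; rewrite !mxE EFinB.
  by apply: integrableB => //; exact: is_in.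
have vE : vintegral tau A (fun x => s x - c)%R = (vintegral tau A s - t *: c)%R.
  apply/rowP => i; rewrite !mxE.
  under eq_Rintegral do rewrite !mxE.
  rewrite (@RintegralB _ _ _ _ _ (fun x => s x ord0 i) (fun=> c ord0 i)) //.
  - by rewrite Rintegral_cst// mulrC.
  - exact: is_in.
  - exact: icst.
have h1 := enorm_vintegral_le mA ic; rewrite vE in h1.
have h2 : (\int[tau]_(x in A) enorm (s x - c)%R <= e * t)%R.
  rewrite -Rintegral_cst//; apply: le_Rintegral => //.
    exact: integrable_enorm.
  exact: icst.
have h3 : (\int[tau]_(x in A) enorm (s x) <= (enorm c + e) * t)%R.
  rewrite -Rintegral_cst//; apply: le_Rintegral => //.
  - exact/integrable_enorm/is_in.
  - exact: icst.
  - move=> x Ax; rewrite -[in leLHS](subrK c (s x)) (le_trans (enormD _ _))//.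
    by rewrite addrC lerD2l sc.
have h4 : (t * enorm c <= enorm (vintegral tau A s) + enorm (vintegral tau A s - t *: c))%R.
  rewrite -[X in (X * _)%R](ger0_norm t0) -enormZ -{1}(subKr (vintegral tau A s) (t *: c)).
  by rewrite (le_trans (enormD _ _))// enormN.
by clear tA; nra.
Qed.

(** One inequality is the triangle inequality on each piece. For the other, [A] is partitioned by
    the rounded value of [s], so that [s] is almost constant on each piece. *)
Lemma vector_variation_density A : measurable A ->
  vector_variation nu A = \int[tau]_(x in A) (enorm (s x))%:E.
Proof.
move=> mA; apply/eqP; rewrite eq_le; apply/andP; split.
  apply: ge_ereal_sup => _ [F [mF tF FA] <-].
  apply: (@le_trans _ _ (\sum_(k <oo) \int[tau]_(x in F k) (enorm (s x))%:E)).
    apply: lee_nneseries => [k _ _|k _]; first by rewrite lee_fin enorm_ge0.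
    rewrite vector_valueE// -int_enorm// lee_fin.
    by apply: enorm_vintegral_le => //; exact: is_in.
  rewrite -ge0_integral_bigcup//.
  - apply: ge0_subset_integral => //.
    + exact: bigcupT_measurable.
    + exact: menorm.
    + by move=> x _; rewrite lee_fin enorm_ge0.
  - by apply: menorm; exact: bigcupT_measurable.
  - by move=> x _; rewrite lee_fin enorm_ge0.
apply/lee_addgt0Pr => e e0.
pose t := fine (tau A); have t0 : (0 <= t)%R by rewrite fine_ge0.
(* The total error is [2 n d tau(A)], at most [e] for this [d]; the added ones guard against [n = 0]
   and [tau(A) = 0]. *)
pose d := (e / (2 * n.+1%:R * (t + 1)))%R.
have d0 : (0 < d)%R by rewrite divr_gt0// mulr_gt0// ltr_pwDr.
(* Rounded values are coded by integer vectors, and [choice.pickle] numbers the codes; [F k] is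
   empty for numbers not attained. *)
have [z zP] := choice (round0_int d).
pose code x : {ffun 'I_n -> int} := [ffun i => z (s x ord0 i)].
have codeE x y : code x = code y <-> round_rV d (s x) = round_rV d (s y).
  split => [xy|/rowP xy]; [apply/rowP => i|apply/ffunP => i].
    by rewrite !mxE !zP; move/ffunP/(_ i): xy; rewrite !ffunE => ->.
  have := xy i; rewrite !mxE !zP !ffunE => /(mulfI (lt0r_neq0 d0)).
  by move=> /intr_inj.
pose F k := A `&` [set x | choice.pickle (code x) = k].
have mF k : measurable (F k).
  have [->|/set0P[y [Ay yk]]] := eqVneq (F k) set0; first exact: measurable0.
  have -> : F k = A `&` [set x | round_rV d (s x) = round_rV d (s y)].
    apply/seteqP; split => x [Ax] /= h; split => //=.
      by apply/codeE; apply: (pcan_inj choice.pickleK); rewrite h yk.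
    by rewrite -yk; congr choice.pickle; exact/codeE.
  apply: measurable_fiber => // i; under eq_fun do rewrite mxE.
  apply: (measurableT_comp (measurable_round0 d0)).
  exact/vintegrable_measurable/is_in.
have tF : trivIset setT F.
  by move=> k l _ _ [x [[_ /= <-] [_ /= <-]]].
have UF : \bigcup_k F k = A.
  by apply/seteqP; split => [x [k _ []]//|x Ax]; exists (choice.pickle (code x)).
have step k : \int[tau]_(x in F k) (enorm (s x))%:E <=
    (enorm (vector_value nu (F k)))%:E + (2 * (n%:R * d))%:E * tau (F k).
  have [->|/set0P[y [Ay yk]]] := eqVneq (F k) set0.
    by rewrite integral_set0 measure0 mule0 adde0 lee_fin enorm_ge0.
  apply: (@almost_constant_enorm _ (round_rV d (s y))) => // x [Ax xk].
  have -> : round_rV d (s y) = round_rV d (s x).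
    by apply/codeE; apply: (pcan_inj choice.pickleK); rewrite xk yk.
  by rewrite enormB dist_round_rV_le.
rewrite -[X in \int[_]_(x in X) _]UF ge0_integral_bigcup//; last 2 first.
- by rewrite UF; exact: menorm.
- by move=> x _; rewrite lee_fin enorm_ge0.
apply: (@le_trans _ _ (\sum_(k <oo) ((enorm (vector_value nu (F k)))%:E +
    (2 * (n%:R * d))%:E * tau (F k)))).
  apply: lee_nneseries => [k _ _|k _]; last exact: step.
  by apply: integral_ge0 => x _; rewrite lee_fin enorm_ge0.
have nd0 : (0 <= 2 * (n%:R * d))%R by rewrite mulr_ge0// mulr_ge0// ltW.
rewrite nneseriesD; last 2 first.
- by move=> k _ _; rewrite lee_fin enorm_ge0.
- by move=> k _ _; rewrite mule_ge0// lee_fin.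
apply: leeD.
  apply: ereal_sup_ubound; exists F => //; split => //.
  by rewrite UF.
rewrite nneseriesZl//.
have -> : \sum_(k <oo) tau (F k) = tau A.
  rewrite -[in RHS]UF measure_bigcup//.
  by apply: eq_eseriesl => k; rewrite in_setT.
have -> : tau A = t%:E by rewrite fineK// fin_num_measure.
rewrite -EFinM lee_fin /d.
have -> : (2 * (n%:R * (e / (2 * n.+1%:R * (t + 1)))) * t =
    e * ((n%:R / n.+1%:R) * (t / (t + 1))))%R.
  by field; rewrite !gt_eqF// ltr_pwDr.
rewrite ler_piMr ?(ltW e0)// mulr_ile1 ?divr_ge0 ?addr_ge0//.
  by rewrite ler_pdivrMr// mul1r ler_nat.
by rewrite ler_pdivrMr ?ltr_pwDr// mul1r lerDl.
Qed.

(* [vector_variation] is a bare set function; the integral against it only sees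
   its values on measurable sets, where it is the measure with density [enorm s]. *)
Lemma integral_vector_variation D (f : 'rV[R]_n -> \bar R) : measurable D ->
  measurable_fun D f -> (forall x, D x -> 0 <= f x) ->
  \int[vector_variation nu]_(x in D) f x =
  \int[tau]_(x in D) (f x * (enorm (s x))%:E).
Proof.
move=> mD mf f0.
have VE := vector_variation_density.
have V0 : vector_variation nu set0 = 0 by rewrite VE// integral_set0.
have Vge0 A : 0 <= vector_variation nu A.
  apply: ereal_sup_ubound; exists (fun=> set0); last first.
    rewrite eseries0// => k _ _; congr EFin.
    by rewrite vector_valueE// /vintegral -[RHS](@enorm0 R n); congr enorm; apply/rowP => i;
      rewrite !mxE Rintegral_set0.
  split => //; first exact: trivIset_set0.
  by move=> x [].
have Vsa : semi_sigma_additive (vector_variation nu).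
  move=> F mF tF mUF; rewrite VE//.
  rewrite (_ : (fun k => _) = fun k => \sum_(0 <= i < k)
      \int[tau]_(x in F i) (enorm (s x))%:E); last first.
    by apply/funext => k; apply: eq_bigr => i _; rewrite VE.
  apply: (@semi_sigma_additive_nng_induced _ _ _ tau (fun x => (enorm (s x))%:E)) => //.
  - exact: menorm.
  - by move=> x; rewrite lee_fin enorm_ge0.
pose H := isMeasure.Build _ _ _ (vector_variation nu) V0 Vge0 Vsa.
pose V : {measure set 'rV[R]_n -> \bar R} := HB.pack (vector_variation nu) H.
rewrite -[LHS]/(\int[V]_(x in D) f x).
apply: ge0_integral_density => //.
- by apply: measurable_enorm; exact: (vintegrable_measurable (is_in mD)).
- by move=> x _; exact: enorm_ge0.
- by move=> A mA _; exact: VE.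
Qed.

End variation.
End vector_measure_density.

(** * Generalized Phi-functions *)

Section generalized_Phi.
Context {R : realType} {n : nat}.
Variables (Omega : set 'rV[R]_n) (phi : 'rV[R]_n -> R -> \bar R).
Hypotheses (oO : open Omega) (phi_c : Phi_c Omega phi).
Hypotheses (phi_cont : jointly_continuous Omega phi).
Hypotheses (phi_A0 : A0 Omega phi) (phi_aDec : aDec Omega phi).
Local Open Scope ereal_scope.
Implicit Types (x : 'rV[R]_n) (s t A : R).

Let mO : measurable Omega. Proof. exact: open_measurable_rV. Qed.

(** By [PhiE], [fine] loses nothing for x in [Omega] and [0 <= t]. *)
Definition rphi x t : R := fine (phi x t).

Lemma Phi_ge0 x t : Omega x -> (0 <= t)%R -> 0 <= phi x t.
Proof. by have [[+ _ _ _ _] _ _] := phi_c; exact. Qed.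

Lemma Phi_nd x s t : Omega x -> (0 <= s)%R -> (s <= t)%R -> phi x s <= phi x t.
Proof. by have [[_ _ + _ _] _ _] := phi_c; exact. Qed.

(** (A0) bounds [phi x b] by 1 uniformly in x; monotonicity handles smaller [t], and (aDec) carries
    the bound to larger [t]. *)
Lemma Phi_bounded t : (0 <= t)%R ->
  exists2 C : R, (0 <= C)%R & forall x, Omega x -> phi x t <= C%:E.
Proof.
move=> t0; have [b [b0 b1 bP]] := phi_A0; have [q q1 [L L1 qP]] := phi_aDec.
have [tb|bt] := leP t b.
  exists 1%R => // x Ox; apply: le_trans (bP x Ox).1; exact: Phi_nd.
have {}t0 : (0 < t)%R by exact: lt_trans bt.
have tq : (0 < t `^ q)%R by rewrite powR_gt0.
have bq : (0 < b `^ q)%R by rewrite powR_gt0.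
exists (L * (b `^ q)^-1 * t `^ q)%R.
  by rewrite !mulr_ge0 ?invr_ge0// ?(ltW tq)// ?(ltW bq)// (le_trans _ L1).
move=> x Ox; have := qP x b t Ox b0 (ltW bt).
rewrite inver gt_eqF// inver gt_eqF//.
rewrite lee_pdivrMr// => /le_trans; apply.
rewrite !EFinM lee_wpmul2r ?lee_fin ?(ltW tq)//.
rewrite lee_wpmul2l ?lee_fin ?(le_trans _ L1)//.
rewrite -[leRHS]mul1e lee_wpmul2r ?lee_fin ?invr_ge0 ?(ltW bq)//.
exact: (bP x Ox).1.
Qed.

Lemma PhiE x t : Omega x -> (0 <= t)%R -> phi x t = (rphi x t)%:E.
Proof.
move=> Ox t0; have [C _ /(_ x Ox) phiC] := Phi_bounded t0.
rewrite fineK// fin_numElt (lt_le_trans _ (Phi_ge0 Ox t0))//=.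
exact: le_lt_trans phiC (ltry _).
Qed.

Lemma rphi_bounded t : (0 <= t)%R ->
  exists2 C : R, (0 <= C)%R & forall x, Omega x -> (rphi x t <= C)%R.
Proof.
move=> t0; have [C C0 phiC] := Phi_bounded t0; exists C => // x Ox.
by rewrite -lee_fin -PhiE//; exact: phiC.
Qed.

Section fixed_point.
Variables (x : 'rV[R]_n) (Ox : Omega x).

Lemma rphi0 : rphi x 0 = 0%R.
Proof. by have [[_ _ _ /(_ x Ox)[+ _ _] _] _ _] := phi_c; rewrite /rphi => ->. Qed.

Lemma rphi_ge0 t : (0 <= t)%R -> (0 <= rphi x t)%R.
Proof. by move=> t0; rewrite fine_ge0// Phi_ge0. Qed.

Lemma rphi_nd s t : (0 <= s)%R -> (s <= t)%R -> (rphi x s <= rphi x t)%R.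
Proof.
move=> s0 st; have t0 := le_trans s0 st.
by rewrite -lee_fin -!PhiE//; exact: Phi_nd.
Qed.

Lemma rphi_convex s t l : (0 <= s)%R -> (0 <= t)%R -> (0 <= l)%R -> (l <= 1)%R ->
  (rphi x (l * s + (1 - l) * t) <= l * rphi x s + (1 - l) * rphi x t)%R.
Proof.
move=> s0 t0 l0 l1; have [_ /(_ x s t l Ox s0 t0 l0 l1) + _] := phi_c.
by rewrite !PhiE// addr_ge0// mulr_ge0// subr_ge0.
Qed.

End fixed_point.

(* The slope of [phi x] on [A, A + 1]: it increases to the recession function as
   [A -> oo], and [phi^*] is finite and Lipschitz on [0, slope A x]. *)
Definition slope A x : R := rphi x (A + 1) - rphi x A.

Lemma slope_ge0 A x : Omega x -> (0 <= A)%R -> (0 <= slope A x)%R.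
Proof. by move=> Ox A0; rewrite subr_ge0 rphi_nd// lerDl. Qed.

Lemma slope_nd A B x : Omega x -> (0 <= A)%R -> (A <= B)%R ->
  (slope A x <= slope B x)%R.
Proof. by move=> Ox; apply: convex_increment_nd; exact: rphi_convex. Qed.

Lemma slope_bounded A : (0 <= A)%R ->
  exists2 C : R, (0 <= C)%R & forall x, Omega x -> (slope A x <= C)%R.
Proof.
move=> A0; have [|C C0 phiC] := @rphi_bounded (A + 1); first by rewrite addr_ge0.
exists C => // x Ox; rewrite lerBlDr (le_trans (phiC x Ox))// lerDl.
exact: rphi_ge0.
Qed.

(** From [1 <= phi x (1 / b)] by comparing chords. Positivity leaves the room needed to shrink a
    field strictly below the slope. *)
Lemma slope_gt0 : exists2 A0 : nat, (0 < A0)%N &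
  forall A, (A0%:R <= A)%R -> forall x, Omega x -> (0 < slope A x)%R.
Proof.
have [b [b0 b1 bP]] := phi_A0.
exists (Num.truncn (1 / b)).+1 => // A bA x Ox.
have b10 : (0 < 1 / b)%R by rewrite divr_gt0.
have {}bA : (1 / b <= A)%R by rewrite (le_trans _ bA)// ltW// truncnS_gt.
have A0 : (0 < A)%R by exact: lt_le_trans bA.
apply: (@lt_le_trans _ _ (rphi x (1 / b) / (1 / b)))%R.
  rewrite divr_gt0// (@lt_le_trans _ _ 1%R)//.
  by rewrite -lee_fin -PhiE// ?(ltW b10)//; exact: (bP x Ox).2.
apply: (@le_trans _ _ (rphi x A / A))%R.
  apply: convex_ratio_nd => //; [exact: rphi0|exact: rphi_convex].
apply: convex_ratio_le_increment => //; [exact: rphi0|exact: rphi_convex].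
Qed.

Lemma rphi_continuous t x : (0 <= t)%R -> Omega x ->
  {for x, continuous (rphi ^~ t)}.
Proof.
move=> t0 Ox.
have h : phi y t @[y --> x] --> phi x t.
  have /subspace_continuousP/(_ (x, t)) := phi_cont.
  move=> /(_ (conj Ox t0)) h.
  apply: (@cvg_trans _ (phi p.1 p.2 @[p --> within (Omega `*` [set t | (0 <= t)%R])
      (nbhs (x, t))])); last exact: h.
  move=> B /= [[U V] /= [Ux Vt] UVB].
  have : nbhs x (U `&` Omega).
    by apply: filterI => //; apply: open_nbhs_nbhs.
  apply: filterS => y [Uy Oy]; apply: (UVB (y, t)) => //.
  by split => //=; exact: nbhs_singleton Vt.
rewrite PhiE// in h; exact: (fine_cvg h).
Qed.

Lemma open_lt_slope A c : (0 <= A)%R ->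
  open (Omega `&` [set x | (c < slope A x)%R]).
Proof.
move=> A0; rewrite openE => x [Ox /= cx].
have cS : {for x, continuous (slope A)}.
  apply: continuousB; apply: rphi_continuous => //.
  by rewrite addr_ge0.
apply: filterI; first exact: open_nbhs_nbhs.
exact: (cS _ (lt_nbhsr cx)).
Qed.

Lemma measurable_rphi (h : 'rV[R]_n -> R) : measurable_fun Omega h ->
  (forall x, Omega x -> (0 <= h x)%R) ->
  measurable_fun Omega (fun x => rphi x (h x)).
Proof.
move=> mh h0; have [[_ /(_ h mh) + _ _ _] _ _] := phi_c => mphi.
apply/measurable_EFinP; apply: eq_measurable_fun mphi => x /[!inE] Ox /=.
by rewrite ger0_norm ?h0// PhiE// h0.
Qed.

Lemma measurable_slope A : (0 <= A)%R -> measurable_fun Omega (slope A).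
Proof.
move=> A0; apply: measurable_funB; apply: (measurable_rphi (measurable_cst _)) => //.
by move=> x _; rewrite addr_ge0.
Qed.

Lemma recession_ge x t : Omega x -> (0 < t)%R -> (rphi x t / t)%:E <= recession phi x.
Proof.
move=> Ox t0; apply: le_ereal_inf_tmp => _ [V [M [_ MV]] <-].
(* A point of the given tail beyond [t]: the ratio there is at least the ratio at [t]. *)
pose s := Num.max t (M + 1)%R.
have ts : (t <= s)%R by rewrite le_max lexx.
have s0 : (0 < s)%R by exact: lt_le_trans ts.
apply: (@le_trans _ _ (phi x s / s%:E)).
  rewrite (PhiE Ox (ltW s0)) inver gt_eqF// -EFinM lee_fin.
  apply: convex_ratio_nd => //; [exact: rphi0|exact: rphi_convex].
apply: ereal_sup_ubound; exists s => //; apply: MV.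
by rewrite /s lt_max ltrDl ltr01 orbT.
Qed.

(** Beyond [A + 1] one has [a (t - A) <= phi x t], hence a ratio of at least [a - a A / t]; the
    chosen [t] makes the defect at most [e]. *)
Lemma slope_le_recession A x : Omega x -> (0 <= A)%R ->
  (slope A x)%:E <= recession phi x.
Proof.
move=> Ox A0; apply/lee_addgt0Pr => e e0.
have S0 := slope_ge0 Ox A0; set a := slope A x in S0 *.
pose t := (A + 1 + a * A / e)%R.
have t1 : (A + 1 <= t)%R by rewrite lerDl divr_ge0// ?mulr_ge0// ltW.
have t0 : (0 < t)%R by rewrite (lt_le_trans _ t1)// ltr_wpDl.
apply: (@le_trans _ _ ((rphi x t / t)%:E + e%:E)); last first.
  by apply: leeD => //; exact: recession_ge.
rewrite -EFinD lee_fin -lerBlDr ler_pdivlMr//.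
have h : (a * (t - A) <= rphi x t)%R.
  apply: (convex_increment_le (F := rphi x)) => //.
  - by move=> s; exact: rphi_ge0.
  - exact: rphi_convex.
  - by rewrite (lt_le_trans _ t1)// ltrDl.
have : (a * A <= e * t)%R.
  rewrite /t mulrDr (mulrC e (_ / e)%R) divfK ?gt_eqF// lerDr.
  by rewrite mulr_ge0// ?ltW// ltr_wpDl.
by move: h; nra.
Qed.

(** Ratios are below increments and increments below the recession function. A limsup over real t
    thus becomes a countable monotone limit, which gives measurability and prepares monotone
    convergence. *)
Lemma recessionE x : Omega x ->
  recession phi x = ereal_sup (range (fun k : nat => (slope k%:R x)%:E)).
Proof.
move=> Ox; apply/eqP; rewrite eq_le; apply/andP; split; last first.
  by apply: ge_ereal_sup => _ [k _ <-]; exact: slope_le_recession.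
apply: ge_ereal_inf; exists (ereal_sup [set phi x t / t%:E | t in [set t | (0 < t)%R]]).
  exists [set t | (0 < t)%R] => //.
  by exists 0%R; split => //; exact: num_real.
apply: ge_ereal_sup => _ [t /= t0 <-].
rewrite (PhiE Ox (ltW t0)) inver gt_eqF// -EFinM.
apply: (@le_trans _ _ (slope (Num.truncn t).+1%:R x)%:E); last first.
  by apply: ereal_sup_ubound; exists (Num.truncn t).+1.
have tk : (t <= (Num.truncn t).+1%:R)%R by rewrite ltW// truncnS_gt.
rewrite lee_fin (@le_trans _ _ (rphi x (Num.truncn t).+1%:R / (Num.truncn t).+1%:R)%R)//.
  apply: convex_ratio_nd => //; [exact: rphi0|exact: rphi_convex].
apply: convex_ratio_le_increment => //; [exact: rphi0|exact: rphi_convex].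
Qed.

Lemma recession_cvg x : Omega x -> (slope k%:R x)%:E @[k --> \oo] --> recession phi x.
Proof.
move=> Ox; rewrite recessionE//; apply: ereal_nondecreasing_cvgn.
by move=> k l kl; rewrite lee_fin slope_nd// ler_nat.
Qed.

Lemma recession_ge0 x : Omega x -> 0 <= recession phi x.
Proof.
move=> Ox; apply: le_trans (slope_le_recession Ox (lexx 0%R)).
by rewrite lee_fin slope_ge0.
Qed.

Lemma recession_gt0 x : Omega x -> 0 < recession phi x.
Proof.
move=> Ox; have [A0 _ S0] := slope_gt0.
apply: lt_le_trans (slope_le_recession Ox (ler0n _ A0)).
by rewrite lte_fin S0.
Qed.

Lemma measurable_recession : measurable_fun Omega (recession phi).
Proof.
apply: (emeasurable_fun_cvg (fun (k : nat) x => (slope k%:R x)%:E)) => //.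
  by move=> k; apply/measurable_EFinP; apply: measurable_slope.
by move=> x Ox; exact: recession_cvg.
Qed.

Lemma conjugate_ge x s t : Omega x -> (0 <= s)%R ->
  (s * t - rphi x s)%:E <= conjugate phi x t.
Proof.
by move=> Ox s0; apply: ereal_sup_ubound; exists s => //; rewrite PhiE.
Qed.

Lemma conjugate_le x t (M : \bar R) : Omega x ->
  (forall s, (0 <= s)%R -> (s * t - rphi x s)%:E <= M) -> conjugate phi x t <= M.
Proof.
by move=> Ox h; apply: ge_ereal_sup => _ [s /= s0 <-]; rewrite PhiE//; exact: h.
Qed.

Lemma conjugate_ge0 x t : Omega x -> 0 <= conjugate phi x t.
Proof.
move=> Ox; have := conjugate_ge t Ox (lexx 0%R).
by rewrite mul0r rphi0// subr0.
Qed.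

(** The supremum may be restricted to rational [s]: on replacing [s] by a smaller rational,
    [- phi x s] does not decrease and the linear term loses at most [e]. *)
Lemma measurable_conjugate (h : 'rV[R]_n -> R) : measurable_fun Omega h ->
  (forall x, Omega x -> (0 <= h x)%R) ->
  measurable_fun Omega (fun x => conjugate phi x (h x)).
Proof.
move=> mh h0.
(* Numbers that code no rational give 0 and rationals enter by absolute value, so every [q k] is an
   admissible point of the supremum. *)
pose q k : R := if choice.unpickle k is Some r then `|ratr r : R|%R else 0%R.
have q0 k : (0 <= q k)%R by rewrite /q; case: choice.unpickle.
pose g k x : \bar R := (q k * h x - rphi x (q k))%:E.
have gE x : Omega x -> conjugate phi x (h x) = ereal_sup [set g k x | k in [set: nat]].
  move=> Ox; apply/eqP; rewrite eq_le; apply/andP; split; last first.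
    by apply: ge_ereal_sup => _ [k _ <-]; exact: conjugate_ge.
  apply: conjugate_le => // s s0; apply/lee_addgt0Pr => e e0.
  have [->|s_neq0] := eqVneq s 0%R.
    rewrite (@le_trans _ _ (g (choice.pickle (0 : rat)) x))//; last first.
      rewrite -[leLHS]adde0; apply: leeD; last by rewrite lee_fin ltW.
      by apply: ereal_sup_ubound; exists (choice.pickle (0 : rat)).
    by rewrite /g /q choice.pickleK rmorph0 normr0.
  have {}s0 : (0 < s)%R by rewrite lt0r s_neq0.
  pose d := (e / (h x + 1))%R.
  have hx := h0 x Ox; have d0 : (0 < d)%R by rewrite divr_gt0// ltr_wpDl.
  have ms : (Num.max 0 (s - d) < s)%R by rewrite gt_max s0 gtrBl d0.
  have [r] := rat_in_itvoo ms.
  rewrite in_itv/= gt_max => /andP[/andP[r0 sdr] rs].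
  rewrite (@le_trans _ _ (g (choice.pickle r) x + e%:E))//; last first.
    apply: leeD => //.
    by apply: ereal_sup_ubound; exists (choice.pickle r).
  rewrite /g /q choice.pickleK (gtr0_norm r0) -EFinD lee_fin.
  have := rphi_nd Ox (ltW r0) (ltW rs).
  have : ((s - ratr r) * h x <= e)%R.
    have -> : e = (d * (h x + 1))%R by rewrite divfK// gt_eqF// ltr_wpDl.
    by apply: ler_pM => //; lra.
  by lra.
apply: (@eq_measurable_fun _ _ _ _ _ (fun x => esups (g ^~ x) 0%N)).
  move=> x /[!inE] Ox; rewrite gE// /esups; congr ereal_sup.
  by apply/seteqP; split => _ [k _ <-]; exists k.
apply: measurable_fun_esups => k.
apply/measurable_EFinP/measurable_funB; first exact: measurable_funM.
exact: (measurable_rphi (measurable_cst _) (fun x _ => q0 k)).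
Qed.

Section conjugate_below_slope.
Variables (x : 'rV[R]_n) (A : R).
Hypotheses (Ox : Omega x) (A0 : (0 <= A)%R).

Let A10 : (0 <= A + 1)%R. Proof. by rewrite addr_ge0. Qed.

(** Only [s] has to lie below the slope: its supremum lives on [[0, A + 1]], and the same test
    points bound the conjugate at [s'] from below. *)
Lemma conjugate_slope_le s s' : (0 <= s)%R -> (s <= slope A x)%R ->
  conjugate phi x s <= conjugate phi x s' + ((A + 1) * `|s - s'|)%:E.
Proof.
move=> s0 sS; apply: conjugate_le => // t t0.
have [tA|At] := leP t (A + 1)%R.
  apply: (@le_trans _ _ ((t * s' - rphi x t)%:E + ((A + 1) * `|s - s'|)%:E)).
    rewrite -EFinD lee_fin.
    have : (t * (s - s') <= (A + 1) * `|s - s'|)%R.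
      apply: (@le_trans _ _ (t * `|s - s'|)%R).
        by rewrite ler_wpM2l// ler_norm.
      by rewrite ler_wpM2r.
    by lra.
  by apply: leeD => //; exact: conjugate_ge.
apply: (@le_trans _ _ (((A + 1) * s' - rphi x (A + 1))%:E + ((A + 1) * `|s - s'|)%:E)).
  rewrite -EFinD lee_fin.
  have := @convex_increment_conj _ (rphi x) (rphi_convex Ox) A s t A0 s0 sS (ltW At).
  have : ((A + 1) * (s - s') <= (A + 1) * `|s - s'|)%R.
    by rewrite ler_wpM2l// ler_norm.
  by lra.
by apply: leeD => //; exact: conjugate_ge.
Qed.

Lemma conjugate_slope_bounded s : (0 <= s)%R -> (s <= slope A x)%R ->
  conjugate phi x s <= ((A + 1) * s)%:E.
Proof.
move=> s0 sS; apply: le_trans (conjugate_slope_le 0 s0 sS) _.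
rewrite subr0 ger0_norm// -[leRHS]add0e; apply: leeD => //.
by apply: conjugate_le => // t t0; rewrite mulr0 sub0r lee_fin oppr_le0 rphi_ge0.
Qed.

End conjugate_below_slope.

Lemma conjugate_quotient_le x a h s : Omega x -> (0 <= a)%R -> (0 < h)%R ->
  s = ((rphi x (a + h) - rphi x a) / h)%R ->
  conjugate phi x s <= (s * a - rphi x a + (rphi x (a + h) - rphi x a))%:E.
Proof.
move=> Ox a0 h0 ->; apply: conjugate_le => // t t0; rewrite lee_fin mulrC.
apply: convex_slope_conj => //.
- by move=> *; exact: rphi_nd.
- exact: rphi_convex.
Qed.

End generalized_Phi.

(** * Admissible fields are bounded by the recession function *)

(** The larger function may have infinite integral, as the modular and the recession integral
    may. *)
Lemma le_integral_ge0 d (T : measurableType d) (R : realType)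
    (mu : {measure set T -> \bar R}) (D : set T) (f1 f2 : T -> \bar R) :
  measurable D -> mu.-integrable D f1 -> measurable_fun D f2 ->
  (forall x, D x -> 0 <= f2 x)%E -> (forall x, D x -> f1 x <= f2 x)%E ->
  (\int[mu]_(x in D) f1 x <= \int[mu]_(x in D) f2 x)%E.
Proof.
move=> mD i1 m2 f20 f12.
have [->|foo] := eqVneq (\int[mu]_(x in D) f2 x)%E +oo%E; first exact: leey.
apply: le_integral => //; last by move=> x /[!inE] /f12.
apply/integrableP; split => //.
rewrite (eq_integral f2); first by rewrite ltey.
by move=> x /[!inE] Dx; rewrite gee0_abs// f20.
Qed.

Section lebesgue_cube.
Context {R : realType} {n : nat}.
Hypothesis n_gt0 : (0 < n)%N.
Local Open Scope ereal_scope.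
Implicit Types (x : 'rV[R]_n) (rho : R).

(** Left-open with corner [x]: the cubes avoid the singularity at [x] and, for [0 < n], shrink to
    the empty set with [rho]. *)
Definition half_cube x rho : set 'rV[R]_n :=
  [set y | forall i, (x ord0 i < y ord0 i <= x ord0 i + rho)%R].

Lemma measurable_half_cube x rho : measurable (half_cube x rho).
Proof.
rewrite (_ : half_cube x rho = \bigcap_(i in [set: 'I_n])
    ((fun y : 'rV[R]_n => y ord0 i) @^-1` `]x ord0 i, (x ord0 i + rho)%R])).
  apply: fin_bigcap_measurable => // i _.
  by rewrite -[X in measurable X]setTI; exact: measurable_coord_rV.
apply/seteqP; split => y; first by move=> h i _; rewrite /= in_itv/= h.
by move=> h i; have := h i I; rewrite /= in_itv.
Qed.

Lemma lebesgue_half_cube x rho : (0 < rho)%R ->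
  lebesgue_rV n (half_cube x rho) = (rho ^+ n)%:E.
Proof.
move=> rho0.
rewrite (_ : half_cube x rho =
    [set y | forall i, `]x ord0 i, (x ord0 i + rho)%R]%classic (y ord0 i)]).
  rewrite (@lebesgue_rV_box _ _ (fun i => `]x ord0 i, (x ord0 i + rho)%R]%classic));
    last by move=> i; exact: measurable_itv.
  rewrite (eq_bigr (fun=> rho%:E)) => [|i _].
    by rewrite prodEFin prodr_const card_ord.
  by rewrite lebesgue_measure_itv/= lte_fin ltrDl rho0 -EFinD addrAC subrr add0r.
by apply/seteqP; split => y h i; have := h i; rewrite /= in_itv.
Qed.

Lemma lebesgue_bounded_lty (D : set 'rV[R]_n) : measurable D -> bounded_set D ->
  lebesgue_rV n D < +oo.
Proof.
move=> mD [M [Mr MP]].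
pose r := (`|M| + 1)%R.
have r0 : (0 < r)%R by rewrite ltr_wpDl.
have DQ : D `<=` half_cube (const_mx (- r)%R) (r + r)%R.
  move=> x Dx i; rewrite !mxE.
  have : (`|x| <= (`|M| + 2^-1))%R.
    by apply: MP => //; rewrite (le_lt_trans (ler_norm M))// ltrDl invr_gt0.
  move/(le_trans (coord_le_norm x i)); rewrite ler_norml /r.
  have : (2^-1 < 1 :> R)%R by rewrite invf_lt1// ltr1n.
  by move=> h /andP[h1 h2]; apply/andP; split; lra.
apply: (@le_lt_trans _ _ (lebesgue_rV n (half_cube (const_mx (- r)%R) (r + r)%R))).
  by apply: le_measure => //; apply/mem_set => //; exact: measurable_half_cube.
by rewrite (lebesgue_half_cube _ (addr_gt0 r0 r0)) ltry.
Qed.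

(* The cubes [half_cube x0 rho] carry [rho ^+ n] of Lebesgue measure, so
   [c / enorm (x - x0) ^+ n] has integral bounded below on all of them. *)
Lemma not_integrable_enorm_power (D : set 'rV[R]_n) (psi : 'rV[R]_n -> \bar R)
    (x0 : 'rV[R]_n) (c r : R) :
  measurable D -> (lebesgue_rV n).-integrable D psi ->
  (0 < c)%R -> (0 < r)%R -> (forall x, (`|x - x0| <= r)%R -> D x) ->
  (forall x, (`|x - x0| <= r)%R -> x != x0 ->
    (c / enorm (x - x0) ^+ n - 1)%:E <= psi x) -> False.
Proof.
move=> mD ipsi c0 r0 rD psi_ge.
have [||m mE] := @density_measure _ _ _ (lebesgue_rV n) ((abse \o psi) \_ D).
- by move=> x; rewrite patchE; case: ifPn => _ //=; exact: abse_ge0.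
- by apply/(integrable_mkcond _ mD); exact: integrable_abse.
(* On the cube [enorm (x - x0) <= n * rho], so the lower bound has integral at least
   [2 * e - rho ^+ n]. This is at least [e] once [rho] is at most 1 and [e], while the integral of
   [|psi|] over the cubes tends to 0. *)
pose e := (c / n%:R ^+ n / 2)%R.
have nn0 : (0 < n%:R ^+ n :> R)%R by rewrite exprn_gt0// ltr0n.
have e0 : (0 < e)%R by rewrite !divr_gt0.
pose rho0 := Num.min r (Num.min 1 e)%R.
have rho00 : (0 < rho0)%R by rewrite !lt_min r0 e0 ltr01.
pose rho (k : nat) := (rho0 / k.+1%:R)%R.
have rhok0 k : (0 < rho k)%R by rewrite divr_gt0.
have rhole k : (rho k <= rho0)%R by rewrite ler_pdivrMr// ler_peMr ?ler1n// ltW.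
have [N mN] : exists N, m (half_cube x0 (rho N)) < e%:E.
  apply: nonincreasing_measure_lt.
  - by move=> k; exact: measurable_half_cube.
  - move=> k l kl; apply/subsetPset => x h i; have /andP[h1 h2] := h i.
    rewrite h1 (le_trans h2)//= lerD2l ler_pM2l// lef_pV2 ?posrE//.
    by rewrite ler_nat.
  - rewrite (_ : \bigcap_k _ = set0) ?measure0 ?lte_fin//.
    rewrite -subset0 => x h; pose i := Ordinal n_gt0.
    have /andP[xi _] := h 0%N I i.
    have d0 : (0 < (x ord0 i - x0 ord0 i) / rho0)%R by rewrite divr_gt0// subr_gt0.
    have [k kd] : exists k : nat, (k.+1%:R^-1 < (x ord0 i - x0 ord0 i) / rho0)%R.
      near \oo => k; exists k; near: k.
      exact: (near_infty_natSinv_lt (PosNum d0)).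
    have /andP[_] := h k I i; rewrite leNgt => /negP; apply.
    by move: kd; rewrite ltr_pdivlMr// mulrC ltrBrDl.
have QD x : half_cube x0 (rho N) x -> (`|x - x0| <= rho N)%R /\ x != x0.
  move=> xQ; split.
    apply: norm_rV_le => [|i]; first exact/ltW.
    have /andP[h1 h2] := xQ i; rewrite !mxE ger0_norm ?subr_ge0 ?(ltW h1)//.
    by rewrite lerBlDl.
  apply/eqP => xx0; have := xQ (Ordinal n_gt0).
  by rewrite xx0 ltxx.
have QDD : half_cube x0 (rho N) `<=` D.
  move=> x /QD[xr _]; apply: rD; rewrite (le_trans xr)//.
  by rewrite (le_trans (rhole N))// ge_min lexx.
have mQ := measurable_half_cube x0 (rho N).
suff : e%:E <= m (half_cube x0 (rho N)) by rewrite leNgt mN.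
rewrite mE//.
pose b := (c / (n%:R * rho N) ^+ n - 1)%R.
apply: (@le_trans _ _ (\int[lebesgue_rV n]_(x in half_cube x0 (rho N)) b%:E)).
  rewrite integral_cst// lebesgue_half_cube// -EFinM lee_fin /b exprMn.
  rewrite mulrBl mul1r invfM mulrA divfK ?expf_neq0 ?gt_eqF//.
  rewrite (_ : c / n%:R ^+ n = e + e)%R; last by rewrite /e -splitr.
  rewrite -addrA lerDl subr_ge0 (@le_trans _ _ (rho N))//.
    rewrite -(prednK n_gt0) exprS ler_piMr ?(ltW (rhok0 N))//.
    rewrite exprn_ile1 ?(ltW (rhok0 N))// (le_trans (rhole N))//.
    by rewrite !ge_min lexx orbT.
  by rewrite (le_trans (rhole N))// !ge_min lexx !orbT.
apply: le_integral_ge0 => //.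
- apply: (@measurable_bounded_integrable _ _ _ _ (cst b)) => //.
    by rewrite lebesgue_half_cube// ?ltry.
  by exists `|b|%R; split => // M bM x _ /=; exact: ltW.
- apply: (measurable_funS mD) => //.
  apply: (@eq_measurable_fun _ _ _ _ _ (abse \o psi)).
    by move=> x xD; rewrite patchE xD.
  exact: (measurableT_comp (@abse_measurable _ setT) (measurable_int _ ipsi)).
- by move=> x _; rewrite patchE; case: ifPn => _ //=; exact: abse_ge0.
- move=> x Qx; rewrite patchE mem_set; last exact: QDD.
  have [xr xx0] := QD x Qx.
  apply: (@le_trans _ _ (psi x)); last exact: lee_abs.
  apply: le_trans (psi_ge x _ xx0); last first.
    by rewrite (le_trans xr)// (le_trans (rhole N))// ge_min lexx.
  have ex0 : (0 < enorm (x - x0))%R.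
    rewrite lt0r enorm_ge0 andbT; apply: contra xx0 => /eqP/enorm_eq0/eqP.
    by rewrite subr_eq0.
  rewrite lee_fin lerD2r ler_pM2l// lef_pV2 ?posrE ?exprn_gt0 ?mulr_gt0 ?ltr0n//.
  rewrite lerXn2r ?nnegrE ?enorm_ge0 ?mulr_ge0 ?(ltW rho00)//.
  by rewrite (le_trans (enorm_le_norm _))// ler_wpM2l.
Unshelve. all: by end_near. Qed.

End lebesgue_cube.

Section admissible_fields.
Context {R : realType} {n : nat}.
Hypothesis n_gt0 : (0 < n)%N.
Variables (Omega : set 'rV[R]_n) (phi : 'rV[R]_n -> R -> \bar R).
Hypotheses (oO : open Omega) (phi_c : Phi_c Omega phi).
Hypotheses (phi_A0 : A0 Omega phi) (phi_aDec : aDec Omega phi).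
Hypothesis phi_VA1 : restricted_VA1 Omega phi.
Local Open Scope ereal_scope.

Let mO : measurable Omega. Proof. exact: open_measurable_rV. Qed.

(* If [enorm (w x0) > phi'_infty x0 = T], then (VA1) at [t = 1 / (T |x - x0|^n)] gives
   [phi^*(x, |w x|) >= d t - 1] near [x0], which is not integrable. *)
Lemma enorm_le_recession (w : 'rV[R]_n -> 'rV[R]_n) : C1_0 Omega w ->
  \int[lebesgue_rV n]_(x in Omega) conjugate phi x (enorm (w x)) < +oo ->
  forall x0, Omega x0 -> (enorm (w x0))%:E <= recession phi x0.
Proof.
move=> Cw conjoo x0 Ox0; rewrite leNgt; apply/negP => Tw.
have T0 := recession_gt0 phi_c phi_A0 phi_aDec Ox0.
have [T TE] : exists T, recession phi x0 = T%:E.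
  by move: T0 Tw; case: recession => // T _ _; exists T.
rewrite TE !lte_fin in T0 Tw.
(* One third of the gap is given to the continuity of [w] at [x0], one to the factor [1 + omega],
   and one is left as the coefficient of [t]. *)
pose d := ((enorm (w x0) - T) / 3)%R.
have d0 : (0 < d)%R by rewrite divr_gt0// subr_gt0.
have wd : (enorm (w x0) = T + 3 * d)%R by rewrite /d mulrCA divff// mulr1 addrC subrK.
have [_ /(_ 1%R ltr01)[om [om_ge0 om_nd om0 omcvg] va1]] := phi_VA1.
(* The bound 1 is for omega as an additive error. The bound [d / (T + d)] is for the factor: it
   gives [(T + d) * (1 + omega) <= T + 2 * d]. *)
pose eta := Num.min 1%R (d / (T + d))%R.
have eta0 : (0 < eta)%R by rewrite lt_min ltr01 divr_gt0// addr_gt0.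
have [r1 r10 om_le] : exists2 r1 : R, (0 < r1)%R &
    forall r, (0 < r)%R -> (r <= r1)%R -> om r <= eta%:E.
  have : \forall r \near 0^'+, om r < eta%:E.
    by apply: (omcvg [set y | y < eta%:E]); apply: open_nbhs_nbhs;
      split; [exact: open_ereal_lt_ereal|rewrite /= lte_fin].
  move=> [r1 /= r10 h].
  exists (r1 / 2)%R; first by rewrite divr_gt0.
  move=> r r0 rr1; rewrite ltW//; apply: h => //=.
  rewrite sub0r normrN gtr0_norm// (le_lt_trans rr1)//.
  by rewrite ltr_pdivrMr// ltr_pMr// ltr1n.
have cw := C1_0_enorm_continuous Cw.
have [r2 r20 near_x0] : exists2 r2 : R, (0 < r2)%R & forall x, (`|x - x0| <= r2)%R ->
    Omega x /\ (T + 2 * d < enorm (w x))%R.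
  have : nbhs x0 (Omega `&` [set x | (T + 2 * d < enorm (w x))%R]).
    apply: (@filterI _ (nbhs x0) _); first exact: open_nbhs_nbhs.
    have h : (T + 2 * d < enorm (w x0))%R by rewrite wd; lra.
    exact: (cw x0 _ (lt_nbhsr h)).
  move=> /nbhs_ballP[e /= e0 eP]; exists (e / 2)%R; first by rewrite divr_gt0.
  move=> x xx0; apply: eP; rewrite -ball_normE /= distrC (le_lt_trans xx0)//.
  by rewrite ltr_pdivrMr// ltr_pMr// ltr1n.
pose r := Num.min r2 (r1 / n%:R)%R.
have r0 : (0 < r)%R by rewrite lt_min r20 divr_gt0// ltr0n.
apply: (@not_integrable_enorm_power _ _ n_gt0 Omega
    (fun x => conjugate phi x (enorm (w x))) x0 (d / T)%R r) => //.
- apply/integrableP; split.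
    apply: measurable_conjugate => //; last by move=> x _; exact: enorm_ge0.
    apply: measurable_enorm => i.
    by apply: continuous_measurable_rV => //; exact: C1_0_coord_continuous Cw.
  rewrite (eq_integral (fun x => conjugate phi x (enorm (w x))))//.
  move=> x /[!inE] Ox; rewrite gee0_abs//.
  exact: conjugate_ge0 phi_c phi_A0 phi_aDec _ _ Ox.
- by rewrite divr_gt0.
- by move=> x xr; have [] := near_x0 x _ => //; rewrite (le_trans xr)// ge_min lexx.
move=> x xr xx0.
have [Ox wx] : Omega x /\ (T + 2 * d < enorm (w x))%R.
  by apply: near_x0; rewrite (le_trans xr)// ge_min lexx.
have ex0 : (0 < enorm (x - x0))%R.
  rewrite lt0r enorm_ge0 andbT; apply: contra xx0 => /eqP/enorm_eq0/eqP.
  by rewrite subr_eq0.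
have enr1 : (enorm (x - x0) <= r1)%R.
  rewrite (le_trans (enorm_le_norm _))// mulrC -ler_pdivlMr ?ltr0n//.
  by rewrite (le_trans xr)// ge_min lexx orbT.
set D := (enorm (x - x0) ^+ n)%R; have D0 : (0 < D)%R by rewrite exprn_gt0.
(* Since [phi x0 t <= T * t = 1 / D], this [t] is in the range of (VA1) for [K = 1]. *)
pose t := (1 / (T * D))%R.
have t0 : (0 < t)%R by rewrite divr_gt0// mulr_gt0.
have phit : (rphi phi x0 t <= T * t)%R.
  have := recession_ge phi_c phi_A0 phi_aDec Ox0 t0.
  by rewrite TE lee_fin ler_pdivrMr.
have TtE : (T * t = 1 / D)%R.
  by rewrite /t; field; rewrite !gt_eqF// mulr_gt0.
have phiE y s := @PhiE _ _ Omega phi phi_c phi_A0 phi_aDec y s.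
have in_r : in_range phi 1 x x0 t.
  rewrite /in_range phiE ?(ltW t0)//; apply/andP; split.
    by rewrite lee_fin (rphi_ge0 phi_c Ox0)// ltW.
  by rewrite inver gt_eqF// -EFinM lee_fin (le_trans phit)// TtE.
(* The pair is admissible because the recession function is finite at [x0]; nothing is known about
   it at [x]. *)
have := va1 x x0 t Ox Ox0 (ltW t0) _ in_r.
rewrite TE => /(_ (or_intror (ltry _))).
have omx := om_le _ ex0 enr1; have omx0 := om_ge0 _ (ltW ex0).
have [m mE] : exists m, om (enorm (x - x0)) = m%:E.
  by move: omx omx0; case: (om _) => // m _ _; exists m.
rewrite mE !lee_fin in omx omx0 *.
have m1 : (0 < 1 + m)%R by rewrite ltr_pwDl.
rewrite -EFinD inver gt_eqF// -EFinM /=.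
have tm0 : (0 <= t / (1 + m))%R by rewrite divr_ge0// ltW.
rewrite !phiE ?(ltW t0)// -EFinD lee_fin => phi_le.
apply: le_trans (conjugate_ge phi_c phi_A0 phi_aDec (enorm (w x)) Ox tm0).
rewrite lee_fin.
have -> : (d / T / D = d * t)%R by rewrite /t; field; rewrite !gt_eqF// mulr_gt0.
move: omx; rewrite le_min => /andP[m_le1]; rewrite ler_pdivlMr ?addr_gt0// => m_d.
have : (t * (T + d) <= t / (1 + m) * enorm (w x))%R.
  rewrite -mulrA ler_pM2l// mulrC ler_pdivlMr//.
  by nra.
by nra.
Qed.

End admissible_fields.

(** * The dual functional *)

Lemma EFin_Rintegral d (T : measurableType d) (R : realType)
    (mu : {measure set T -> \bar R}) (D : set T) (f : T -> R) : measurable D ->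
  mu.-integrable D (fun x => (f x)%:E) ->
  (\int[mu]_(x in D) (f x)%:E)%E = (\int[mu]_(x in D) f x)%:E.
Proof. by move=> mD fi; rewrite /Rintegral fineK// integrable_fin_num. Qed.

Section dual_functional.
Context {R : realType} {n : nat}.
Variables (Omega : set 'rV[R]_n) (phi : 'rV[R]_n -> R -> \bar R).
Hypotheses (bO : bounded_set Omega) (oO : open Omega) (phi_c : Phi_c Omega phi).
Hypotheses (phi_A0 : A0 Omega phi) (phi_aDec : aDec Omega phi).
Variables (u : 'rV[R]_n -> R) (g s : 'rV[R]_n -> 'rV[R]_n).
Variable Du : vector_measure R n.
Variable tau : {finite_measure set 'rV[R]_n -> \bar R}.
Local Notation mu := (lebesgue_rV n).
Hypothesis iu : mu.-integrable Omega (EFin \o u).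
Hypothesis DuE : is_derivative_measure Omega u Du.
Hypothesis ig : vintegrable mu Omega g.
Hypothesis is_ : vintegrable tau setT s.
Hypothesis Du_decomp : forall i A, measurable A -> A `<=` Omega ->
  (Du i A = \int[mu]_(x in A) (g x ord0 i)%:E + \int[tau]_(x in A) (s x ord0 i)%:E)%E.
Implicit Types w : 'rV[R]_n -> 'rV[R]_n.

Let mO : measurable Omega. Proof. exact: open_measurable_rV. Qed.

Let isO : vintegrable tau Omega s.
Proof. by move=> i; exact: (integrableS measurableT mO). Qed.

Section fixed_field.
Variables (w : 'rV[R]_n -> 'rV[R]_n) (Cw : C1_0 Omega w).

Lemma measurable_field i : measurable_fun Omega (fun x => w x ord0 i).
Proof. by apply: continuous_measurable_rV => //; exact: C1_0_coord_continuous Cw. Qed.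

Lemma integrable_field_dot (m : {measure set 'rV[R]_n -> \bar R}) v :
  vintegrable m Omega v -> m.-integrable Omega (fun x => (dot (w x) (v x))%:E).
Proof.
move=> iv; have [M wM] := C1_0_bounded Cw.
by apply: (integrable_dot mO iv measurable_field) => x _; exact: wM.
Qed.

Lemma integrable_u_divergence :
  mu.-integrable Omega (fun x => (u x * divergence w x)%:E).
Proof.
have [cd [M dM]] := C1_0_divergence Cw.
apply: (@integrableMl _ _ _ _ _ mO (EFin \o u) (divergence w)) => //.
  exact: continuous_measurable_rV.
by exists M; split => [|M' MM' x _]; [exact: num_real|rewrite /= (le_trans (dM x))// ltW].
Qed.

Lemma integral_u_divergence :
  \int[mu]_(x in Omega) (u x * divergence w x) =
  - (\int[mu]_(x in Omega) dot (w x) (g x) + \int[tau]_(x in Omega) dot (w x) (s x)).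
Proof.
have [M wM] := C1_0_bounded Cw.
apply: EFin_inj; rewrite -EFin_Rintegral//; last exact: integrable_u_divergence.
rewrite DuE// EFinN; congr (- _)%E.
have h i := integral_charge_density mO (ig i) (isO i) (Du_decomp i)
  (measurable_field i) (ex_intro _ M (fun x _ => le_trans (coord_le_enorm _ i) (wM x))).
under eq_bigr => i _.
  have [ii1 ii2 ->] := h i.
  rewrite (EFin_Rintegral mO ii1) (EFin_Rintegral mO ii2) -EFinD; over.
rewrite sumEFin big_split/= EFinD; congr (_%:E + _%:E)%E.
  by rewrite Rintegral_sum// => i; have [] := h i.
by rewrite Rintegral_sum// => i; have [] := h i.
Qed.

Lemma conjugate_ge0_field x : Omega x -> (0 <= conjugate phi x (enorm (w x)))%E.
Proof. exact: conjugate_ge0. Qed.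

Lemma measurable_conjugate_field :
  measurable_fun Omega (fun x => conjugate phi x (enorm (w x))).
Proof.
apply: measurable_conjugate => //; last by move=> x _; exact: enorm_ge0.
exact: measurable_enorm measurable_field.
Qed.

Lemma integrable_conjugate_field :
  (\int[mu]_(x in Omega) conjugate phi x (enorm (w x)) != +oo)%E ->
  mu.-integrable Omega (fun x => conjugate phi x (enorm (w x))).
Proof.
rewrite -ltey => h; apply/integrableP; split; first exact: measurable_conjugate_field.
rewrite (eq_integral (fun x => conjugate phi x (enorm (w x))))//.
by move=> x /[!inE] Ox; rewrite gee0_abs// conjugate_ge0_field.
Qed.

Lemma dual_functionalE :
  dual_functional Omega phi u w =
  if (\int[mu]_(x in Omega) conjugate phi x (enorm (w x)) == +oo)%E then -oo%E
  else (- (\int[mu]_(x in Omega) (dot (w x) (g x))%:E +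
           \int[tau]_(x in Omega) (dot (w x) (s x))%:E) -
        \int[mu]_(x in Omega) conjugate phi x (enorm (w x)))%E.
Proof.
rewrite /dual_functional; case: ifPn => // h.
rewrite (integralB mO integrable_u_divergence (integrable_conjugate_field h)).
rewrite (EFin_Rintegral mO integrable_u_divergence) integral_u_divergence.
rewrite (EFin_Rintegral mO (integrable_field_dot ig)).
by rewrite (EFin_Rintegral mO (integrable_field_dot isO)).
Qed.

End fixed_field.

Lemma dual_functional_le w : (0 < n)%N -> restricted_VA1 Omega phi -> C1_0 Omega w ->
  (dual_functional Omega phi u w <= modular Omega phi (fun x => enorm (g x)) +
    \int[tau]_(x in Omega) (recession phi x * (enorm (s x))%:E))%E.
Proof.
move=> n0 va1 Cw; rewrite dual_functionalE//; case: ifPn => [_|h]; first exact: leNye.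
have ic := integrable_conjugate_field Cw h.
(* This bound holds at every point of [Omega], so it may be integrated against [tau], whatever [tau]
   charges. *)
have wT := enorm_le_recession n0 oO phi_c phi_A0 phi_aDec va1 Cw.
rewrite -ltey in h; move/(_ h) in wT.
have idg := integrable_field_dot Cw ig; have ids := integrable_field_dot Cw isO.
rewrite (EFin_Rintegral mO idg) (EFin_Rintegral mO ids) -EFinD -EFinN opprD EFinD.
rewrite addeAC !EFinN -(EFin_Rintegral mO idg) -(EFin_Rintegral mO ids).
have mge : measurable_fun Omega (fun x => enorm (g x)).
  exact: measurable_enorm (vintegrable_measurable ig).
apply: leeD.
- have idg' : mu.-integrable Omega (fun x => (- dot (w x) (g x))%:E).
    by under eq_fun do rewrite EFinN; exact: integrableN.
  rewrite -integralN; last exact: integrable_add_def.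
  under eq_integral do rewrite -EFinN.
  rewrite -(integralB mO idg' ic).
  apply: le_integral_ge0 => //.
  + exact: integrableB.
  + by have [[_ /(_ _ mge) + _ _ _] _ _] := phi_c.
  + by move=> x Ox; exact: (Phi_ge0 phi_c).
  + move=> x Ox; rewrite /= ger0_norm ?enorm_ge0//.
    rewrite (PhiE phi_c phi_A0 phi_aDec Ox (enorm_ge0 _)).
    have := conjugate_ge phi_c phi_A0 phi_aDec (enorm (w x)) Ox (enorm_ge0 (g x)).
    case: conjugate => [c||]//; rewrite ?leNye// -EFinB !lee_fin => hc.
    have := dot_le (- w x) (g x); rewrite dotNl enormN; lra.
- have ids' : tau.-integrable Omega (fun x => (- dot (w x) (s x))%:E).
    by under eq_fun do rewrite EFinN; exact: integrableN.
  rewrite -integralN; last exact: integrable_add_def.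
  under eq_integral do rewrite -EFinN.
  apply: le_integral_ge0 => //.
  + apply: emeasurable_funM; first exact: measurable_recession.
    apply/measurable_EFinP; apply: measurable_enorm.
    exact: (vintegrable_measurable isO).
  + move=> x Ox; rewrite mule_ge0 ?lee_fin ?enorm_ge0//.
    exact: (recession_ge0 phi_c phi_A0 phi_aDec).
  + move=> x Ox; rewrite (@le_trans _ _ ((enorm (w x))%:E * (enorm (s x))%:E)%E)//.
      by rewrite -EFinM lee_fin -dotNl -(enormN (w x)) dot_le.
    by rewrite lee_wpmul2r ?lee_fin ?enorm_ge0// wT.
Qed.

(** * Lower bound: almost optimal fields, their C1 approximation, and the limit in A *)

Section lower_bound.
Variable N : set 'rV[R]_n.
Hypotheses (mN : measurable N) (muN0 : mu N = 0%E).
Hypothesis s0 : forall x, Omega x -> ~ N x -> s x = 0.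
Hypothesis phi_cont : jointly_continuous Omega phi.

Let muO : (mu Omega < +oo)%E. Proof. exact: lebesgue_bounded_lty. Qed.

Definition bounded_gradient (A : R) := Omega `&` [set x | enorm (g x) <= A].

Let menorm_g : measurable_fun Omega (fun x => enorm (g x)).
Proof. by apply: measurable_enorm; exact: vintegrable_measurable ig. Qed.

Let menorm_s : measurable_fun Omega (fun x => enorm (s x)).
Proof. by apply: measurable_enorm; exact: vintegrable_measurable isO. Qed.

Lemma measurable_bounded_gradient A : measurable (bounded_gradient A).
Proof.
rewrite /bounded_gradient (_ : [set x | _] =
  (fun x => enorm (g x)) @^-1` [set` `]-oo, A]]); first exact: menorm_g.
by apply/seteqP; split => x; rewrite /= in_itv.
Qed.

Let measurable_inv (f : 'rV[R]_n -> R) : measurable_fun Omega f ->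
  (forall x, 0 <= f x) -> measurable_fun Omega (fun x => (f x)^-1).
Proof.
move=> mf f0; under eq_fun do rewrite -powR_inv1//.
exact: (measurableT_comp (measurable_powR (-1))).
Qed.

Section almost_optimal_field.
Variables (A h : R).
Hypotheses (A0 : 0 <= A) (h0 : 0 < h) (h1 : h <= 1).

Definition quotient x : R :=
  (rphi phi x (enorm (g x) + h) - rphi phi x (enorm (g x))) / h.

(* On [N] it realizes [slope A x * enorm (s x)]; off [N] it is the direction of [g]
   with a difference quotient of [phi x] at [enorm (g x)] as length. *)
Definition opt_field x : 'rV[R]_n :=
  (\1_N x * (slope phi A x * (enorm (s x))^-1)) *: s x +
  (\1_(bounded_gradient A `\` N) x * (quotient x * (enorm (g x))^-1)) *: g x.

(** Since [h <= 1], the chord over [[|g|, |g| + h]] ends no later than [A + 1], so its slope is at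
    most that of the chord over [[A, A + 1]]. *)
Lemma quotient_bounds x : Omega x -> enorm (g x) <= A ->
  0 <= quotient x <= slope phi A x.
Proof.
move=> Ox gA; apply/andP; split.
  rewrite divr_ge0 ?(ltW h0)// subr_ge0.
  by apply: (rphi_nd phi_c phi_A0 phi_aDec Ox) => //; [exact: enorm_ge0|rewrite lerDl ltW].
rewrite -[leRHS]divr1; apply: convex_slope_le => //.
- exact: (rphi_convex phi_c phi_A0 phi_aDec Ox).
- exact: enorm_ge0.
- by rewrite lerD.
Qed.

(** An inequality, because for [v = 0] the inverse is 0 and so is the normalised vector. *)
Let normalized_le (v : 'rV[R]_n) (a b : R) : 0 <= a -> a <= b ->
  enorm ((a * (enorm v)^-1) *: v) <= b.
Proof.
move=> a0 ab; rewrite enormZ ger0_norm ?mulr_ge0 ?invr_ge0 ?enorm_ge0//.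
have [->|v0] := eqVneq (enorm v) 0; first by rewrite mulr0 (le_trans a0).
by rewrite divfK.
Qed.

Lemma opt_fieldN x : N x ->
  opt_field x = (slope phi A x * (enorm (s x))^-1) *: s x.
Proof.
move=> Nx; rewrite /opt_field !indicE mem_set// mul1r memNset; last by move=> [].
by rewrite mul0r scale0r addr0.
Qed.

Lemma opt_field_notN x : ~ N x -> opt_field x =
  if x \in bounded_gradient A then (quotient x * (enorm (g x))^-1) *: g x else 0.
Proof.
move=> Nx; rewrite /opt_field !indicE memNset// mul0r scale0r add0r.
have -> : (x \in bounded_gradient A `\` N) = (x \in bounded_gradient A).
  by apply/idP/idP => /set_mem; [move=> [? _]; exact/mem_set|move=> ?; exact/mem_set].
by case: ifPn => _; rewrite ?mul1r// mul0r scale0r.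
Qed.

Lemma enorm_opt_field x : Omega x -> enorm (opt_field x) <= slope phi A x.
Proof.
move=> Ox; have S0 := slope_ge0 phi_c phi_A0 phi_aDec Ox A0.
have [Nx|Nx] := pselect (N x); first by rewrite opt_fieldN// normalized_le.
rewrite opt_field_notN//; case: ifPn => [/set_mem[_ gA]|_]; last by rewrite enorm0.
by have /andP[q0 qS] := quotient_bounds Ox gA; exact: normalized_le.
Qed.

Lemma measurable_opt_field i : measurable_fun Omega (fun x => opt_field x ord0 i).
Proof.
have msl : measurable_fun Omega (slope phi A).
  exact: (measurable_slope phi_c phi_A0 phi_aDec).
have mq : measurable_fun Omega quotient.
  apply: measurable_funM; last exact: measurable_cst.
  apply: measurable_funB; apply: (measurable_rphi phi_c phi_A0 phi_aDec) => //.
  - exact: measurable_funD.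
  - by move=> x _; rewrite addr_ge0 ?enorm_ge0// ltW.
  - by move=> x _; exact: enorm_ge0.
rewrite (_ : (fun x => _) = fun x =>
  (\1_N x * (slope phi A x * (enorm (s x))^-1)) * s x ord0 i +
  (\1_(bounded_gradient A `\` N) x * (quotient x * (enorm (g x))^-1)) * g x ord0 i);
  last by apply/funext => x; rewrite !mxE.
have mi (f : 'rV[R]_n -> 'rV[R]_n) : measurable_fun Omega (fun x => enorm (f x)) ->
    measurable_fun Omega (fun x => (enorm (f x))^-1).
  by move=> mf; apply: measurable_inv => // x; exact: enorm_ge0.
apply: measurable_funD; apply: measurable_funM.
- apply: measurable_funM; first exact: measurable_indic.
  by apply: measurable_funM => //; exact: mi.
- exact: (vintegrable_measurable isO).
- apply: measurable_funM.
    by apply: measurable_indic; apply: measurableD => //; exact: measurable_bounded_gradient.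
  by apply: measurable_funM => //; exact: mi.
- exact: (vintegrable_measurable ig).
Qed.

Lemma dot_opt_field_s x : Omega x ->
  dot (opt_field x) (s x) = slope phi A x * enorm (s x).
Proof.
move=> Ox; have [Nx|Nx] := pselect (N x); last first.
  by rewrite s0// dotC dot0l enorm0 mulr0.
rewrite opt_fieldN// dotZl -sqr_enorm.
have [->|sx] := eqVneq (enorm (s x)) 0; first by rewrite expr0n !mulr0.
by rewrite expr2 -!mulrA mulKf.
Qed.

(** Near equality in Young's inequality: only [h * slope] is lost. Where [|g|] exceeds [A] the field
    is 0 and the conjugate at 0 is at most 0. *)
Lemma conjugate_opt_field_le x : Omega x -> ~ N x ->
  (conjugate phi x (enorm (opt_field x)) <=
   (dot (opt_field x) (g x) + h * slope phi A x -
    \1_(bounded_gradient A) x * rphi phi x (enorm (g x)))%:E)%E.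
Proof.
move=> Ox Nx; have S0 := slope_ge0 phi_c phi_A0 phi_aDec Ox A0.
have hS : 0 <= h * slope phi A x by rewrite mulr_ge0// ltW.
have c0 : (conjugate phi x 0 <= 0)%E.
  have := conjugate_slope_bounded phi_c phi_A0 phi_aDec Ox A0 (lexx 0) S0.
  by rewrite mulr0.
rewrite opt_field_notN// indicE; case: ifPn => [/set_mem[_ gA]|_]; last first.
  by rewrite enorm0 dot0l mul0r subr0 add0r (le_trans c0)// lee_fin.
rewrite mul1r; have /andP[q0 qS] := quotient_bounds Ox gA.
have [g0|g0] := eqVneq (enorm (g x)) 0.
  rewrite g0 invr0 mulr0 scale0r enorm0 dot0l add0r.
  by rewrite (rphi0 phi_c Ox) subr0 (le_trans c0)// lee_fin.
rewrite enormZ normrM (ger0_norm q0) normfV (ger0_norm (enorm_ge0 _)) divfK//.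
apply: le_trans (conjugate_quotient_le phi_c phi_A0 phi_aDec Ox
  (enorm_ge0 (g x)) h0 erefl) _.
rewrite -/(quotient x) lee_fin dotZl -sqr_enorm expr2 -!mulrA mulKf//.
have -> : rphi phi x (enorm (g x) + h) - rphi phi x (enorm (g x)) = h * quotient x.
  by rewrite mulrC divfK// gt_eqF.
have : h * quotient x <= h * slope phi A x by rewrite ler_pM2l.
lra.
Qed.

End almost_optimal_field.

(** Shrinking by [1 - th] makes the bound by the positive slope strict, and rounding towards zero
    keeps it strict and leaves finitely many values. On the exceptional set [E] both fields are
    bounded by [C], which gives the term [2 * C]. *)
Lemma C1_0_near_field (nu : {finite_measure set 'rV[R]_n -> \bar R})
    (v : 'rV[R]_n -> 'rV[R]_n) (A C e1 e2 : R) : 0 <= A -> 0 < C ->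
  (forall x, Omega x -> 0 < slope phi A x <= C) ->
  (forall i, measurable_fun Omega (fun x => v x ord0 i)) ->
  (forall x, Omega x -> enorm (v x) <= slope phi A x) -> 0 < e1 -> 0 < e2 ->
  exists w E, [/\ C1_0 Omega w, forall x, Omega x -> enorm (w x) <= slope phi A x,
    measurable E, (nu E < e2%:E)%E &
    forall x, Omega x -> enorm (w x - v x) <= e1 + 2 * C * \1_E x].
Proof.
move=> A0 C0 SC mv vS e10 e20.
(* Shrinking moves [v] by at most [th * C] and rounding by at most [n * d]; each is at most
   [e1 / 2]. *)
pose th := Num.min (2^-1) (e1 / (2 * C)).
have th0 : 0 < th by rewrite lt_min invr_gt0 ltr0n divr_gt0// mulr_gt0.
have th1 : th < 1 by rewrite gt_min invf_lt1 ?ltr1n.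
have thC : th * C <= e1 / 2.
  have : th <= e1 / (2 * C) by rewrite ge_min lexx orbT.
  rewrite -(ler_pM2r C0) => /le_trans; apply.
  by rewrite invfM mulrA divfK// gt_eqF.
pose d := e1 / (2 * n.+1%:R).
have d0 : 0 < d by rewrite divr_gt0// mulr_gt0.
have nd : n%:R * d <= e1 / 2.
  have -> : n%:R * d = (e1 / 2) * (n%:R / n.+1%:R) by rewrite /d; field.
  rewrite ler_piMr ?divr_ge0 ?(ltW e10)//.
  by rewrite ler_pdivrMr// mul1r ler_nat.
pose v1 x := round_rV d ((1 - th) *: v x).
have v1v x : Omega x -> enorm (v1 x - v x) <= e1.
  move=> Ox; rewrite (_ : v1 x - v x =
      (v1 x - (1 - th) *: v x) + (- th) *: v x); last first.
    by apply/rowP => i; rewrite !mxE; ring.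
  rewrite (le_trans (enormD _ _))// enormZ normrN (gtr0_norm th0).
  rewrite [leRHS](splitr e1) lerD//.
    exact: le_trans (dist_round_rV_le d0 _) nd.
  apply: le_trans thC; rewrite ler_pM2l// (le_trans (vS x Ox))//.
  by have /andP[] := SC x Ox.
have v1S x : Omega x -> enorm (v1 x) < slope phi A x.
  move=> Ox; have /andP[S0 _] := SC x Ox.
  rewrite (le_lt_trans (enorm_round_rV_le d0 _))// enormZ ger0_norm ?subr_ge0 ?(ltW th1)//.
  rewrite (@le_lt_trans _ _ ((1 - th) * slope phi A x))//.
    by rewrite ler_pM2l ?subr_gt0// vS.
  by rewrite gtr_pMl// gtrBl.
have mv1 i : measurable_fun Omega (fun x => v1 x ord0 i).
  under eq_fun do rewrite !mxE.
  by apply: (measurableT_comp (measurable_round0 d0)); exact: measurable_funM.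
have [cs csP] := round_rV_bounded d0 n C.
have v1cs x : Omega x -> v1 x \in cs.
  move=> Ox; apply: csP; have /andP[_ SxC] := SC x Ox.
  rewrite enormZ ger0_norm ?subr_ge0 ?(ltW th1)//.
  apply: le_trans SxC; apply: le_trans (vS x Ox).
  by rewrite ler_piMl ?enorm_ge0// gerBl ltW.
have [w [E [Cw wS mE nuE wE]]] := @C1_0_approximation R n Omega (slope phi A)
  (fun x Ox => slope_ge0 phi_c phi_A0 phi_aDec Ox A0)
  (fun c => open_lt_slope oO phi_c phi_cont phi_A0 phi_aDec A0 (c := enorm c))
  nu v1 cs e2 bO mO mv1 v1S v1cs e20.
exists w, E; split => // x Ox; rewrite indicE.
have [xE|xE] := boolP (x \in E); last first.
  rewrite mulr0 addr0 wE//; first exact: v1v.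
  by move/negP: xE => h /mem_set.
have /andP[_ SxC] := SC x Ox.
rewrite mulr1 (le_trans (enormD _ _))// enormN -[leLHS]add0r lerD ?(ltW e10)//.
have -> : 2 * C = C + C by rewrite mulr_natl.
by rewrite lerD// (le_trans _ SxC)// ?wS ?vS.
Qed.

Let integrable_bounded (m : {measure set 'rV[R]_n -> \bar R}) (f : 'rV[R]_n -> R) :
  (m Omega < +oo)%E -> measurable_fun Omega f ->
  (exists M, forall x, Omega x -> `|f x| <= M) -> m.-integrable Omega (EFin \o f).
Proof.
move=> mO' mf [M fM]; apply: measurable_bounded_integrable => //.
exists M; split => [|M' MM' x Ox]; first exact: num_real.
by rewrite /= (le_trans (fM x Ox))// ltW.
Qed.

Lemma Rintegral_step (m : {finite_measure set 'rV[R]_n -> \bar R}) (a b : R)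
    (E : set 'rV[R]_n) : measurable E ->
  m.-integrable Omega (EFin \o (fun x => a + b * \1_E x)) /\
  \int[m]_(x in Omega) (a + b * \1_E x) =
    a * fine (m Omega) + b * fine (m (E `&` Omega)).
Proof.
move=> mE.
have mOoo : (m Omega < +oo)%E by rewrite ltey_eq fin_num_measure.
have ia : m.-integrable Omega (EFin \o (fun=> a)).
  by apply: integrable_bounded => //; exists `|a|.
have i1 : m.-integrable Omega (EFin \o (\1_E : 'rV[R]_n -> R)).
  apply: integrable_bounded => //; exists 1 => x _.
  by rewrite indicE; case: (_ \in _); rewrite ?normr0 ?normr1 ?ler01.
have ib : m.-integrable Omega (EFin \o (fun x => b * \1_E x)).
  exact: (integrableZl mO b i1).
split; first exact: (integrableD mO ia ib).
rewrite RintegralD// Rintegral_cst// RintegralZl//; congr (_ + _ * _).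
by rewrite /Rintegral integral_indic.
Qed.

(** The error has three shares of [e / 3]: [h * C * M] from the difference quotient, [e1 * P] from
    closeness on [Omega], and [2 * C * e2] from the set [E]. *)
Lemma dual_functional_lower_bound (A e : R) : 0 <= A ->
  (forall x, Omega x -> 0 < slope phi A x) -> 0 < e ->
  exists w, C1_0 Omega w /\
    (\int[mu]_(x in Omega)
       (\1_(bounded_gradient A) x * rphi phi x (enorm (g x)))%:E +
     \int[tau]_(x in Omega) (slope phi A x * enorm (s x))%:E <=
     dual_functional Omega phi u w + e%:E)%E.
Proof.
move=> A0 S0 e0.
have [C' C'0 SC'] := slope_bounded phi_c phi_A0 phi_aDec A0.
pose C := C' + 1; have C0 : 0 < C by rewrite ltr_wpDl.
have SC x : Omega x -> 0 < slope phi A x <= C.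
  by move=> Ox; rewrite S0//= (le_trans (SC' x Ox))// lerDl.
pose M := fine (mu Omega); have M0 : 0 <= M by rewrite fine_ge0.
pose h := Num.min 1 (e / 3 / (C * (M + 1))).
have h0 : 0 < h by rewrite lt_min ltr01 !divr_gt0// mulr_gt0// ltr_wpDl.
have h1 : h <= 1 by rewrite ge_min lexx.
have hCM : h * C * M <= e / 3.
  apply: (@le_trans _ _ (h * (C * (M + 1)))).
    by rewrite -mulrA !ler_pM2l// lerDl.
  by rewrite -ler_pdivlMr ?mulr_gt0 ?ltr_wpDl// ge_min lexx orbT.
pose v := opt_field A h.
have mv i : measurable_fun Omega (fun x => v x ord0 i) by exact: measurable_opt_field.
have vS x : Omega x -> enorm (v x) <= slope phi A x by move=> Ox; exact: enorm_opt_field.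
(* Replacing [v] by [w] changes [w . g] by at most [|w - v| |g|], and raises the conjugate by at
   most [(A + 1) |w - v|] compared with [v]. So [k] weighs the distance in the Lebesgue integral. *)
pose k x := enorm (g x) + (A + 1).
have A10 : 0 <= A + 1 by rewrite addr_ge0.
have k0 x : 0 <= k x by rewrite addr_ge0// enorm_ge0.
have mk : measurable_fun Omega k by exact: measurable_funD.
have iA : mu.-integrable Omega (EFin \o (fun=> A + 1)).
  by apply: integrable_bounded => //; exists `|A + 1|.
have ik : mu.-integrable Omega (EFin \o k).
  exact: (integrableD mO (integrable_enorm mO ig) iA).
have [nu1 nu1E] := density_measure_in mO (fun x _ => k0 x) ik.
have ies : tau.-integrable setT (fun x => (enorm (s x))%:E) by exact: integrable_enorm.
have [|nu2 nu2E] := density_measure _ ies.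
  by move=> x; rewrite lee_fin enorm_ge0.
have [nu nuE] := finite_measure_add nu1 nu2.
pose P := fine (nu Omega); have P0 : 0 <= P by rewrite fine_ge0.
pose e1 := e / 3 / (P + 1); pose e2 := e / 3 / (2 * C).
have e10 : 0 < e1 by rewrite !divr_gt0// ltr_wpDl.
have e20 : 0 < e2 by rewrite !divr_gt0// mulr_gt0.
have [w [E [Cw wS mE nuE2 wv]]] := C1_0_near_field nu A0 C0 SC mv vS e10 e20.
pose dl x := e1 + 2 * C * \1_E x.
have [idl1 dl1E] := Rintegral_step nu1 e1 (2 * C) mE.
have [idl2 dl2E] := Rintegral_step nu2 e1 (2 * C) mE.
have [ik1 k1E] := integral_density mO mk (fun x _ => k0 x) nu1E idl1.
have [ik2 k2E] := integral_density mO menorm_s (fun x _ => enorm_ge0 (s x))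
  (fun B mB _ => nu2E B mB) idl2.
have {}k1E : \int[mu]_(x in Omega) (dl x * k x) = \int[nu1]_(x in Omega) dl x.
  by rewrite /Rintegral k1E.
have {}k2E : \int[tau]_(x in Omega) (dl x * enorm (s x)) = \int[nu2]_(x in Omega) dl x.
  by rewrite /Rintegral k2E.
have err : \int[mu]_(x in Omega) (dl x * k x) +
    \int[tau]_(x in Omega) (dl x * enorm (s x)) <= e / 3 + e / 3.
  rewrite k1E k2E dl1E dl2E.
  have nuEO : fine (nu (E `&` Omega)) <= e2.
    have mEO : measurable (E `&` Omega) by exact: measurableI.
    rewrite -lee_fin fineK ?fin_num_measure// (le_trans _ (ltW nuE2))//.
    by apply: le_measure; rewrite ?inE.
  have nuD B : measurable B -> fine (nu B) = fine (nu1 B) + fine (nu2 B).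
    by move=> mB; rewrite nuE fineD// fin_num_measure.
  have P1 : e1 * P <= e / 3.
    rewrite /e1 mulrAC ler_pdivrMr ?ltr_wpDl// ler_pM2l ?divr_gt0// lerDl//.
  have C2 : 2 * C * fine (nu (E `&` Omega)) <= e / 3.
    by rewrite mulrC -ler_pdivlMr// mulr_gt0.
  move: P1 C2; rewrite /P !nuD//; last exact: measurableI.
  by lra.
pose c x := fine (conjugate phi x (enorm (w x))).
have conj_le x : Omega x -> (conjugate phi x (enorm (w x)) <= ((A + 1) * C)%:E)%E.
  move=> Ox; apply: le_trans (conjugate_slope_bounded phi_c phi_A0 phi_aDec Ox A0
    (enorm_ge0 _) (wS x Ox)) _.
  rewrite lee_fin ler_wpM2l// (le_trans (wS x Ox))//.
  by have /andP[] := SC x Ox.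
have conj_ge x := @conjugate_ge0_field w x.
have cE x : Omega x -> conjugate phi x (enorm (w x)) = (c x)%:E.
  move=> Ox; rewrite fineK// ge0_fin_numE; first exact: le_lt_trans (conj_le x Ox) (ltry _).
  exact: conj_ge.
have ic : mu.-integrable Omega (fun x => (c x)%:E).
  apply: integrable_bounded => //.
    apply/measurable_EFinP; apply: eq_measurable_fun (measurable_conjugate_field Cw).
    by move=> x /[!inE] Ox; rewrite cE.
  exists ((A + 1) * C) => x Ox; rewrite ger0_norm.
    by rewrite -lee_fin -cE//; exact: conj_le.
  by rewrite -lee_fin -cE//; exact: conj_ge.
have intc : (\int[mu]_(x in Omega) conjugate phi x (enorm (w x)) =
    (\int[mu]_(x in Omega) c x)%:E)%E.
  rewrite -EFin_Rintegral//; apply: eq_integral => x /[!inE]; exact: cE.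
have idg := integrable_field_dot Cw ig; have ids := integrable_field_dot Cw isO.
(* The sign undoes the minus of the integration by parts. *)
exists (fun x => - w x); split; first exact: C1_0N.
pose H x := \1_(bounded_gradient A) x * rphi phi x (enorm (g x)).
have mG := measurable_bounded_gradient A.
have iH : mu.-integrable Omega (fun x => (H x)%:E).
  apply: integrable_bounded => //.
    apply: measurable_funM; first exact: measurable_indic.
    by apply: (measurable_rphi phi_c phi_A0 phi_aDec) => // x _; exact: enorm_ge0.
  have [K K0 phiK] := rphi_bounded phi_c phi_A0 phi_aDec A0.
  exists K => x Ox; rewrite /H indicE.
  have [/set_mem[_ gA]|_] := boolP (x \in bounded_gradient A); last first.
    by rewrite mul0r normr0.
  rewrite mul1r ger0_norm ?(rphi_ge0 phi_c Ox) ?enorm_ge0//.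
  apply: le_trans (phiK x Ox).
  by apply: (rphi_nd phi_c phi_A0 phi_aDec Ox) => //; exact: enorm_ge0.
have iS : tau.-integrable Omega (fun x => (slope phi A x * enorm (s x))%:E).
  have msl := measurable_slope phi_c phi_A0 phi_aDec A0.
  apply: (@le_integrable _ _ _ _ _ mO _ (fun x => C%:E * (enorm (s x))%:E)%E).
  - by apply/measurable_EFinP; exact: measurable_funM.
  - move=> x Ox; rewrite -EFinM /= lee_fin !normrM ler_wpM2r//.
    by have /andP[S1 S2] := SC x Ox; rewrite !gtr0_norm.
  - by apply: integrableZl => //; exact: integrable_enorm.
have claim1 : \int[mu]_(x in Omega) H x - h * C * M <=
    \int[mu]_(x in Omega) dot (w x) (g x) - \int[mu]_(x in Omega) c x +
    \int[mu]_(x in Omega) (dl x * k x).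
  have icst : mu.-integrable Omega (EFin \o (fun=> h * C)).
    by apply: integrable_bounded => //; exists `|h * C|.
  have -> : h * C * M = \int[mu]_(x in Omega) (fun=> h * C) x by rewrite Rintegral_cst.
  rewrite -(RintegralB (f1 := H) (f2 := fun=> h * C) mO iH icst).
  rewrite -(RintegralB (f1 := fun x => dot (w x) (g x)) (f2 := c) mO idg ic).
  rewrite -(RintegralD (f1 := fun x => dot (w x) (g x) - c x)
    (f2 := fun x => dl x * k x) mO (integrableB mO idg ic) ik1).
  have i1 := integrableB mO iH icst.
  have i2 := integrableD mO (integrableB mO idg ic) ik1.
  have mON : measurable (Omega `\` N) by exact: measurableD.
  have subON : Omega `\` N `<=` Omega by move=> x [].
  (* On [N] the field is adapted to [s], and its conjugate is not compared with [g]; [N] is null for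
     the Lebesgue integrals. *)
  rewrite /Rintegral (negligible_integral mN mO i1 muN0) (negligible_integral mN mO i2 muN0).
  apply: le_Rintegral => //; [exact: integrableS i1|exact: integrableS i2|].
  move=> x [Ox Nx] /=.
  have /andP[S1 S2] := SC x Ox.
  have hS : h * slope phi A x <= h * C by rewrite ler_pM2l.
  have : c x <= dot (v x) (g x) + h * slope phi A x - H x + (A + 1) * enorm (w x - v x).
    rewrite -lee_fin -cE// EFinD.
    apply: le_trans (conjugate_slope_le phi_c phi_A0 phi_aDec Ox A0 (enorm (v x))
      (enorm_ge0 _) (wS x Ox)) _.
    apply: leeD; first exact: conjugate_opt_field_le.
    by rewrite lee_fin ler_wpM2l// ler_enorm_dist.
  have : dot (v x) (g x) - dot (w x) (g x) <= enorm (w x - v x) * enorm (g x).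
    by rewrite -dotBl enormB dot_le.
  have : enorm (w x - v x) * k x <= dl x * k x by rewrite ler_wpM2r// wv.
  by rewrite /k /dl => q1 q2 q3; lra.
have claim2 : \int[tau]_(x in Omega) (slope phi A x * enorm (s x)) <=
    \int[tau]_(x in Omega) dot (w x) (s x) + \int[tau]_(x in Omega) (dl x * enorm (s x)).
  rewrite -(RintegralD (f1 := fun x => dot (w x) (s x))
    (f2 := fun x => dl x * enorm (s x)) mO ids ik2).
  apply: le_Rintegral => //; first exact: (integrableD mO ids ik2).
  move=> x Ox; rewrite -(@dot_opt_field_s A h)//.
  have : dot (v x) (s x) - dot (w x) (s x) <= enorm (w x - v x) * enorm (s x).
    by rewrite -dotBl enormB dot_le.
  have : enorm (w x - v x) * enorm (s x) <= dl x * enorm (s x).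
    by rewrite ler_wpM2r ?enorm_ge0// wv.
  by rewrite -/v /dl => q1 q2; lra.
have Nw x : enorm (- w x) = enorm (w x) by exact: enormN.
rewrite dual_functionalE; last exact: C1_0N.
under [X in if X == _ then _ else _]eq_integral do rewrite Nw.
under [X in (_ - X)%E]eq_integral do rewrite Nw.
under [X in (- (X + _) - _)%E]eq_integral do rewrite dotNl.
under [X in (- (_ + X) - _)%E]eq_integral do rewrite dotNl.
rewrite intc /=.
have iN (m : {measure set 'rV[R]_n -> \bar R}) (f : 'rV[R]_n -> R) :
    m.-integrable Omega (fun x => (f x)%:E) ->
    (\int[m]_(x in Omega) (- f x)%:E = (- \int[m]_(x in Omega) f x)%:E)%E.
  move=> if_; under eq_integral do rewrite EFinN.
  by rewrite integralN ?EFin_Rintegral//; exact: integrable_add_def.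
rewrite !iN// (EFin_Rintegral mO iH) (EFin_Rintegral mO iS).
rewrite -EFinD -EFinN -EFinB -!EFinD lee_fin; lra.
Qed.

(** For fixed A the errors have been sent to 0; both truncated integrands increase with A, so
    monotone convergence applies even when a limit is infinite. *)
Lemma dual_modular_ge :
  (modular Omega phi (fun x => enorm (g x)) +
   \int[tau]_(x in Omega) (recession phi x * (enorm (s x))%:E) <=
   dual_modular Omega phi u)%E.
Proof.
have [k0 _ S0] := slope_gt0 phi_c phi_A0 phi_aDec.
(* The shift by [k0] makes all slopes positive. *)
pose A k : R := (k + k0)%:R.
have A0 k : 0 <= A k by exact: ler0n.
have A_nd k l : (k <= l)%N -> A k <= A l by rewrite ler_nat leq_add2r.
pose F k x := (\1_(bounded_gradient (A k)) x * rphi phi x (enorm (g x)))%:E.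
pose G k x := (slope phi (A k) x * enorm (s x))%:E.
have FG_le k : (\int[mu]_(x in Omega) F k x + \int[tau]_(x in Omega) G k x <=
    dual_modular Omega phi u)%E.
  apply/lee_addgt0Pr => e e0.
  have SA x : Omega x -> 0 < slope phi (A k) x.
    by apply: S0; rewrite ler_nat leq_addl.
  have [w [Cw wFG]] := dual_functional_lower_bound (A0 k) SA e0.
  by apply: le_trans wFG _; apply: leeD => //; apply: ereal_sup_ubound; exists w.
have rphi_g x : Omega x -> 0 <= rphi phi x (enorm (g x)).
  by move=> Ox; rewrite (rphi_ge0 phi_c Ox)// enorm_ge0.
have cF : (\int[mu]_(x in Omega) F k x @[k --> \oo] -->
    modular Omega phi (fun x => enorm (g x)))%E.
  have limF x : Omega x -> (F k x @[k --> \oo] --> phi x `|enorm (g x)|)%E.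
    move=> Ox; rewrite ger0_norm ?enorm_ge0//.
    rewrite (PhiE phi_c phi_A0 phi_aDec Ox (enorm_ge0 _)).
    apply: cvg_near_cst; exists (Num.truncn (enorm (g x))).+1 => // k /= gk.
    rewrite /F indicE mem_set ?mul1r//; split => //=.
    rewrite ltW// (lt_le_trans (truncnS_gt _))// ler_nat.
    by rewrite (leq_trans gk)// leq_addr.
  rewrite /modular; under eq_integral => x /[!inE] Ox.
    rewrite -(cvg_lim _ (limF x Ox))//; over.
  apply: cvg_monotone_convergence => //.
  - move=> k; apply/measurable_EFinP/measurable_funM.
      by apply: measurable_indic; exact: measurable_bounded_gradient.
    by apply: (measurable_rphi phi_c phi_A0 phi_aDec) => // x _; exact: enorm_ge0.
  - by move=> k x Ox; rewrite lee_fin mulr_ge0// rphi_g.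
  - move=> x Ox k l kl; rewrite lee_fin ler_wpM2r ?rphi_g// !indicE ler_nat.
    case: (boolP (x \in bounded_gradient (A k))) => // /set_mem[_ /= gk].
    by rewrite mem_set//; split => //=; rewrite (le_trans gk)// A_nd.
have cG : (\int[tau]_(x in Omega) G k x @[k --> \oo] -->
    \int[tau]_(x in Omega) (recession phi x * (enorm (s x))%:E))%E.
  have limG x : Omega x ->
      (G k x @[k --> \oo] --> recession phi x * (enorm (s x))%:E)%E.
    move=> Ox; rewrite /G; under eq_fun do rewrite EFinM.
    apply: cvgeZr => //.
    have := recession_cvg phi_c phi_A0 phi_aDec Ox.
    by rewrite -(cvg_shiftn k0).
  under [X in _ --> X]eq_integral => x /[!inE] Ox.
    rewrite -(cvg_lim _ (limG x Ox))//; over.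
  apply: cvg_monotone_convergence => //.
  - move=> k; apply/measurable_EFinP/measurable_funM => //.
    exact: (measurable_slope phi_c phi_A0 phi_aDec).
  - move=> k x Ox; rewrite lee_fin mulr_ge0 ?enorm_ge0//.
    exact: (slope_ge0 phi_c phi_A0 phi_aDec).
  - move=> x Ox k l kl; rewrite lee_fin ler_wpM2r ?enorm_ge0//.
    exact/(slope_nd phi_c phi_A0 phi_aDec Ox)/A_nd.
have m0 : (0 <= modular Omega phi (fun x => enorm (g x)))%E.
  by apply: integral_ge0 => x Ox; exact: (Phi_ge0 phi_c).
have r0 : (0 <= \int[tau]_(x in Omega) (recession phi x * (enorm (s x))%:E))%E.
  apply: integral_ge0 => x Ox; rewrite mule_ge0 ?lee_fin ?enorm_ge0//.
  exact: (recession_ge0 phi_c phi_A0 phi_aDec).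
(* Both limits are nonnegative, so their sum is defined even when infinite. *)
have cFG := cvgeD (ge0_adde_def m0 r0) cF cG.
have {}cFG := cFG (@filter_filter _ _ eventually_filter).
rewrite -(cvg_lim _ cFG)//; apply: lime_le; first by apply/cvg_ex; eexists; exact: cFG.
by apply: nearW => k; exact: FG_le.
Qed.

End lower_bound.
End dual_functional.

Theorem theorem6p4 (R : realType) (n : nat) (n_gt0 : (0 < n)%N)
    (Omega : set 'rV[R]_n) (phi : 'rV[R]_n -> R -> \bar R) :
  bounded_domain Omega ->
  Phi_c Omega phi -> jointly_continuous Omega phi ->
  A0 Omega phi -> aDec Omega phi -> restricted_VA1 Omega phi ->
  forall u : 'rV[R]_n -> R, BV Omega u ->
  forall (Du Ds : vector_measure R n) (g : 'rV[R]_n -> 'rV[R]_n),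
    is_derivative_measure Omega u Du ->
    is_lebesgue_decomposition Omega Du g Ds ->
    dual_modular Omega phi u =
    (modular Omega phi (fun x => enorm (g x)) +
     \int[vector_variation Ds]_(x in Omega) recession phi x)%E.
Proof.
move=> [bO oO _] phi_c phi_cont phi_A0 phi_aDec va1 u [iu _] Du Ds g DuE.
move=> [ig DuDs [N [mN muN0 DsN]]].
have mO : measurable Omega by exact: open_measurable_rV.
(* [Ds] vanishes on subsets of [Omega] outside [N], so its density can be taken zero at every point
   there. *)
have [tau [s [is_ DsE sN]]] := vector_measure_density (measurableD mO mN) DsN.
have Du_decomp i A : measurable A -> A `<=` Omega ->
    (Du i A = \int[lebesgue_rV n]_(x in A) (g x ord0 i)%:E +
              \int[tau]_(x in A) (s x ord0 i)%:E)%E.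
  by move=> mA AO; rewrite DuDs// DsE.
have s0 x : Omega x -> ~ N x -> s x = 0 by move=> Ox Nx; exact: sN.
rewrite (integral_vector_variation is_ DsE mO); last 2 first.
- exact: (measurable_recession phi_c phi_A0 phi_aDec).
- exact: (recession_ge0 phi_c phi_A0 phi_aDec).
apply/eqP; rewrite eq_le; apply/andP; split.
  by apply: ge_ereal_sup => _ [w Cw <-];
    exact: (dual_functional_le oO phi_c phi_A0 phi_aDec iu DuE ig is_ Du_decomp).
exact: (dual_modular_ge bO oO phi_c phi_A0 phi_aDec iu DuE ig is_ Du_decomp mN muN0).
Qed.
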